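(* Let $(M,L)$ be a Finsler manifold of scalar curvature $k$ and of dimension $n\ge4$, and let $\varepsilon\in C^\infty(\mathcal{T}M)$ be positively homogeneous of degree zero in $y$. Then $(M,L)$ is a Finsler manifold of $H_p$-scalar curvature $\varepsilon$ if and only if $$B^{k}(\overline{X},\overline{Y})=\alpha\,\hbar(\overline{X},\overline{Y})\quad\text{for all }\pi\text{-vector fields }\overline{X},\overline{Y},\qquad\text{where }\alpha=3(\varepsilon-k).$$
   Context: Pullback formalism. $M$ is a smooth $n$-dimensional manifold, $\pi:\mathcal{T}M\to M$ the bundle of nonzero tangent vectors, $\pi^{-1}(TM)\to\mathcal{T}M$ the pullback of $TM$. Sections of $\pi^{-1}(TM)$ are called $\pi$-vector fields (written with bars), tensor fields on $\pi^{-1}(TM)$ are called $\pi$-tensor fields, and $\overline{\eta}(u)=(u,u)$ is the fundamental $\pi$-vector field. There is an exact sequence $0\to\pi^{-1}(TM)\xrightarrow{\gamma}T(\mathcal{T}M)\xrightarrow{\rho}\pi^{-1}(TM)\to0$, with $\rho=(\pi_{\mathcal{T}M},\pi_* )$ (where $\pi_{\mathcal{T}M}:T(\mathcal{T}M)\to\mathcal{T}M$ is the projection) and $\gamma$ the vertical lift. A connection $D$ on $\pi^{-1}(TM)$ is regular if $T_u(\mathcal{T}M)=V_u\oplus H_u$ for all $u$, where $V_u$ is the vertical space and $H_u=\{X: D_X\overline{\eta}=0\}$; its horizontal map is $\beta=(\rho|_{H})^{-1}$. Torsion and curvature (note the sign convention) are $\mathbf{T}(X,Y)=D_X\rho Y-D_Y\rho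 X-\rho[X,Y]$ and $\mathbf{K}(X,Y)\rho Z=-D_XD_Y\rho Z+D_YD_X\rho Z+D_{[X,Y]}\rho Z$. The h-curvature is $R(\overline{X},\overline{Y})\overline{Z}=\mathbf{K}(\beta\overline{X},\beta\overline{Y})\overline{Z}$, the (v)h-torsion is $\widehat{R}(\overline{X},\overline{Y})=R(\overline{X},\overline{Y})\overline{\eta}$, and the (v)hv-torsion is $\widehat{P}(\overline{X},\overline{Y})=\mathbf{K}(\beta\overline{X},\gamma\overline{Y})\overline{\eta}$. For a Finsler manifold $(M,L)$ with Finsler metric $g$ on $\pi^{-1}(TM)$ (locally $g_{ij}=\frac12\partial^2L^2/\partial y^i\partial y^j$), the Berwald connection $D^{\circ}$ is the unique regular connection on $\pi^{-1}(TM)$ that is torsion-free ($\mathbf{T}^{\circ}=0$), has vanishing (v)hv-torsion, and satisfies $D^{\circ}_{h^{\circ}X}L=0$, $h^{\circ}=\beta\circ\rho$ being its horizontal projector. $R^{\circ}$ and $\widehat{R^{\circ}}$ denote its h-curvature and (v)h-torsion, $R^{\circ}(\overline{X},\overline{Y},\overline{Z},\overline{W}):=g(R^{\circ}(\overline{X},\overline{Y})\overline{Z},\overline{W})$, and $H(\overline{X}):=\widehat{R^{\circ}}(\overline{\eta},\overline{X})$ is the deviation tensor. The vertical covariant derivative $\stackrel{v}{D^{\circ}}$ is $(\stackrel{v}{D^{\circ}}A)(\overline{X},\dots)=(D^{\circ}_{\gamma\overline{X}}A)(\dots)$. Notation: $\ell(\overline{X}):=L^{-1}g(\overline{\eta},\overline{X})$,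 $\phi(\overline{X}):=\overline{X}-L^{-1}\ell(\overline{X})\overline{\eta}$, $\hbar(\overline{X},\overline{Y}):=g(\overline{X},\overline{Y})-\ell(\overline{X})\ell(\overline{Y})$, $\mathfrak{A}_{\overline{X},\overline{Y}}\{\omega(\overline{X},\overline{Y})\}:=\omega(\overline{X},\overline{Y})-\omega(\overline{Y},\overline{X})$. The projection operator $\mathcal{P}$ on a $(0,p)$ $\pi$-tensor field $\omega$ is $(\mathcal{P}\cdot\omega)(\overline{X}_1,\dots,\overline{X}_p):=\omega(\phi(\overline{X}_1),\dots,\phi(\overline{X}_p))$. For the function $k$ on $\mathcal{T}M$: $C^{k}(\overline{X}):=L(\stackrel{v}{D^{\circ}}k)(\overline{X})$ and $B^{k}(\overline{X},\overline{Y}):=L(\mathcal{P}\cdot\stackrel{v}{D^{\circ}}C^{k})(\overline{X},\overline{Y})$. Definitions: a Finsler manifold of dimension $n\ge3$ is of scalar curvature $k$, where $k\in C^\infty(\mathcal{T}M)$ is positively homogeneous of degree zero in $y$, if $H(\overline{X})=kL^2\phi(\overline{X})$. A Finsler manifold of dimension $n\ge4$ is of $H_p$-scalar curvature $\varepsilon$, where $\varepsilon\in C^\infty(\mathcal{T}M)$ is positively homogeneous of degree zero in $y$, if $(\mathcal{P}\cdot R^{\circ})(\overline{X},\overline{Y},\overline{Z},\overline{W})=\varepsilon\,\mathfrak{A}_{\overline{X},\overline{Y}}\{\hbar(\overline{X},\overline{Z})\hbar(\overline{Y},\overline{W})\}$. *)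

(* Defs.v *)
From HB Require Import structures.
From mathcomp Require Import all_boot all_order all_algebra.
From mathcomp Require Import all_classical all_reals all_analysis.

Set Implicit Arguments.
Unset Strict Implicit.
Unset Printing Implicit Defensive.

Import Order.TTheory GRing.Theory Num.Theory.
Import numFieldNormedType.Exports.

Local Open Scope classical_set_scope.
Local Open Scope ring_scope.

Definition iter_derive (R : realType) (V W : normedModType R)
    (f : V -> W) (s : seq V) : V -> W :=
  foldr (fun v (g : V -> W) x => 'D_v g x) f s.

(* C^oo on a neighbourhood of x: the iterated directional derivatives of all
   orders are differentiable, hence continuous, there. *)
Definition smooth_near (R : realType) (V W : normedModType R)
    (f : V -> W) (x : V) : Prop :=
  \forall y \near x, forall s : seq V, differentiable (iter_derive f s) y.

(* cmap is meaningful on cdom, and cinv on cmap @` cdom; both are junk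
   elsewhere. *)
Record chart (R : realType) (n : nat) (M : Type) := Chart {
  cdom : set M;
  cmap : M -> 'rV[R]_n;
  cinv : 'rV[R]_n -> M }.

(* An atlas is presented by a choice of one of its charts around each point p.
   The tangent space T_p M is 'rV[R]_n: a tangent vector is given by its
   components in the chart A p. *)
Definition atlas (R : realType) (n : nat) (M : Type) := M -> chart R n M.

Definition is_chart (R : realType) (n : nat) (M : topologicalType)
    (c : chart R n M) : Prop :=
  [/\ open (cdom c), open (cmap c @` cdom c),
      {in cdom c, cancel (cmap c) (cinv c)},
      {in cdom c, continuous (cmap c)} &
      {in cmap c @` cdom c, continuous (cinv c)}].

Definition is_smooth_manifold (R : realType) (n : nat) (M : topologicalType)
    (A : atlas R n M) : Prop :=
  [/\ hausdorff_space M, @second_countable M,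
      (forall p, is_chart (A p)),
      (forall p, cdom (A p) p) &
      (forall p q r, cdom (A p) r -> cdom (A q) r ->
         smooth_near (cmap (A q) \o cinv (A p)) (cmap (A p) r))].

(* Components in the chart d of the tangent vector at p whose components in the
   chart c are v. *)
Definition change (R : realType) (n : nat) (M : Type) (c d : chart R n M)
    (p : M) (v : 'rV[R]_n) : 'rV[R]_n :=
  'd (cmap d \o cinv c) (cmap c p) v.

Definition tangent_map (R : realType) (m n : nat) (M N : Type)
    (A : atlas R m M) (B : atlas R n N) (f : M -> N) (p : M)
    (v : 'rV[R]_m) : 'rV[R]_n :=
  'd (cmap (B (f p)) \o f \o cinv (A p)) (cmap (A p) p) v.

Definition smooth_fun_at (R : realType) (n : nat) (M : Type)
    (A : atlas R n M) (f : M -> R) (p : M) : Prop :=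
  smooth_near (f \o cinv (A p) : 'rV[R]_n -> R^o) (cmap (A p) p).

Definition dir (R : realType) (n : nat) (M : Type) (A : atlas R n M)
    (f : M -> R) (p : M) (v : 'rV[R]_n) : R :=
  'd (f \o cinv (A p) : 'rV[R]_n -> R^o) (cmap (A p) p) v.

(* Vector fields are functions X with X q in T_q M; vf_loc X p is the component
   function of X in the chart A p. *)
Definition vf_loc (R : realType) (n : nat) (M : Type) (A : atlas R n M)
    (X : M -> 'rV[R]_n) (p : M) (x : 'rV[R]_n) : 'rV[R]_n :=
  let q := cinv (A p) x in change (A q) (A p) q (X q).

Definition smooth_vf_at (R : realType) (n : nat) (M : Type) (A : atlas R n M)
    (X : M -> 'rV[R]_n) (p : M) : Prop :=
  smooth_near (vf_loc A X p) (cmap (A p) p).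

Definition lie_bracket (R : realType) (n : nat) (M : Type) (A : atlas R n M)
    (X Y : M -> 'rV[R]_n) (p : M) : 'rV[R]_n :=
  'd (vf_loc A Y p) (cmap (A p) p) (X p)
  - 'd (vf_loc A X p) (cmap (A p) p) (Y p).

(* Points of TM are pairs (p, v) with v in T_p M.  The bundle of nonzero
   tangent vectors is the open subset [slit] of TM; objects living on it are
   total functions on TM whose values off [slit] are never used. *)
Definition TM (R : realType) (n : nat) (M : Type) := (M * 'rV[R]_n)%type.

Definition slit (R : realType) (n : nat) (M : Type) : set (TM R n M) :=
  [set u | u.2 != 0].

(* The chart (x^i, y^i) of TM induced by the chart A u.1 of M. *)
Definition TM_atlas (R : realType) (n : nat) (M : Type) (A : atlas R n M) :
    atlas R (n + n) (TM R n M) := fun u =>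
  let c := A u.1 in
  {| cdom := [set w | cdom c w.1];
     cmap := fun w => row_mx (cmap c w.1) (change (A w.1) c w.1 w.2);
     cinv := fun z => let q := cinv c (lsubmx z) in
                      (q, change c (A q) q (rsubmx z)) |}.

Definition smooth_on_slit (R : realType) (n : nat) (M : Type)
    (A : atlas R n M) (f : TM R n M -> R) : Prop :=
  forall u, slit u -> smooth_fun_at (TM_atlas A) f u.

Definition pos_homogeneous0 (R : realType) (n : nat) (M : Type)
    (f : TM R n M -> R) : Prop :=
  forall u (t : R), slit u -> 0 < t -> f (u.1, t *: u.2) = f u.

(* The fibre of the pullback bundle over u is T_(u.1) M: a pi-vector field is a
   function Y with Y u in T_(u.1) M. *)
Definition pvf (R : realType) (n : nat) (M : Type) := TM R n M -> 'rV[R]_n.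

(* Vector fields on TM; X u is in T_u(TM), in the chart TM_atlas A u. *)
Definition tvf (R : realType) (n : nat) (M : Type) :=
  TM R n M -> 'rV[R]_(n + n).

(* Y is smooth on a neighbourhood of u: its components in the frame of
   coordinate vector fields of the chart A u.1 are. *)
Definition smooth_pvf_at (R : realType) (n : nat) (M : Type) (A : atlas R n M)
    (Y : pvf R n M) (u : TM R n M) : Prop :=
  smooth_near (fun z => let w := cinv (TM_atlas A u) z in
                        change (A w.1) (A u.1) w.1 (Y w))
              (cmap (TM_atlas A u) u).

Definition eta (R : realType) (n : nat) (M : Type) : pvf R n M := fun u => u.2.

(* rho_u : T_u(TM) -> T_(u.1) M is the differential of the projection; the
   other component of rho is the base point u, here the argument. *)
Definition rho (R : realType) (n : nat) (M : Type) (A : atlas R n M)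
    (u : TM R n M) (xi : 'rV[R]_(n + n)) : 'rV[R]_n :=
  tangent_map (TM_atlas A) A (fst : TM R n M -> M) u xi.

(* vertical lift: the velocity at t = 0 of the curve t |-> u + t v *)
Definition gam (R : realType) (n : nat) (M : Type) (A : atlas R n M)
    (u : TM R n M) (v : 'rV[R]_n) : 'rV[R]_(n + n) :=
  'D_1 (fun t : R^o => cmap (TM_atlas A u) (u.1, u.2 + t *: v)) 0.

Definition rho_vf (R : realType) (n : nat) (M : Type) (A : atlas R n M)
    (X : tvf R n M) : pvf R n M := fun u => rho A u (X u).

Definition gam_vf (R : realType) (n : nat) (M : Type) (A : atlas R n M)
    (Y : pvf R n M) : tvf R n M := fun u => gam A u (Y u).

(* D u xi Y is the covariant derivative at u, along xi in T_u(TM), of a section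
   Y smooth near u. *)
Definition connection (R : realType) (n : nat) (M : Type) :=
  forall u : TM R n M, 'rV[R]_(n + n) -> pvf R n M -> 'rV[R]_n.

(* A connection acts on local sections: the axioms are imposed on all sections
   smooth near u.  Locality is a consequence: the function which is 0 near u
   and 1 elsewhere is smooth near u, so it may be used in the Leibniz rule. *)
Definition is_connection (R : realType) (n : nat) (M : Type) (A : atlas R n M)
    (D : connection R n M) : Prop :=
  forall u, slit u ->
  [/\ (forall (a : R) xi zeta Y, smooth_pvf_at A Y u ->
         D u (a *: xi + zeta) Y = a *: D u xi Y + D u zeta Y),
      (forall xi Y Z, smooth_pvf_at A Y u -> smooth_pvf_at A Z u ->
         D u xi (fun w => Y w + Z w) = D u xi Y + D u xi Z),
      (forall xi (f : TM R n M -> R) Y,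
         smooth_fun_at (TM_atlas A) f u -> smooth_pvf_at A Y u ->
         D u xi (fun w => f w *: Y w) =
           dir (TM_atlas A) f u xi *: Y u + f u *: D u xi Y) &
      (forall X Y, smooth_vf_at (TM_atlas A) X u -> smooth_pvf_at A Y u ->
         smooth_pvf_at A (fun w => D w (X w) Y) u)].

Definition cov (R : realType) (n : nat) (M : Type) (D : connection R n M)
    (X : tvf R n M) (Y : pvf R n M) : pvf R n M := fun u => D u (X u) Y.

Definition vertical (R : realType) (n : nat) (M : Type) (A : atlas R n M)
    (u : TM R n M) : set 'rV[R]_(n + n) := [set xi | rho A u xi = 0].

Definition horizontal (R : realType) (n : nat) (M : Type)
    (D : connection R n M) (u : TM R n M) : set 'rV[R]_(n + n) :=
  [set xi | D u xi (@eta R n M) = 0].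

(* T_u(TM) is the direct sum of V_u and H_u. *)
Definition is_regular (R : realType) (n : nat) (M : Type) (A : atlas R n M)
    (D : connection R n M) : Prop :=
  forall u, slit u -> forall xi,
    exists! vh : 'rV[R]_(n + n) * 'rV[R]_(n + n),
      [/\ vertical A u vh.1, horizontal D u vh.2 & xi = vh.1 + vh.2].

(* When D is regular, the condition singles out exactly one xi. *)
Definition bet (R : realType) (n : nat) (M : Type) (A : atlas R n M)
    (D : connection R n M) (u : TM R n M) (v : 'rV[R]_n) : 'rV[R]_(n + n) :=
  xget 0 [set xi | horizontal D u xi /\ rho A u xi = v].

Definition bet_vf (R : realType) (n : nat) (M : Type) (A : atlas R n M)
    (D : connection R n M) (Y : pvf R n M) : tvf R n M :=
  fun u => bet A D u (Y u).

Definition torsion (R : realType) (n : nat) (M : Type) (A : atlas R n M)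
    (D : connection R n M) (X Y : tvf R n M) : pvf R n M := fun u =>
  cov D X (rho_vf A Y) u - cov D Y (rho_vf A X) u
  - rho A u (lie_bracket (TM_atlas A) X Y u).

(* The sign convention is the opposite of the most common one. *)
Definition curvature (R : realType) (n : nat) (M : Type) (A : atlas R n M)
    (D : connection R n M) (X Y : tvf R n M) (Z : pvf R n M) : pvf R n M :=
  fun u =>
  - cov D X (cov D Y Z) u + cov D Y (cov D X Z) u
  + cov D (lie_bracket (TM_atlas A) X Y) Z u.

Definition h_curvature (R : realType) (n : nat) (M : Type) (A : atlas R n M)
    (D : connection R n M) (X Y Z : pvf R n M) : pvf R n M :=
  curvature A D (bet_vf A D X) (bet_vf A D Y) Z.

Definition vh_torsion (R : realType) (n : nat) (M : Type) (A : atlas R n M)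
    (D : connection R n M) (X Y : pvf R n M) : pvf R n M :=
  h_curvature A D X Y (@eta R n M).

Definition vhv_torsion (R : realType) (n : nat) (M : Type) (A : atlas R n M)
    (D : connection R n M) (X Y : pvf R n M) : pvf R n M :=
  curvature A D (bet_vf A D X) (gam_vf A Y) (@eta R n M).

Definition deviation (R : realType) (n : nat) (M : Type) (A : atlas R n M)
    (D : connection R n M) (X : pvf R n M) : pvf R n M :=
  vh_torsion A D (@eta R n M) X.

(* g_u(v, w) = 1/2 (d^2 L^2 / dy^i dy^j) v^i w^j, the derivatives being taken
   in the fibre T_(u.1) M. *)
Definition fmetric (R : realType) (n : nat) (M : Type) (L : TM R n M -> R)
    (u : TM R n M) (v w : 'rV[R]_n) : R :=
  2^-1 * 'D_v (fun y : 'rV[R]_n =>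
                 'D_w (fun y' : 'rV[R]_n => (L (u.1, y') ^+ 2 : R^o)) y) u.2.

Definition is_finsler (R : realType) (n : nat) (M : Type) (A : atlas R n M)
    (L : TM R n M -> R) : Prop :=
  [/\ smooth_on_slit A L,
      (forall u, slit u -> 0 < L u),
      (forall p v (t : R), 0 <= t -> L (p, t *: v) = t * L (p, v)) &
      (forall u v, slit u -> v != 0 -> 0 < fmetric L u v v)].

(* By uniqueness of the Berwald connection, these axioms determine D on sections
   smooth near the points of [slit]. *)
Definition is_berwald (R : realType) (n : nat) (M : Type) (A : atlas R n M)
    (L : TM R n M -> R) (D : connection R n M) : Prop :=
  [/\ is_connection A D,
      is_regular A D,
      (forall u X Y, slit u ->
         smooth_vf_at (TM_atlas A) X u -> smooth_vf_at (TM_atlas A) Y u ->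
         torsion A D X Y u = 0),
      (forall u X Y, slit u -> smooth_pvf_at A X u -> smooth_pvf_at A Y u ->
         vhv_torsion A D X Y u = 0) &
      (forall u xi, slit u ->
         dir (TM_atlas A) L u (bet A D u (rho A u xi)) = 0)].

Definition ell (R : realType) (n : nat) (M : Type) (L : TM R n M -> R)
    (u : TM R n M) (v : 'rV[R]_n) : R :=
  (L u)^-1 * fmetric L u (eta u) v.

Definition hbar (R : realType) (n : nat) (M : Type) (L : TM R n M -> R)
    (u : TM R n M) (v w : 'rV[R]_n) : R :=
  fmetric L u v w - ell L u v * ell L u w.

Definition phi (R : realType) (n : nat) (M : Type) (L : TM R n M -> R)
    (X : pvf R n M) : pvf R n M :=
  fun u => X u - ((L u)^-1 * ell L u (X u)) *: eta u.

(* P . w, for w a pi-tensor field of type (0,2), resp. (0,4) *)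
Definition proj2 (R : realType) (n : nat) (M : Type) (L : TM R n M -> R)
    (w : pvf R n M -> pvf R n M -> TM R n M -> R) (X Y : pvf R n M) :
    TM R n M -> R :=
  w (phi L X) (phi L Y).

Definition proj4 (R : realType) (n : nat) (M : Type) (L : TM R n M -> R)
    (w : pvf R n M -> pvf R n M -> pvf R n M -> pvf R n M -> TM R n M -> R)
    (X Y Z W : pvf R n M) : TM R n M -> R :=
  w (phi L X) (phi L Y) (phi L Z) (phi L W).

Definition h_curvature4 (R : realType) (n : nat) (M : Type) (A : atlas R n M)
    (L : TM R n M -> R) (D : connection R n M) (X Y Z W : pvf R n M) :
    TM R n M -> R :=
  fun u => fmetric L u (h_curvature A D X Y Z u) (W u).

(* (D_(gamma X) f) and (D_(gamma X) w)(Y), for a function f and a pi-1-form w *)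
Definition vcov0 (R : realType) (n : nat) (M : Type) (A : atlas R n M)
    (f : TM R n M -> R) (X : pvf R n M) : TM R n M -> R :=
  fun u => dir (TM_atlas A) f u (gam_vf A X u).

Definition vcov1 (R : realType) (n : nat) (M : Type) (A : atlas R n M)
    (D : connection R n M) (w : pvf R n M -> TM R n M -> R)
    (X Y : pvf R n M) : TM R n M -> R :=
  fun u => dir (TM_atlas A) (w Y) u (gam_vf A X u)
           - w (cov D (gam_vf A X) Y) u.

Definition Ctensor (R : realType) (n : nat) (M : Type) (A : atlas R n M)
    (L k : TM R n M -> R) (X : pvf R n M) : TM R n M -> R :=
  fun u => L u * vcov0 A k X u.

Definition Btensor (R : realType) (n : nat) (M : Type) (A : atlas R n M)
    (L : TM R n M -> R) (D : connection R n M) (k : TM R n M -> R)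
    (X Y : pvf R n M) : TM R n M -> R :=
  fun u => L u * proj2 L (vcov1 A D (Ctensor A L k)) X Y u.

(* Tensor identities are stated at each u in [slit], for all pi-vector fields
   defined and smooth near u. *)
Definition scalar_curvature (R : realType) (n : nat) (M : Type)
    (A : atlas R n M) (L : TM R n M -> R) (D : connection R n M)
    (k : TM R n M -> R) : Prop :=
  [/\ (3 <= n)%N, smooth_on_slit A k, pos_homogeneous0 k &
      forall u X, slit u -> smooth_pvf_at A X u ->
        deviation A D X u = (k u * L u ^+ 2) *: phi L X u].

Definition Hp_scalar_curvature (R : realType) (n : nat) (M : Type)
    (A : atlas R n M) (L : TM R n M -> R) (D : connection R n M)
    (eps : TM R n M -> R) : Prop :=
  [/\ (4 <= n)%N, smooth_on_slit A eps, pos_homogeneous0 eps &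
      forall u X Y Z W, slit u ->
        smooth_pvf_at A X u -> smooth_pvf_at A Y u ->
        smooth_pvf_at A Z u -> smooth_pvf_at A W u ->
        proj4 L (h_curvature4 A L D) X Y Z W u =
          eps u * (hbar L u (X u) (Z u) * hbar L u (Y u) (W u)
                   - hbar L u (Y u) (Z u) * hbar L u (X u) (W u))].

(* Main.v *)
Require Import Defs.
From HB Require Import structures.
From mathcomp Require Import all_boot all_order all_algebra.
From mathcomp Require Import all_classical all_reals all_analysis.
From mathcomp Require Import ring lra.
Import Order.TTheory GRing.Theory Num.Theory.
Import numFieldNormedType.Exports.
Local Open Scope classical_set_scope.
Local Open Scope ring_scope.

(** Fix a point u of the slit tangent bundle and read everything in the chart
    (x, y) of TM induced by the chart of M around u.

    Evaluated on coordinate fields, whose brackets vanish, the torsion equation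
    says that the connection coefficients do not see vertical directions and
    are symmetric ([conn_coef_torsion]): the connection is given by functions
    G a b, bilinear and symmetric in a and b, and D along a vertical vector is
    the plain vertical derivative.  The horizontal lift of a is (a, - N a) with
    N a = G a y.  Vanishing (v)hv-torsion means that the vertical derivative of
    G, contracted with y, is 0 ([berwald_coef_vert]); hence G is the vertical
    derivative of N.  Writing R for the h-curvature and R^ a b = R a b y for the
    (v)h-torsion, it follows, with d_c the derivative along the vertical vector
    c, that
      d_c (R^ a b) = R a b c                          ([derive_hbracket]),
    while the symmetry of G gives the cyclic identity ([bianchi]).  For the
    deviation tensor H b = R^ y b these two facts give
      d_a (H b) - d_b (H a) = 3 R^ a b                ([jacobi_bracket]),
    so that 3 R is an antisymmetrized second vertical derivative of H
    ([hcurv_jacobi]).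

    For a metric of scalar curvature k, H b = k (L^2 b - g(y, b) y), where
    g(y, b) is half the vertical derivative of L^2 by homogeneity
    ([metric_eta]).  The projection kills y and the first derivatives of L^2, so
    only few terms of the second derivative of H survive.  With h for the
    angular metric, and since the projected second vertical derivative of k is
    L^-2 B^k ([BtensorE]), they are
      3 P.R(X,Y,Z,W) = B^k(Z,X) h(Y,W) - B^k(Z,Y) h(X,W)
                       + 3 k (h(X,Z) h(Y,W) - h(Y,Z) h(X,W))   ([proj4_B]).
    If B^k = 3 (eps - k) h, the right-hand side is 3 eps times the bracket of h.
    Conversely, if P.R is eps times that bracket, put Y = W = d for a nonzero d
    orthogonal to y and to the projection of X; such a d exists because the
    dimension exceeds 2 ([common_kernel]).  Both sides become multiples of
    h(d,d) > 0, and dividing gives B^k(Z,X) = 3 (eps - k) h(X,Z).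

    Two things have to be prepared.  The calculus of smooth maps, including the
    symmetry of second derivatives ([derive_comm]), is developed from the
    characterization of smoothness by iterated directional derivatives.  And all
    the given notions are defined, at each point, in the chart centred at that
    point, whereas the computation above differentiates them; so vectors,
    sections and brackets at nearby points are first transported to one fixed
    chart ([smooth_section_read], [lie_bracket_change], [pvf_read_cov]). *)

Set Implicit Arguments.
Unset Strict Implicit.
Unset Printing Implicit Defensive.

(** * Differentials *)

Section Differentials.
Variable R : realType.
Implicit Types V W : normedModType R.

Lemma near_eq_differentiable_diff V W (f g : V -> W) (x : V) :
  (\forall y \near x, f y = g y) -> differentiable f x ->
  differentiable g x /\ 'd g x = 'd f x :> (V -> W).
Proof.
move=> fg df.
have gx : g \o shift x = cst (g x) + 'd f x +o_ 0 id.
  apply/eqaddoP => e e0.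
  have /eqaddoP /(_ e e0) := diff_locally df.
  have : \forall h \near (0 : V), f (h + x) = g (h + x).
    by move: fg; rewrite (near_shift 0 x) /= => fg; near=> h; near: h;
      apply: filterS fg => h /=; rewrite subr0.
  apply: filterS2 => h fgh; rewrite !fctE /= fgh.
  by rewrite (nbhs_singleton fg).
have dg : 'd g x = 'd f x :> (V -> W).
  by apply: diff_unique => //; exact: diff_continuous.
split=> //; apply/diff_locallyP; rewrite dg; split=> //.
exact: diff_continuous.
Unshelve. all: by end_near. Qed.

Lemma near_eq_differentiable V W (f g : V -> W) (x : V) :
  (\forall y \near x, f y = g y) -> differentiable f x -> differentiable g x.
Proof. by move=> fg /(near_eq_differentiable_diff fg)[]. Qed.

Lemma near_eq_diff V W (f g : V -> W) (x : V) :
  (\forall y \near x, f y = g y) -> differentiable f x ->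
  'd g x = 'd f x :> (V -> W).
Proof. by move=> fg /(near_eq_differentiable_diff fg)[]. Qed.

(** The product rule for a scalar times a vector: compose the differential of the
    continuous bilinear map scaling with that of the pair (h, f). *)
Lemma is_diff_scale V W (h : V -> R^o) (f : V -> W) x :
  differentiable h x -> differentiable f x ->
  is_diff x (fun y => h y *: f y) (fun v => 'd h x v *: f x + h x *: 'd f x v).
Proof.
move=> dh df.
have sb : bilinear_for (GRing.Scale.Law.clone _ _ *:%R _)
   (GRing.Scale.Law.clone _ _ *:%R _) (@GRing.scale R W : R^o -> W -> W).
  split=> [u'|u] a x' y /=; first by rewrite scalerDl scalerA.
  by rewrite scalerDr !scalerA mulrC.
pose sM := bilinear_isBilinear.Build R R^o W W _ _ (@GRing.scale R W : R^o -> W ->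
  W) sb.
pose s : {bilinear R^o -> W -> W} := HB.pack (@GRing.scale R W : R^o -> W -> W) sM.
have sc : continuous (fun p : R^o * W => s p.1 p.2) by exact: scale_continuous.
have -> : (fun y => h y *: f y) = (fun p => s p.1 p.2) \o (fun y => (h y, f y)) by [].
have dhf := differentiable_pair dh df.
apply: DiffDef.
  by apply: differentiable_comp => //; exact: differentiable_bilin.
rewrite diff_comp //; last exact: differentiable_bilin.
rewrite diff_bilin //= diff_pair //; apply/funext => v /=.
by rewrite addrC.
Qed.

End Differentials.

(** * Differentiability classes *)

Section Smooth.
Variable R : realType.
Implicit Types V W : normedModType R.

(** Differentiability of all directional derivatives up to order n on U.  The
    recursion peels off the derivative taken first, so that products and
    composites, whose first derivatives are again sums of products and
    composites, can be treated by induction on n. *)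
Fixpoint Ck_on (n : nat) V W (U : set V) (f : V -> W) : Prop :=
  (forall x, U x -> differentiable f x) /\
  (if n is m.+1 then forall v, Ck_on m U ('D_v f) else True).

Lemma Ck_on_differentiable n V W (U : set V) (f : V -> W) x :
  Ck_on n U f -> U x -> differentiable f x.
Proof. by case: n => [|n] [df _]; exact: df. Qed.

Lemma Ck_on_derive n V W (U : set V) (f : V -> W) v :
  Ck_on n.+1 U f -> Ck_on n U ('D_v f).
Proof. by case=> _; exact. Qed.

Lemma Ck_onW n V W (U : set V) (f : V -> W) : Ck_on n.+1 U f -> Ck_on n U f.
Proof.
elim: n f => [|n IH] f [df Df]; split => // v.
exact: IH.
Qed.

Lemma Ck_on_subset n V W (U U' : set V) (f : V -> W) :
  U' `<=` U -> Ck_on n U f -> Ck_on n U' f.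
Proof.
move=> UU'; elim: n f => [|n IH] f [df Df]; split => //; do ?[by move=> x /UU'/df].
by move=> v; exact/IH/Df.
Qed.

(** In [iter_derive] the last direction of the list is the one along which the
    derivative is taken first, whence the use of [rcons]. *)
Lemma Ck_on_iterP n V W (U : set V) (f : V -> W) :
  Ck_on n U f <-> (forall s, (size s <= n)%N -> forall x, U x ->
                  differentiable (iter_derive f s) x).
Proof.
elim: n f => [|n IH] f.
  split=> [[df _] [|//] _|/(_ [::] isT) df]; first exact: df.
  by split.
split=> [[df Df] s|H].
  case/lastP: s => [_|s v]; first exact: df.
  rewrite size_rcons ltnS => sn x Ux; rewrite /iter_derive foldr_rcons.
  by have /IH := Df v; apply.
split; first exact: (H [::]).
move=> v; apply/IH => s sn x Ux.
by have := H (rcons s v); rewrite size_rcons ltnS /iter_derive foldr_rcons; apply.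
Qed.

(** One open set serves all orders at once, because [smooth_near] quantifies over
    the list of directions inside the neighbourhood. *)
Lemma smooth_nearP V W (f : V -> W) (x : V) :
  smooth_near f x <-> exists U, [/\ open U, U x & forall n, Ck_on n U f].
Proof.
split=> [|[U [oU Ux Cf]]].
  move=> fx; have : nbhs x [set y | forall s, differentiable (iter_derive f s) y] by [].
  rewrite nbhsE => -[U [oU Ux] UF].
  exists U; split=> // n; apply/Ck_on_iterP => s _ y Uy; exact: UF.
have : nbhs x U by exact: open_nbhs_nbhs.
apply: filterS => y Uy s.
by have /Ck_on_iterP := Cf (size s); apply.
Qed.

Lemma Ck_on_eq n V W (U : set V) (f g : V -> W) :
  open U -> (forall x, U x -> f x = g x) -> Ck_on n U f -> Ck_on n U g.
Proof.
move=> oU; elim: n f g => [|n IH] f g fg [df Df].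
all: have nfg x : U x -> \forall y \near x, f y = g y
  by move=> Ux; apply: filterS fg _; exact: open_nbhs_nbhs.
all: split => //; do ?[by move=> x Ux; apply: near_eq_differentiable (nfg _ Ux)
  (df _ Ux)].
move=> v; apply: IH (Df v) => x Ux.
exact/near_eq_derive/nfg.
Qed.

Lemma Ck_on_cst n V W (U : set V) (a : W) : open U -> Ck_on n U (fun=> a : W).
Proof.
move=> oU; elim: n a => [|n IH] a; split => //;
  do ?[by move=> x _; exact: differentiable_cst].
move=> v; rewrite (_ : 'D_v _ = fun=> 0) //; apply/funext => x; exact: derive_cst.
Qed.

Lemma Ck_on_add n V W (U : set V) (f g : V -> W) : open U ->
  Ck_on n U f -> Ck_on n U g -> Ck_on n U (fun x => f x + g x).
Proof.
move=> oU; elim: n f g => [|n IH] f g [df Df] [dg Dg]; split => //;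
  do ?[by move=> x Ux; apply: differentiableD; auto].
move=> v; apply: (@Ck_on_eq _ _ _ _ (fun x => 'D_v f x + 'D_v g x)) => //.
- move=> x Ux; rewrite -[RHS]/('D_v (f + g) x) deriveD //.
  + exact/diff_derivable/df.
  + exact/diff_derivable/dg.
- by apply: IH; [exact: Df|exact: Dg].
Qed.

Lemma Ck_on_sum n V W (U : set V) m (f : 'I_m -> V -> W) : open U ->
  (forall i, Ck_on n U (f i)) -> Ck_on n U (fun x => \sum_(i < m) f i x).
Proof.
move=> oU; elim: m f => [|m IH] f Cf.
  apply: (@Ck_on_eq _ _ _ _ (fun=> 0)) => //; last exact: Ck_on_cst.
  by move=> x _; rewrite big_ord0.
apply: (@Ck_on_eq _ _ _ _ (fun x => \sum_(i < m) f (widen_ord (leqnSn m) i)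
  x + f ord_max x)) => //.
  by move=> x _; rewrite big_ord_recr.
by apply: Ck_on_add => //; exact: IH.
Qed.

Lemma Ck_on_scale n V W (U : set V) (h : V -> R^o) (f : V -> W) : open U ->
  Ck_on n U h -> Ck_on n U f -> Ck_on n U (fun x => h x *: f x).
Proof.
move=> oU; elim: n h f => [|n IH] h f Ch Cf.
  split=> // x Ux; have [dh df] := (Ck_on_differentiable Ch Ux,
    Ck_on_differentiable Cf Ux).
  by case: (is_diff_scale dh df).
have dhf x : U x -> is_diff x (fun y => h y *: f y) (fun v =>
  'd h x v *: f x + h x *: 'd f x v).
  by move=> Ux; apply: is_diff_scale; [exact: Ck_on_differentiable Ch Ux|exact:
    Ck_on_differentiable Cf Ux].
split=> [x Ux|v]; first by case: (dhf x Ux).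
apply: (@Ck_on_eq _ _ _ _ (fun x => ('D_v h x : R^o) *: f x + h x *: 'D_v f x)) => //.
  move=> x Ux; have dx := dhf x Ux.
  rewrite [RHS]deriveE //.
  rewrite diff_val !deriveE //; [exact: Ck_on_differentiable Cf Ux|exact:
    Ck_on_differentiable Ch Ux].
apply: Ck_on_add => //; apply: IH; do ?[exact: Ck_onW]; exact: Ck_on_derive.
Qed.

Lemma rV_linear_sum m W (l : 'rV[R]_m -> W) : linear l ->
  forall x, l x = \sum_(i < m) x 0 i *: l (delta_mx 0 i).
Proof.
move=> ll x; pose lM := GRing.isLinear.Build _ _ _ _ _ ll.
pose l' : {linear 'rV[R]_m -> W} := HB.pack l lM.
rewrite -[LHS]/(l' x) [in LHS](row_sum_delta x) linear_sum.
by apply: eq_bigr => i _; rewrite linearZ.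
Qed.

Lemma derive_coord V m p (f : V -> 'M[R]_(m, p)) x v i j :
  differentiable f x ->
  'D_v (fun y => f y i j : R^o) x = 'D_v f x i j.
Proof.
by move=> df; rewrite derive_mx; [rewrite mxE|exact: diff_derivable].
Qed.

Lemma differentiable_coordf V m p (f : V -> 'M[R]_(m, p)) x i j :
  differentiable f x -> differentiable (fun y => f y i j : R^o) x.
Proof.
by move=> df; exact: (@differentiable_comp R V 'M[R]_(m, p) R^o f (fun N =>
  N i j) x df (differentiable_coord _ _ _)).
Qed.

Lemma Ck_on_coord n V m p (U : set V) (f : V -> 'M[R]_(m, p)) i j : open U ->
  Ck_on n U f -> Ck_on n U (fun x => f x i j : R^o).
Proof.
move=> oU; elim: n f => [|n IH] f [df Df];
  have dc x : U x -> differentiable (fun y => f y i j : R^o) x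
    by [move=> /df; exact: differentiable_coordf].
  by split.
split=> // v; apply: (@Ck_on_eq _ _ _ _ (fun x => 'D_v f x i j : R^o)) => //.
  by move=> x /df dfx; rewrite derive_coord.
exact/IH/Df.
Qed.

Lemma Ck_on_linear n V m W (U : set V) (f : V -> 'rV[R]_m) (l : 'rV[R]_m -> W) :
  open U -> linear l -> Ck_on n U f -> Ck_on n U (fun x => l (f x)).
Proof.
move=> oU ll Cf.
apply: (@Ck_on_eq _ _ _ _ (fun x => \sum_(i < m) (f x 0 i : R^o) *: l (delta_mx 0 i)))
  => //.
  by move=> x _; rewrite -rV_linear_sum.
apply: Ck_on_sum => // i; apply: Ck_on_scale => //; last exact: Ck_on_cst.
exact: Ck_on_coord.
Qed.

Lemma Ck_on_id n V (U : set V) : open U -> Ck_on n U (fun x : V => x).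
Proof.
move=> oU; case: n => [|n]; split => //.
by move=> v; rewrite (_ : 'D_v _ = fun=> v);
  [exact: Ck_on_cst|apply/funext => x; exact: derive_id].
Qed.

Lemma derive_comp_rV V m W (f : V -> 'rV[R]_m) (g : 'rV[R]_m -> W) x v :
  differentiable f x -> differentiable g (f x) ->
  'D_v (fun y => g (f y)) x =
  \sum_(i < m) 'D_v f x 0 i *: 'D_(delta_mx 0 i) g (f x).
Proof.
move=> df dg; rewrite deriveE; last exact: (differentiable_comp df dg).
rewrite (diff_comp df dg) /= (rV_linear_sum (l := 'd g (f x))); last exact: linearP.
by apply: eq_bigr => i _; rewrite -!deriveE.
Qed.

(** By the chain rule the derivative of a composite is a sum of products of
    coordinates of the derivative of f with composites of partial derivatives of
    g, all of them of one class lower. *)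
Lemma Ck_on_comp n V m W (U : set V) (U' : set 'rV[R]_m)
    (f : V -> 'rV[R]_m) (g : 'rV[R]_m -> W) : open U ->
  (forall x, U x -> U' (f x)) -> Ck_on n U' g -> Ck_on n U f ->
  Ck_on n U (fun x => g (f x)).
Proof.
move=> oU UU'; elim: n W g f UU' => [|n IH] W g f UU' Cg Cf;
  have Df x := @Ck_on_differentiable _ _ _ _ _ x Cf; have Dg x :=
    @Ck_on_differentiable _ _ _ _ _ x Cg;
  have dgf x : U x -> differentiable (fun x => g (f x)) x
   by [move=> Ux; exact: (differentiable_comp (Df _ Ux) (Dg _ (UU' _ Ux)))].
  by split.
split=> // v.
apply: (@Ck_on_eq _ _ _ _ (fun x => \sum_(i < m) ('D_v f x 0 i :
  R^o) *: 'D_(delta_mx 0 i) g (f x))) => //.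
  by move=> x Ux; rewrite derive_comp_rV //; [exact: Df|exact/Dg/UU'].
apply: (Ck_on_sum oU) => i; apply: (Ck_on_scale oU).
  by apply: (Ck_on_coord _ _ oU); exact: (Ck_on_derive v Cf).
by apply: (IH _ ('D_(delta_mx 0 i) g) f UU'); [exact: (Ck_on_derive _ Cg)|exact:
  Ck_onW].
Qed.

Lemma Ck_on_opp n V W (U : set V) (f : V -> W) : open U ->
  Ck_on n U f -> Ck_on n U (fun x => - f x).
Proof.
move=> oU Cf; apply: (@Ck_on_eq _ _ _ _ (fun x => (-1 : R^o) *: f x)) => //.
  by move=> x _; rewrite scaleN1r.
by apply: Ck_on_scale => //; exact: Ck_on_cst.
Qed.

(** The derivative of 1/h is - (1/h) (1/h) h', a product of functions known to be
    of class n by induction. *)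
Lemma Ck_on_inv n V (U : set V) (h : V -> R^o) : open U ->
  (forall x, U x -> h x != 0) -> Ck_on n U h -> Ck_on n U (fun x => (h x)^-1 : R^o).
Proof.
move=> oU h0; elim: n => [|n IH] Ch; have dh := Ck_on_differentiable Ch.
  by split=> // x Ux; apply: differentiableV; [exact: dh|exact: h0].
split=> [x Ux|v]; first by apply: differentiableV; [exact: dh|exact: h0].
pose i x : R^o := (h x)^-1.
apply: (@Ck_on_eq _ _ _ _ (fun x => - (i x *: (i x *: 'D_v h x)))) => //.
  move=> x Ux; have hx := dh _ Ux.
  rewrite [RHS]deriveV; [|exact: h0|exact: diff_derivable].
  by rewrite scaleNr scalerA /i expr2 invfM.
have Ci : Ck_on n U i by apply/IH/Ck_onW.
by apply: Ck_on_opp => //; do 2![apply: Ck_on_scale => //]; exact: Ck_on_derive.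
Qed.

End Smooth.

(** * Symmetry of second derivatives *)

Section Schwarz.
Variables (R : realType) (V : normedModType R).

(** Restricting f to a line turns a directional derivative into a derivative of one
    real variable, to which the mean value theorem applies. *)
Lemma is_derive_line (W : normedModType R) (f : V -> W) (p v : V) (t : R) :
  derivable f (t *: v + p) v ->
  is_derive (t : R^o) 1 (fun s : R^o => f (s *: v + p)) ('D_v f (t *: v + p)).
Proof.
move=> df.
have E : (fun h : R => h^-1 *: (((fun s : R^o => f (s *: v + p)) \o shift (t :
  R^o)) (h *: (1 : R^o))
    - f (t *: v + p))) =
  (fun h : R => h^-1 *: ((f \o shift (t *: v + p)) (h *: v) - f (t *: v + p))).
  by apply/funext => h /=; rewrite /shift /= scalerDl -addrA [h%:A]mulr1.
by apply: DeriveDef; rewrite /derivable /derive E.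
Qed.

Implicit Types f : V -> R^o.

(** The mean value theorem applied to t |-> f (t v + h w + x) - f (t v + x) writes
    the second difference as h times a difference of values of the first
    derivative along v; the differentiability of that derivative at x evaluates it up to
    o(h). *)
Lemma second_difference f (x v w : V) (e : R) : smooth_near f x -> 0 < e ->
  \forall h \near 0^'+, `|f (h *: v + (h *: w + x)) - f (h *: v + x)
     - f (h *: w + x) + f x - h ^+ 2 * 'D_w ('D_v f) x| <= e * h ^+ 2.
Proof.
move=> /smooth_nearP[U [oU Ux Cf]] e0.
have df y : U y -> differentiable f y by exact: (Ck_on_differentiable (Cf 0%N)).
have dDf : differentiable ('D_v f) x.
  exact: (Ck_on_differentiable (Ck_on_derive v (Cf 1%N))).
(* All points used lie within h c of x; the summand 1 keeps c positive. *)
pose c := `|v| + `|w| + 1.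
have c0 : 0 < c by rewrite ltr_wpDl // addr_ge0.
have c2 : 0 < e / (2 * c) by rewrite divr_gt0 // mulr_gt0.
have /eqaddoP /(_ _ c2) := diff_locally dDf.
have Un : nbhs x U by exact: open_nbhs_nbhs.
move: Un => /nbhs_ballP[r r0 rU] /nbhs_ballP[s s0 sD].
near=> h.
have h0 : 0 < h by near: h; exact: nbhs_right_gt.
have hr : h * c < r.
  rewrite -ltr_pdivlMr //; near: h; apply: nbhs_right_lt.
  by rewrite divr_gt0.
have hs : h * c < s.
  rewrite -ltr_pdivlMr //; near: h; apply: nbhs_right_lt.
  by rewrite divr_gt0.
have nrm (t : R) (b : bool) : 0 <= t <= h -> `|t *: v + (h *+ b) *: w| <= h * (`|v| +
  `|w|).
  move=> /andP[t0 th]; rewrite (le_trans (ler_normD _ _)) // !normrZ mulrDr.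
  rewrite ger0_norm // lerD // ?ler_wpM2r //.
  by case: b; rewrite ?mulr1n ?mulr0n ?normr0 ?mul0r ?mulr_ge0 ?ger0_norm // ltW.
have inball (t : R) (b : bool) (q : R) : 0 <= t <= h -> h * c < q ->
    `|t *: v + (h *+ b) *: w| < q.
  move=> th hq; apply: le_lt_trans hq; apply: (le_trans (nrm _ b th)).
  by rewrite ler_wpM2l ?(ltW h0) // /c lerDl.
have inU (t : R) (b : bool) : 0 <= t <= h -> U (t *: v + ((h *+ b) *: w + x)).
  move=> th; apply: rU; rewrite -ball_normE /= addrA opprD addrCA subrr addr0 normrN.
  exact: inball.
have rem (t : R) (b : bool) : 0 <= t <= h ->
   `|'D_v f (t *: v + ((h *+ b) *: w + x)) - ('D_v f x + 'd ('D_v f)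
     x (t *: v + (h *+ b) *: w))|
     <= e / (2 * c) * (h * (`|v| + `|w|)).
  move=> th; have := sD (t *: v + (h *+ b) *: w); rewrite -ball_normE /= sub0r normrN.
  move=> /(_ (inball _ _ _ th hs)); rewrite !fctE /= addrA => /le_trans; apply.
  by rewrite ler_wpM2l ?(ltW c2) // nrm.
pose g (t : R^o) : R^o := f (t *: v + (h *: w + x)) - f (t *: v + x).
pose dg (t : R^o) : R^o := 'D_v f (t *: v + (h *: w + x)) - 'D_v f (t *: v + x).
have inU1 t : 0 <= t <= h -> U (t *: v + (h *: w + x)) by move=> /inU-/(_ true).
have inU0 t : 0 <= t <= h -> U (t *: v + x).
  by move=> /inU-/(_ false); rewrite mulr0n scale0r add0r.
have gdg (t : R^o) : 0 <= t <= h -> is_derive t 1 g (dg t).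
  move=> th; apply: is_deriveB; apply: is_derive_line;
    apply/diff_derivable/df; [exact: inU1|exact: inU0].
have [t] : exists2 t, t \in `]0, h[%R & g h - g 0 = dg t * (h - 0).
  apply: MVT => // [t|].
    by rewrite in_itv /= => /andP[t0 th]; apply: gdg; rewrite !ltW.
  apply: derivable_within_continuous => t; rewrite in_itv /= => th.
  by have [] := gdg t th.
rewrite in_itv /= subr0 => /andP[t0 th]; rewrite /g !scale0r !add0r.
have {}th : 0 <= t <= h by rewrite !ltW.
rewrite opprB addrA => E; rewrite -[X in `|X - _|](_ : dg t * h = _); last first.
  by rewrite -E /=; ring.
have -> : 'D_w ('D_v f) x = 'd ('D_v f) x w by rewrite deriveE.
have -> : dg t * h - h ^+ 2 * 'd ('D_v f) x w =
   h * (('D_v f (t *: v + ((h *+ true) *: w + x)) - ('D_v f x + 'd ('D_v f)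
     x (t *: v + (h *+ true) *: w)))
   - ('D_v f (t *: v + ((h *+ false) *: w + x)) - ('D_v f x + 'd ('D_v f)
     x (t *: v + (h *+ false) *: w)))).
  rewrite mulr1n mulr0n !scale0r !add0r !addr0 /dg.
  have lZ (a : R) u : 'd ('D_v f) x (a *: u) = a * 'd ('D_v f) x u by rewrite linearZ.
  have -> : 'd ('D_v f) x (t *: v + h *: w) = t * 'd ('D_v f) x v + h * 'd ('D_v f) x w.
    by rewrite linearD !lZ.
  by rewrite lZ; ring.
rewrite normrM gtr0_norm // expr2 mulrA [e * h]mulrC -mulrA ler_pM2l //.
rewrite (le_trans (ler_normB _ _)) //.
apply: (le_trans (lerD (rem _ true th) (rem _ false th))).
rewrite [leLHS](_ : _ = (e * h) * ((`|v| + `|w|) / c)); last first.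
  by field; rewrite gt_eqF.
rewrite -[leRHS]mulr1 ler_wpM2l //; first by rewrite mulr_ge0 ?(ltW e0) ?(ltW h0).
by rewrite ltW // ltr_pdivrMr // mul1r /c ltrDl.
Unshelve. all: by end_near. Qed.

(** The second difference is symmetric in v and w, and divided by h^2 it tends to
    either of the two iterated derivatives. *)
Lemma derive_comm f (x v w : V) : smooth_near f x ->
  'D_v ('D_w f) x = 'D_w ('D_v f) x.
Proof.
move=> fx; apply/eqP; rewrite -subr_eq0 -normr_eq0 eq_le normr_ge0 andbT.
apply/ler_addgt0Pl => e e0; rewrite addr0.
have e20 : 0 < e / 2 by rewrite divr_gt0.
have H : \forall h \near (0 : R)^'+, `|'D_v ('D_w f) x - 'D_w ('D_v f) x| <= e.
  apply: filterS3 (second_difference v w fx e20)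
    (second_difference w v fx e20) (nbhs_right_gt 0) => h.
  rewrite [h *: w + (h *: v + x)]addrCA.
  set A := f _; set B := f _; set C := f _; set P := 'D_v _ x; set Q := 'D_w _ x.
  move=> H1; rewrite distrC => H2 h0; have h2 : 0 < h ^+ 2 by rewrite exprn_gt0.
  rewrite -(ler_pM2r h2) -{1}(gtr0_norm h2) -normrM.
  have -> : (P - Q) * h ^+ 2 = (h ^+ 2 * P - (A - C - B + f x)) + ((A - B - C + f x)
    - h ^+ 2 * Q).
    by ring.
  apply: (le_trans (ler_normD _ _)).
  by apply: (le_trans (lerD H2 H1)); rewrite -mulrDl -splitr.
have [h] := filter_ex H; exact.
Qed.

End Schwarz.

(** * Smooth maps near a point *)

Section SmoothNear.
Variable R : realType.
Implicit Types V W : normedModType R.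

Lemma smooth_near_near V W (f : V -> W) x :
  smooth_near f x -> \forall y \near x, smooth_near f y.
Proof. exact: near_join. Qed.

Lemma smooth_near_diff V W (f : V -> W) x : smooth_near f x -> differentiable f x.
Proof. by move=> /nbhs_singleton /(_ [::]). Qed.

Lemma smooth_near_derive V W (f : V -> W) x v :
  smooth_near f x -> smooth_near ('D_v f) x.
Proof.
apply: filterS => y H s; have := H (rcons s v).
by rewrite /iter_derive foldr_rcons.
Qed.

Lemma smooth_near_eq V W (f g : V -> W) x :
  (\forall y \near x, f y = g y) -> smooth_near f x -> smooth_near g x.
Proof.
rewrite -nbhs_nearE nbhsE => -[U1 [oU1 U1x] fg] /smooth_nearP[U [oU Ux Cf]].
apply/smooth_nearP; exists (U `&` U1); split=> //; first exact: openI.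
move=> n; apply: (@Ck_on_eq _ n _ _ _ f); first exact: openI.
  by move=> y [_ /fg].
by apply: Ck_on_subset (Cf n) => y [].
Qed.

Lemma smooth_near2 V W W1 W2 (f : V -> W) (g : V -> W1) (h : V -> W2) x :
  (forall n U, open U -> Ck_on n U f -> Ck_on n U g -> Ck_on n U h) ->
  smooth_near f x -> smooth_near g x -> smooth_near h x.
Proof.
move=> H /smooth_nearP[U [oU Ux Cf]] /smooth_nearP[U1 [oU1 U1x Cg]].
apply/smooth_nearP; exists (U `&` U1); split=> // [|n]; first exact: openI.
apply: H; first exact: openI.
  by apply: Ck_on_subset (Cf n) => y [].
by apply: Ck_on_subset (Cg n) => y [].
Qed.

Lemma smooth_near1 V W W1 (f : V -> W) (g : V -> W1) x :
  (forall n U, open U -> Ck_on n U f -> Ck_on n U g) ->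
  smooth_near f x -> smooth_near g x.
Proof.
move=> H fx; apply: (smooth_near2 _ fx fx) => n U oU Cf _; exact: H.
Qed.

Lemma smooth_near_cst V W (a : W) (x : V) : smooth_near (fun _ : V => a) x.
Proof.
apply/smooth_nearP; exists setT; split=> // [|n]; first exact: openT.
by apply: Ck_on_cst; exact: openT.
Qed.

Lemma smooth_near_id V (x : V) : smooth_near (fun y : V => y) x.
Proof.
apply/smooth_nearP; exists setT; split=> // [|n]; first exact: openT.
by apply: Ck_on_id; exact: openT.
Qed.

Lemma smooth_near_add V W (f g : V -> W) x :
  smooth_near f x -> smooth_near g x -> smooth_near (fun y => f y + g y) x.
Proof. by apply: smooth_near2 => n U; exact: Ck_on_add. Qed.

Lemma smooth_near_opp V W (f : V -> W) x :
  smooth_near f x -> smooth_near (fun y => - f y) x.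
Proof. by apply: smooth_near1 => n U; exact: Ck_on_opp. Qed.

Lemma smooth_near_sub V W (f g : V -> W) x :
  smooth_near f x -> smooth_near g x -> smooth_near (fun y => f y - g y) x.
Proof. by move=> fx gx; apply: smooth_near_add => //; exact: smooth_near_opp. Qed.

Lemma smooth_near_scale V W (h : V -> R^o) (f : V -> W) x :
  smooth_near h x -> smooth_near f x -> smooth_near (fun y => h y *: f y) x.
Proof. by apply: smooth_near2 => n U; exact: Ck_on_scale. Qed.

Lemma smooth_near_mul V (f g : V -> R^o) x :
  smooth_near f x -> smooth_near g x -> smooth_near (fun y => f y * g y : R^o) x.
Proof. exact: smooth_near_scale. Qed.

Lemma smooth_near_sum V W m (f : 'I_m -> V -> W) x :
  (forall i, smooth_near (f i) x) -> smooth_near (fun y => \sum_(i < m) f i y) x.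
Proof.
elim: m f => [|m IH] f fx.
  apply: (@smooth_near_eq _ _ (fun=> 0)); last exact: smooth_near_cst.
  by near=> y; rewrite big_ord0.
apply: (@smooth_near_eq _ _ (fun y => \sum_(i < m) f (widen_ord (leqnSn m) i)
  y + f ord_max y)).
  by near=> y; rewrite big_ord_recr.
by apply: smooth_near_add => //; exact: IH.
Unshelve. all: by end_near. Qed.

Lemma smooth_near_coord V m p (f : V -> 'M[R]_(m, p)) x i j :
  smooth_near f x -> smooth_near (fun y => f y i j : R^o) x.
Proof. by apply: smooth_near1 => n U; exact: Ck_on_coord. Qed.

Lemma smooth_near_linear V m W (f : V -> 'rV[R]_m) (l : 'rV[R]_m -> W) x :
  linear l -> smooth_near f x -> smooth_near (fun y => l (f y)) x.
Proof. by move=> ll; apply: smooth_near1 => n U oU; exact: Ck_on_linear. Qed.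

(** Smoothness of a family of linear maps applied to a varying vector: in
    coordinates it is a sum of products. *)
Lemma smooth_near_app V m W (B : V -> 'rV[R]_m -> W) (X : V -> 'rV[R]_m) x :
  (forall y, linear (B y)) -> (forall a, smooth_near (fun y => B y a) x) ->
  smooth_near X x -> smooth_near (fun y => B y (X y)) x.
Proof.
move=> lB Bx Xx.
apply: (@smooth_near_eq _ _ (fun y => \sum_(i < m) (X y 0 i :
  R^o) *: B y (delta_mx 0 i))).
  by near=> y; rewrite -rV_linear_sum.
apply: smooth_near_sum => i; apply: smooth_near_scale => //.
exact: smooth_near_coord.
Unshelve. all: by end_near. Qed.

Lemma smooth_near_comp V m W (f : V -> 'rV[R]_m) (g : 'rV[R]_m -> W) x :
  smooth_near f x -> smooth_near g (f x) -> smooth_near (fun y => g (f y)) x.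
Proof.
move=> fx /smooth_nearP[U1 [oU1 U1x Cg]].
have : nbhs x (f @^-1` U1).
  apply: (differentiable_continuous (smooth_near_diff fx)).
  exact: open_nbhs_nbhs.
rewrite nbhsE => -[U2 [oU2 U2x] U21].
move: fx => /smooth_nearP[U [oU Ux Cf]].
apply/smooth_nearP; exists (U `&` U2); split=> // [|n]; first exact: openI.
apply: (Ck_on_comp _ _ (Cg n)); first exact: openI.
  by move=> y [_ /U21].
by apply: Ck_on_subset (Cf n) => y [].
Qed.

Lemma smooth_near_inv V (h : V -> R^o) x :
  smooth_near h x -> h x != 0 -> smooth_near (fun y => (h y)^-1 : R^o) x.
Proof.
move=> hx hx0.
have : nbhs x (h @^-1` [set a | a != 0]).
  apply: (differentiable_continuous (smooth_near_diff hx)).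
  by apply: open_nbhs_nbhs; split => //; exact: open_neq.
rewrite nbhsE => -[U2 [oU2 U2x] U20].
move: hx => /smooth_nearP[U [oU Ux Cf]].
apply/smooth_nearP; exists (U `&` U2); split=> // [|n]; first exact: openI.
apply: Ck_on_inv; first exact: openI.
  by move=> y [_ /U20].
by apply: Ck_on_subset (Cf n) => y [].
Qed.

Lemma smooth_near_rV V m (f : V -> 'rV[R]_m) x :
  (forall i, smooth_near (fun y => f y 0 i : R^o) x) -> smooth_near f x.
Proof.
move=> fx.
apply: (@smooth_near_eq _ _ (fun y => \sum_(i < m) (f y 0 i : R^o) *: delta_mx 0 i)).
  by near=> y; rewrite -row_sum_delta.
apply: smooth_near_sum => i; apply: smooth_near_scale => //.
exact: smooth_near_cst.
Unshelve. all: by end_near. Qed.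

Lemma smooth_near_row_mx V m p (f : V -> 'rV[R]_m) (g : V -> 'rV[R]_p) x :
  smooth_near f x -> smooth_near g x ->
  smooth_near (fun y => row_mx (f y) (g y)) x.
Proof.
move=> fx gx; apply: smooth_near_rV => i.
rewrite (_ : (fun _ => _) = fun y => match fintype.split i with inl j =>
  f y 0 j | inr j => g y 0 j end);
  last by apply/funext => y; rewrite mxE.
by case: (fintype.split i) => j; exact: smooth_near_coord.
Qed.

Lemma derive_add V W (f g : V -> W) x v :
  differentiable f x -> differentiable g x ->
  'D_v (fun y => f y + g y) x = 'D_v f x + 'D_v g x.
Proof. by move=> df dg; rewrite -deriveD //; exact: diff_derivable. Qed.

Lemma derive_opp V W (f : V -> W) x v :
  differentiable f x -> 'D_v (fun y => - f y) x = - 'D_v f x.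
Proof. by move=> df; rewrite -deriveN //; exact: diff_derivable. Qed.

Lemma derive_sub V W (f g : V -> W) x v :
  differentiable f x -> differentiable g x ->
  'D_v (fun y => f y - g y) x = 'D_v f x - 'D_v g x.
Proof. by move=> df dg; rewrite -deriveB //; exact: diff_derivable. Qed.

Lemma differentiable_scale V W (h : V -> R^o) (f : V -> W) x :
  differentiable h x -> differentiable f x ->
  differentiable (fun y => h y *: f y) x.
Proof. by move=> dh df; case: (is_diff_scale dh df). Qed.

Lemma derive_scale V W (h : V -> R^o) (f : V -> W) x v :
  differentiable h x -> differentiable f x ->
  'D_v (fun y => h y *: f y) x = 'D_v h x *: f x + h x *: 'D_v f x.
Proof.
move=> dh df; have [dhf E] := is_diff_scale dh df.
by rewrite deriveE // E -!deriveE.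
Qed.

Lemma derive_mul V (f g : V -> R^o) x v :
  differentiable f x -> differentiable g x ->
  'D_v (fun y => f y * g y : R^o) x = 'D_v f x * g x + f x * 'D_v g x.
Proof. exact: derive_scale. Qed.

Lemma derive_lin V m W (f : V -> 'rV[R]_m) (l : 'rV[R]_m -> W) x v :
  linear l -> differentiable f x ->
  'D_v (fun y => l (f y)) x = l ('D_v f x).
Proof.
move=> ll df; rewrite [RHS]rV_linear_sum //.
rewrite (_ : (fun _ => _) = fun y => \sum_(i < m) (f y 0 i :
  R^o) *: l (delta_mx 0 i)); last first.
  by apply/funext => y; rewrite -rV_linear_sum.
have dfi i : differentiable (fun y => f y 0 i : R^o) x by exact: differentiable_coordf.
rewrite (_ : (fun _ => _) = \sum_(i < m) (fun y => (f y 0 i :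
  R^o) *: l (delta_mx 0 i))); last first.
  by apply/funext => y; rewrite fct_sumE.
have dl i : differentiable (fun y => (f y 0 i : R^o) *: l (delta_mx 0 i)) x.
  by apply: differentiable_scale => //; exact: differentiable_cst.
rewrite derive_sum => [|i]; last exact/diff_derivable.
apply: eq_bigr => i _; rewrite derive_scale //.
by rewrite derive_coord // (derive_cst (l _)) scaler0 addr0.
Qed.

(** The product rule for a family of linear maps B applied to a varying vector X.
    Applied to B y a = 'D_a f y it also differentiates derivatives along
    varying directions. *)
Lemma derive_app V m W (B : V -> 'rV[R]_m -> W) (X : V -> 'rV[R]_m) x v :
  (forall y, linear (B y)) -> (forall a, differentiable (fun y => B y a) x) ->
  differentiable X x ->
  'D_v (fun y => B y (X y)) x = 'D_v (fun y => B y (X x)) x + B x ('D_v X x).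
Proof.
move=> lB dB dX.
have dXi i : differentiable (fun y => X y 0 i : R^o) x by exact: differentiable_coordf.
have E (Y : V -> 'rV[R]_m) : differentiable Y x ->
  'D_v (fun y => B y (Y y)) x =
  \sum_(i < m) ('D_v Y x 0 i *: B x (delta_mx 0 i) + Y x 0 i *: 'D_v (fun y =>
    B y (delta_mx 0 i)) x).
  move=> dY; have dYi i : differentiable (fun y => Y y 0 i :
    R^o) x by exact: differentiable_coordf.
  rewrite (_ : (fun _ => _) = \sum_(i < m) (fun y => (Y y 0 i :
    R^o) *: B y (delta_mx 0 i))); last first.
    by apply/funext => y; rewrite fct_sumE -rV_linear_sum.
  have dl i : differentiable (fun y => (Y y 0 i : R^o) *: B y (delta_mx 0 i)) x.
    exact: differentiable_scale.
  rewrite derive_sum => [|i]; last exact/diff_derivable.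
  by apply: eq_bigr => i _; rewrite derive_scale // derive_coord.
rewrite E // E //.
rewrite [X in _ + X]rV_linear_sum // -big_split; apply: eq_bigr => i _ /=.
by rewrite (derive_cst (X x)) mxE scale0r add0r addrC.
Qed.

Lemma differentiable_app V m W (B : V -> 'rV[R]_m -> W) (X : V -> 'rV[R]_m) x :
  (forall y, linear (B y)) -> (forall a, differentiable (fun y => B y a) x) ->
  differentiable X x -> differentiable (fun y => B y (X y)) x.
Proof.
move=> lB dB dX.
rewrite (_ : (fun _ => _) = \sum_(i < m) (fun y => (X y 0 i :
  R^o) *: B y (delta_mx 0 i))); last first.
  by apply/funext => y; rewrite fct_sumE -rV_linear_sum.
by apply: differentiable_sum => i; apply: differentiable_scale => //;
  exact: differentiable_coordf.
Qed.

Lemma linear_near_ext V m W (B : V -> 'rV[R]_m -> W) (x : V) :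
  (\forall y \near x, linear (B y)) ->
  \forall y \near x, forall a, B y a = \sum_(i < m) a 0 i *: B y (delta_mx 0 i).
Proof. by apply: filterS => y lB a; rewrite -rV_linear_sum. Qed.

(** A version in which linearity may fail far from x: replace B by the map linear
    everywhere with the same values on the basis vectors. *)
Lemma derive_app_near V m W (B : V -> 'rV[R]_m -> W) (X : V -> 'rV[R]_m) (x : V) v :
  (\forall y \near x, linear (B y)) -> (forall a, differentiable (fun y => B y a) x) ->
  differentiable X x ->
  differentiable (fun y => B y (X y)) x /\
  'D_v (fun y => B y (X y)) x = 'D_v (fun y => B y (X x)) x + B x ('D_v X x).
Proof.
move=> lB dB dX; have E := linear_near_ext lB.
pose B' (y : V) (a : 'rV[R]_m) : W := \sum_(i < m) a 0 i *: B y (delta_mx 0 i).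
have lB' y : linear (B' y).
  move=> a u w; rewrite /B' scaler_sumr -big_split; apply: eq_bigr => i _ /=.
  by rewrite !mxE scalerDl scalerA.
have E1 a : \forall y \near x, B y a = B' y a by apply: filterS E => y ->.
have E2 : \forall y \near x, B y (X y) = B' y (X y) by apply: filterS E => y ->.
have dB' a : differentiable (fun y => B' y a) x by exact: near_eq_differentiable
  (E1 a) (dB a).
split.
  apply: (@near_eq_differentiable _ _ _ (fun y => B' y (X y))).
    by apply: filterS E2 => y.
  exact: differentiable_app.
rewrite (near_eq_derive _ E2) (near_eq_derive _ (E1 (X x))).
by rewrite (nbhs_singleton (E1 _)) derive_app.
Qed.

Lemma derive_linear_direction V W (f : V -> W) x (a : R) v w : differentiable f x ->
  'D_(a *: v + w) f x = a *: 'D_v f x + 'D_w f x.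
Proof. by move=> df; rewrite !deriveE // linearP. Qed.

Lemma derive_comm_rV V m (f : V -> 'rV[R]_m) x v w : smooth_near f x ->
  'D_v ('D_w f) x = 'D_w ('D_v f) x.
Proof.
move=> fx; have D1 u1 u2 i : 'D_u1 ('D_u2 f) x 0 i = 'D_u1 ('D_u2 (fun y => f y 0 i :
  R^o)) x.
  rewrite -derive_coord; last exact/smooth_near_diff/smooth_near_derive.
  apply: near_eq_derive; have := smooth_near_near fx.
  by apply: filterS => y /smooth_near_diff fy; rewrite derive_coord.
apply/rowP => i.
apply: (etrans (D1 v w i)).
apply: (etrans _ (esym (D1 w v i))).
exact: (derive_comm v w (smooth_near_coord 0 i fx)).
Qed.

(** Both sides are limits of the same difference quotients. *)
Lemma derive_comp_affine (V V' W : normedModType R) (g : V' -> W) (l : V -> V') x v v' :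
  (forall h : R, l (h *: v + x) = h *: v' + l x) ->
  'D_v (fun y => g (l y)) x = 'D_v' g (l x).
Proof.
move=> lh; have E : (fun h : R => h^-1 *: (((fun y => g (l y)) \o shift x) (h *: v)
  - g (l x))) =
  (fun h => h^-1 *: ((g \o shift (l x)) (h *: v') - g (l x))).
  by apply/funext => h /=; rewrite lh.
by rewrite /derive E.
Qed.

End SmoothNear.

#[local] Opaque diff derive.

(** * Changes of charts *)

Section Charts.
Variable R : realType.

(** What the sequel needs of an atlas.  It is stated on a bare type, since the
    tangent bundle is used without a topology: the fourth clause replaces the
    openness of the intersection of two chart domains. *)
Definition smooth_charts (m : nat) (N : Type) (B : atlas R m N) : Prop :=
  [/\ forall p, cdom (B p) p,
      forall p, open (cmap (B p) @` cdom (B p)),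
      forall p r, cdom (B p) r -> cinv (B p) (cmap (B p) r) = r,
      forall p q r, cdom (B p) r -> cdom (B q) r ->
        \forall z \near cmap (B p) r, cdom (B q) (cinv (B p) z) &
      forall p q r, cdom (B p) r -> cdom (B q) r ->
        smooth_near (cmap (B q) \o cinv (B p)) (cmap (B p) r)].

Section Transition.
Variables (m : nat) (N : Type) (B : atlas R m N) (gB : smooth_charts B).

Lemma cdom_center p : cdom (B p) p. Proof. by case: gB. Qed.

Lemma cinvK p r : cdom (B p) r -> cinv (B p) (cmap (B p) r) = r.
Proof. by case: gB => _ _ H _ _; exact: H. Qed.

Lemma near_cdom p q r : cdom (B p) r -> cdom (B q) r ->
  \forall z \near cmap (B p) r, cdom (B q) (cinv (B p) z).
Proof. by case: gB => _ _ _ H _; exact: H. Qed.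

Lemma near_image p r : cdom (B p) r ->
  \forall z \near cmap (B p) r, (cmap (B p) @` cdom (B p)) z.
Proof.
by move=> pr; apply: open_nbhs_nbhs; split; [case: gB|exists r].
Qed.

Lemma imageK p z : (cmap (B p) @` cdom (B p)) z -> cmap (B p) (cinv (B p) z) = z.
Proof. by case=> r pr <-; rewrite cinvK. Qed.

Lemma image_cdom p z : (cmap (B p) @` cdom (B p)) z -> cdom (B p) (cinv (B p) z).
Proof. by case=> r pr <-; rewrite cinvK. Qed.

Lemma near_cmapK p r : cdom (B p) r ->
  \forall z \near cmap (B p) r, cmap (B p) (cinv (B p) z) = z.
Proof. by move=> /near_image; apply: filterS => z /imageK. Qed.

Definition transition p q := cmap (B q) \o cinv (B p).

Lemma smooth_transition p q r : cdom (B p) r -> cdom (B q) r ->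
  smooth_near (transition p q) (cmap (B p) r).
Proof. by case: gB => _ _ _ _ H; exact: H. Qed.

Lemma transition_cmap p q r : cdom (B p) r -> transition p q (cmap (B p) r) =
  cmap (B q) r.
Proof. by move=> pr; rewrite /transition /= cinvK. Qed.

Lemma differentiable_transition p q r : cdom (B p) r -> cdom (B q) r ->
  differentiable (transition p q) (cmap (B p) r).
Proof. by move=> pr qr; exact/smooth_near_diff/smooth_transition. Qed.

Lemma changeE p q r v : change (B p) (B q) r v = 'd (transition p q) (cmap (B p) r) v.
Proof. by []. Qed.

Lemma change_linear p q r : linear (change (B p) (B q) r).
Proof. by move=> a u v; rewrite /change linearP. Qed.

Lemma change_id p r v : cdom (B p) r -> change (B p) (B p) r v = v.
Proof.
move=> pr; rewrite changeE (@near_eq_diff _ _ _ id).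
- by rewrite diff_val.
- by apply: filterS (near_cmapK pr) => z /esym.
- by [].
Qed.

(** The chain rule for f o (inverse of chart p) = (f o (inverse of chart q)) o
    (transition from p to q), valid near the point. *)
Lemma diff_read (W : normedModType R) (f : N -> W) p q r v :
  cdom (B p) r -> cdom (B q) r ->
  differentiable (f \o cinv (B q)) (cmap (B q) r) ->
  differentiable (f \o cinv (B p)) (cmap (B p) r) /\
  'd (f \o cinv (B p)) (cmap (B p) r) v =
  'd (f \o cinv (B q)) (cmap (B q) r) (change (B p) (B q) r v).
Proof.
move=> pr qr df; have dt := differentiable_transition pr qr.
have E : \forall z \near cmap (B p) r,
    ((f \o cinv (B q)) \o transition p q) z = (f \o cinv (B p)) z.
  apply: filterS (near_cdom pr qr) => z qz.
  by rewrite /transition /= cinvK.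
have df' : differentiable (f \o cinv (B q)) (transition p q (cmap (B p) r))
  by rewrite transition_cmap.
have dc := differentiable_comp dt df'.
split; first exact: near_eq_differentiable E dc.
have E1 := near_eq_diff E dc.
have E2 := diff_comp dt df'; rewrite (transition_cmap _ pr) in E2.
exact: (etrans (congr1 (@^~ v) E1) (congr1 (@^~ v) E2)).
Qed.

Lemma change_comp p q s r v : cdom (B p) r -> cdom (B q) r -> cdom (B s) r ->
  change (B q) (B s) r (change (B p) (B q) r v) = change (B p) (B s) r v.
Proof.
move=> pr qr sr; have df := differentiable_transition qr sr.
by rewrite [RHS](diff_read v pr qr df).2.
Qed.

Lemma changeK p q r v : cdom (B p) r -> cdom (B q) r ->
  change (B q) (B p) r (change (B p) (B q) r v) = v.
Proof. by move=> pr qr; rewrite change_comp // change_id. Qed.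

Lemma smooth_read (W : normedModType R) (f : N -> W) p q r :
  cdom (B p) r -> cdom (B q) r ->
  smooth_near (f \o cinv (B q)) (cmap (B q) r) ->
  smooth_near (f \o cinv (B p)) (cmap (B p) r).
Proof.
move=> pr qr sf.
have E : \forall z \near cmap (B p) r,
    (f \o cinv (B q)) (transition p q z) = (f \o cinv (B p)) z.
  apply: filterS (near_cdom pr qr) => z qz.
  by rewrite /transition /= cinvK.
apply: smooth_near_eq E _; apply: smooth_near_comp; first exact: smooth_transition.
by rewrite transition_cmap.
Qed.

End Transition.

Section Sections.
Variables (n : nat) (M : Type) (A : atlas R n M) (gA : smooth_charts A).
Variables (m : nat) (N : Type) (B : atlas R m N) (gB : smooth_charts B).
Variable pi : N -> M.
Hypothesis pi_cdom : forall p r, cdom (B p) r -> cdom (A (pi p)) (pi r).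
Hypothesis pi_smooth : forall p r, cdom (B p) r ->
  smooth_near (cmap (A (pi p)) \o pi \o cinv (B p)) (cmap (B p) r).

(** The components, in the charts centred at p and pi p,
  of a section Y of the pullback of
    the tangent bundle of M along pi : N -> M.  With pi the identity these are
    vector fields; with pi the projection of the tangent bundle, pi-vector
    fields. *)
Definition section_read (Y : N -> 'rV[R]_n) (p : N) (z : 'rV[R]_m) : 'rV[R]_n :=
  let w := cinv (B p) z in change (A (pi w)) (A (pi p)) (pi w) (Y w).

Lemma section_read_cmap Y p r : cdom (B p) r ->
  section_read Y p (cmap (B p) r) = change (A (pi r)) (A (pi p)) (pi r) (Y r).
Proof. by move=> pr; rewrite /section_read /= cinvK. Qed.

Lemma section_read_change Y p q r : cdom (B p) r -> cdom (B q) r ->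
  change (A (pi p)) (A (pi q)) (pi r) (section_read Y p (cmap (B p) r)) =
  section_read Y q (cmap (B q) r).
Proof.
move=> pr qr; rewrite !section_read_cmap // (change_comp gA) //; do ?exact: pi_cdom.
exact: cdom_center.
Qed.

(** Smoothness of a section does not depend on the chart in which it is read: the
    two readings differ by the differential of a transition map, applied along
    the base point. *)
Lemma smooth_section_read Y p q r : cdom (B p) r -> cdom (B q) r ->
  smooth_near (section_read Y p) (cmap (B p) r) -> smooth_near (section_read Y q)
    (cmap (B q) r).
Proof.
move=> pr qr sY.
pose t := transition A (pi p) (pi q).
pose g := cmap (A (pi p)) \o pi.
have sg : smooth_near (g \o cinv (B q)) (cmap (B q) r).
  by apply: (smooth_read (f := g) gB qr pr); exact: pi_smooth.
have gE : (g \o cinv (B q)) (cmap (B q) r) = cmap (A (pi p)) (pi r).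
  by rewrite /g /= cinvK.
have st : smooth_near t (cmap (A (pi p)) (pi r)).
  by apply: smooth_transition => //; exact: pi_cdom.
apply: (@smooth_near_eq _ _ _ (fun z => 'd t ((g \o cinv (B q)) z)
  (section_read Y p (transition B q p z)))).
  apply: filterS2 (near_cdom gB qr pr) (near_image gB qr) => z pz qz.
  have pqz : cdom (B q) (cinv (B q) z) by exact: image_cdom qz.
  rewrite -[X in section_read Y q X](imageK gB qz) -(section_read_change Y pz pqz).
  by rewrite changeE.
apply: (@smooth_near_app R 'rV_m n 'rV_n (fun z => 'd t ((g \o cinv (B q)) z))
  (fun z => section_read Y p (transition B q p z))) => [z|a|].
- exact: linearP.
- apply: (@smooth_near_eq _ _ _ (fun z => 'D_a t ((g \o cinv (B q)) z))).
    have := smooth_near_near st; rewrite -gE => H.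
    have : \forall z \near cmap (B q) r, smooth_near t ((g \o cinv (B q)) z).
      exact: (differentiable_continuous (smooth_near_diff sg) H).
    apply: filterS => z sz; exact: (deriveE a (smooth_near_diff sz)).
  apply: (@smooth_near_comp R 'rV_m n 'rV_n (g \o cinv (B q)) ('D_a t)) => //.
  by rewrite gE; exact: smooth_near_derive.
- apply: (@smooth_near_comp R 'rV_m m 'rV_n (transition B q p) (section_read Y p)).
    exact: smooth_transition.
  by rewrite transition_cmap.
Qed.

End Sections.

Section Bracket.
Variables (m : nat) (N : Type) (B : atlas R m N) (gB : smooth_charts B).

Lemma vf_loc_section_read : vf_loc B = section_read B B id. Proof. by []. Qed.

Lemma smooth_vf_loc_change X p q r : cdom (B p) r -> cdom (B q) r ->
  smooth_near (vf_loc B X p) (cmap (B p) r) ->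
  smooth_near (vf_loc B X q) (cmap (B q) r).
Proof.
rewrite vf_loc_section_read; apply: smooth_section_read => // {}p {}r pr.
apply: (@smooth_near_eq _ _ _ id); last exact: smooth_near_id.
by apply: filterS (near_cmapK gB pr) => z /= ->.
Qed.

(** The Lie bracket can be computed in any chart.  Differentiating the relation
    Z_p (t z) = 'd t z (Z_w z) between two readings produces a second derivative
    of the transition t, which is symmetric and cancels in the bracket. *)
Lemma lie_bracket_change X Y p w : cdom (B p) w ->
  smooth_vf_at B X w -> smooth_vf_at B Y w ->
  change (B w) (B p) w (lie_bracket B X Y w) =
  'd (vf_loc B Y p) (cmap (B p) w) (vf_loc B X p (cmap (B p) w))
  - 'd (vf_loc B X p) (cmap (B p) w) (vf_loc B Y p (cmap (B p) w)).
Proof.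
move=> pw sX sY; have ww := cdom_center gB w.
pose t := transition B w p; pose z0 := cmap (B w) w.
have st : smooth_near t z0 by exact: smooth_transition.
have H Z : smooth_vf_at B Z w -> forall v,
   'd (vf_loc B Z p) (cmap (B p) w) (change (B w) (B p) w v) =
   'D_v ('D_(Z w) t) z0 + change (B w) (B p) w ('d (vf_loc B Z w) z0 v).
  move=> sZ v; have sZp := smooth_vf_loc_change ww pw sZ.
  have Zw : vf_loc B Z w z0 = Z w by rewrite vf_loc_section_read section_read_cmap //=
    change_id.
  have E : \forall z \near z0, vf_loc B Z p (t z) = 'd t z (vf_loc B Z w z).
    apply: filterS2 (near_cdom gB ww pw) (near_image gB ww) => z pz wz.
    have wz' := image_cdom gB wz.
    by rewrite -[in RHS](imageK gB wz) -changeE (section_read_change gB gB (pi :=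
      id) _ Z wz' pz).
  have dt : differentiable t z0 by exact: smooth_near_diff.
  have dZ : differentiable (vf_loc B Z p) (t z0).
    rewrite (_ : t z0 = cmap (B p) w); last exact: (transition_cmap gB p ww).
    exact: (smooth_near_diff sZp).
  have E4 : 'd (vf_loc B Z p) (cmap (B p) w) (change (B w) (B p) w v) =
     'D_v (fun z => vf_loc B Z p (t z)) z0.
    have E1 := deriveE v (differentiable_comp dt dZ).
    have E3 := congr1 (@^~ v) (diff_comp dt dZ).
    rewrite (_ : t z0 = cmap (B p) w) in E3; last exact: (transition_cmap gB p ww).
    exact: (esym (etrans E1 E3)).
  apply: (etrans E4); apply: (etrans (near_eq_derive v E)).
  have E2 a : \forall z \near z0, 'D_a t z = 'd t z a.
    by apply: filterS (smooth_near_near st) => z /smooth_near_diff dz; rewrite deriveE.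
  have E5 := @derive_app R 'rV_m m 'rV_m (fun z => 'd t z) (vf_loc B Z w) z0 v
    (fun z => linearP _) _ (smooth_near_diff sZ).
  apply: (etrans (E5 _)) => [a|].
    apply: near_eq_differentiable (E2 a) _.
    exact/smooth_near_diff/smooth_near_derive.
  rewrite Zw (deriveE v (smooth_near_diff sZ)).
  exact: (congr1 (+%R^~ _) (esym (near_eq_derive v (E2 (Z w))))).
have ZE Z : vf_loc B Z p (cmap (B p) w) = change (B w) (B p) w (Z w).
  exact: (@section_read_cmap _ _ B _ _ B gB id Z p w pw).
rewrite /lie_bracket; apply: (etrans (linearB ('d t z0) _ _)).
apply: esym; apply: (etrans (congr2 (fun a b => 'd (vf_loc B Y p) (cmap (B p) w) a -
   'd (vf_loc B X p) (cmap (B p) w) b) (ZE X) (ZE Y))).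
apply: (etrans (congr2 (fun a b => a - b) (H Y sY (X w)) (H X sX (Y w)))).
by rewrite (derive_comm_rV (Y w) (X w) st) opprD addrACA subrr add0r.
Qed.

End Bracket.

End Charts.

(** * Charts of the tangent bundle *)

Section TangentCharts.
Variable R : realType.

Lemma manifold_smooth_charts (n : nat) (M : topologicalType) (A : atlas R n M) :
  is_smooth_manifold A -> smooth_charts A.
Proof.
case=> _ _ cA cdA tA; split=> //.
- by move=> p; have [] := cA p.
- by move=> p r pr; have [_ _ H _ _] := cA p; apply: H; rewrite inE.
- move=> p q r pr qr; have [_ _ K _ Ci] := cA p; have [oq _ _ _ _] := cA q.
  have ri : cmap (A p) r \in cmap (A p) @` cdom (A p) by rewrite inE; exists r.
  apply: (Ci _ ri); rewrite K ?inE //; exact: open_nbhs_nbhs.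
Qed.

Variables (n : nat) (M : Type) (A : atlas R n M) (gA : smooth_charts A).
Local Notation T := (TM_atlas A).

Lemma lsubmx_linear : linear (lsubmx : 'rV[R]_(n + n) -> 'rV[R]_n).
Proof. exact: linearP. Qed.

Lemma rsubmx_linear : linear (rsubmx : 'rV[R]_(n + n) -> 'rV[R]_n).
Proof. exact: linearP. Qed.

Lemma smooth_lsubmx (z : 'rV[R]_(n + n)) :
  smooth_near (fun z => lsubmx z : 'rV[R]_n) z.
Proof. exact: (smooth_near_linear lsubmx_linear (smooth_near_id z)). Qed.

Lemma smooth_rsubmx (z : 'rV[R]_(n + n)) :
  smooth_near (fun z => rsubmx z : 'rV[R]_n) z.
Proof. exact: (smooth_near_linear rsubmx_linear (smooth_near_id z)). Qed.

Lemma near_lsubmx (P : set 'rV[R]_n) (z : 'rV[R]_(n + n)) :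
  (\forall x \near lsubmx z, P x) -> \forall y \near z, P (lsubmx y).
Proof.
by move=> H; apply: (differentiable_continuous (smooth_near_diff (smooth_lsubmx z)) H).
Qed.

Lemma TM_cmap p w : cmap (T p) w =
  row_mx (cmap (A p.1) w.1) (change (A w.1) (A p.1) w.1 w.2).
Proof. by []. Qed.

Lemma TM_cinv1 p z : (cinv (T p) z).1 = cinv (A p.1) (lsubmx z).
Proof. by []. Qed.

Lemma lsub_TM_cmap p w : lsubmx (cmap (T p) w) = cmap (A p.1) w.1.
Proof. by rewrite TM_cmap row_mxKl. Qed.

Lemma near_TM_cmap p w (P : set 'rV[R]_n) :
  (\forall x \near cmap (A p.1) w.1, P x) ->
  \forall z \near cmap (T p) w, P (lsubmx z).
Proof. by rewrite -(lsub_TM_cmap p w); exact: near_lsubmx. Qed.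

Lemma TM_cinvK p w : cdom (A p.1) w.1 -> cinv (T p) (cmap (T p) w) = w.
Proof.
move=> pw; rewrite [LHS]/= row_mxKl row_mxKr (cinvK gA pw).
rewrite (changeK gA) //; [by case: w pw|exact: cdom_center].
Qed.

Lemma TM_imageP p z :
  (cmap (T p) @` cdom (T p)) z <-> (cmap (A p.1) @` cdom (A p.1)) (lsubmx z).
Proof.
split=> [[w pw <-]|zi]; first by rewrite lsub_TM_cmap; exists w.1.
have pz := image_cdom gA zi.
exists (cinv (T p) z) => //.
rewrite TM_cmap [X in row_mx (cmap _ X) _]TM_cinv1 (imageK gA zi).
rewrite [X in row_mx _ X](_ : _ = rsubmx z) ?hsubmxK //.
exact: (changeK gA (rsubmx z) pz (cdom_center gA _)).
Qed.

(** A transition of the tangent bundle is (x, y) |-> (t x, t' x y), with t a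
    transition of the base. *)
Lemma TM_transitionE p q w : cdom (A p.1) w.1 -> cdom (A q.1) w.1 ->
  \forall z \near cmap (T p) w,
   transition T p q z = row_mx (transition A p.1 q.1 (lsubmx z))
                          ('d (transition A p.1 q.1) (lsubmx z) (rsubmx z)).
Proof.
move=> pw qw.
have H : \forall x \near cmap (A p.1) w.1, cdom (A q.1) (cinv (A p.1) x) /\
   (cmap (A p.1) @` cdom (A p.1)) x.
  exact: (filterI (near_cdom gA pw qw) (near_image gA pw)).
apply: filterS (near_TM_cmap H) => z [qz iz].
have pz := image_cdom gA iz.
have E := change_comp gA (rsubmx z) pz (cdom_center gA _) qz.
have E1 : cmap (A p.1) (cinv (A p.1) (lsubmx z)) = lsubmx z := imageK gA iz.
have E2 := congr1 (fun x => 'd (transition A p.1 q.1) x (rsubmx z)) E1.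
exact: (congr1 (row_mx _) (etrans E E2)).
Qed.

Lemma TM_smooth_charts : smooth_charts T.
Proof.
split.
- by move=> p; exact: (cdom_center gA p.1).
- move=> p.
  rewrite (_ : _ @` _ = (fun z : 'rV[R]_(n + n) => lsubmx z : 'rV[R]_n) @^-1`
             (cmap (A p.1) @` cdom (A p.1))).
    apply: open_comp => [z _|]; last by case: gA.
    exact: (differentiable_continuous (smooth_near_diff (smooth_lsubmx z))).
  by apply/seteqP; split=> z /TM_imageP.
- by move=> p r; exact: TM_cinvK.
- move=> p q r pr qr.
  have H := near_cdom gA pr qr.
  exact: near_TM_cmap H.
- move=> p q r pr qr; have := TM_transitionE pr qr.
  have st := smooth_transition gA pr qr.
  set t := transition A p.1 q.1; move=> E.
  apply: (@smooth_near_eq _ _ _ (fun z => row_mx (t (lsubmx z)) ('d t (lsubmx z)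
    (rsubmx z)))).
    by apply: filterS E => z /esym.
  have stl : smooth_near t (lsubmx (cmap (T p) r)) by rewrite lsub_TM_cmap.
  apply: smooth_near_row_mx.
    exact: (@smooth_near_comp R _ n _ _ t _ (smooth_lsubmx _) stl).
  apply: (@smooth_near_app R _ n _ (fun z => 'd t (lsubmx z)) (fun z => rsubmx z)).
  + by move=> z; exact: linearP.
  + move=> a; apply: (@smooth_near_eq _ _ _ (fun z => 'D_a t (lsubmx z))).
      apply: (near_lsubmx (P := fun x => 'D_a t x = 'd t x a)).
      by apply: filterS (smooth_near_near stl) => x sx;
        exact: (deriveE a (smooth_near_diff sx)).
    exact: (@smooth_near_comp R _ n _ _ ('D_a t) _ (smooth_lsubmx _)
      (smooth_near_derive a stl)).
  + exact: smooth_rsubmx.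
Qed.

Lemma fst_cdom (p r : TM R n M) : cdom (T p) r -> cdom (A p.1) r.1.
Proof. by []. Qed.

Lemma fst_smooth (p r : TM R n M) : cdom (T p) r ->
  smooth_near (cmap (A p.1) \o fst \o cinv (T p)) (cmap (T p) r).
Proof.
move=> pr; apply: (@smooth_near_eq _ _ _ (fun z => lsubmx z));
  last exact: smooth_lsubmx.
have H := near_cmapK gA (pr : cdom (A p.1) r.1).
by apply: filterS (near_TM_cmap H) => z /= ->.
Qed.

(** In induced coordinates the projection is (x, y) |-> x. *)
Lemma rhoE w xi : rho A w xi = lsubmx xi.
Proof.
have ww := cdom_center gA w.1.
have H := near_cmapK gA ww.
have E : \forall z \near cmap (T w) w,
    lsubmx z = (cmap (A w.1) \o fst \o cinv (T w)) z :> 'rV_n.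
  by apply: filterS (near_TM_cmap H) => z /= ->.
have dl := smooth_near_diff (smooth_lsubmx (cmap (T w) w)).
have E1 := congr1 (@^~ xi) (near_eq_diff E dl).
apply: (etrans E1); rewrite -(deriveE xi dl).
rewrite (derive_lin _ lsubmx_linear); last by [].
by rewrite derive_id.
Qed.

(** In induced coordinates the vertical curve is affine: (x, y + t v). *)
Lemma gamE w v : gam A w v = row_mx 0 v.
Proof.
have ww := cdom_center gA w.1.
rewrite /gam (_ : (fun t : R^o => _) = (fun t : R^o => row_mx (cmap (A w.1) w.1)
  w.2 + t *: row_mx 0 v)); last first.
  apply/funext => t; rewrite TM_cmap [X in row_mx _ X](change_id gA _ ww).
  by rewrite scale_row_mx add_row_mx scaler0 addr0.
have d1 : differentiable (fun _ : R^o => row_mx (cmap (A w.1) w.1) w.2) (0 :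
  R^o) by exact: differentiable_cst.
have d2 : differentiable (fun t : R^o => t) (0 : R^o) by [].
have d3 : differentiable (fun _ : R^o => row_mx 0 v : 'rV[R]_(n + n)) (0 :
  R^o) by exact: differentiable_cst.
rewrite (derive_add _ d1 (differentiable_scale d2 d3)) (derive_scale _ d2 d3).
by rewrite derive_id !derive_cst scaler0 addr0 add0r scale1r.
Qed.

Lemma derive_row_mx (V : normedModType R) (f g : V -> 'rV[R]_n) x v :
  smooth_near f x -> smooth_near g x ->
  'D_v (fun y => row_mx (f y) (g y)) x = row_mx ('D_v f x) ('D_v g x).
Proof.
move=> fx gx; have := smooth_near_diff (smooth_near_row_mx fx gx) => d.
rewrite -[LHS]hsubmxK -(derive_lin _ lsubmx_linear d) -(derive_lin _ rsubmx_linear d).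
by congr row_mx; congr ('D_v _ x); apply/funext => y; rewrite ?row_mxKl ?row_mxKr.
Qed.

Lemma derive_lsub (W : normedModType R) (g : 'rV[R]_n -> W) (z xi : 'rV[R]_(n + n)) :
  'D_xi (fun y => g (lsubmx y)) z = 'D_(lsubmx xi) g (lsubmx z).
Proof. by apply: derive_comp_affine => h; rewrite linearP. Qed.

Lemma derive_vert_lsub (W : normedModType R) (g : 'rV[R]_n -> W) (z : 'rV[R]_(n + n))
  v :
  'D_(row_mx 0 v) (fun y => g (lsubmx y)) z = 0.
Proof.
have E := derive0 g (lsubmx z); apply: (etrans _ E); apply: derive_comp_affine => h.
by rewrite linearP /= row_mxKl.
Qed.

Lemma lsub_change_TM p q w xi : cdom (T p) w -> cdom (T q) w ->
  lsubmx (change (T p) (T q) w xi) = change (A p.1) (A q.1) w.1 (lsubmx xi).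
Proof.
move=> pw qw; have dt := differentiable_transition TM_smooth_charts pw qw.
have d := differentiable_transition gA (pw : cdom (A p.1) w.1) qw.
have E : lsubmx (change (T p) (T q) w xi) =
  'D_xi (fun z => transition A p.1 q.1 (lsubmx z)) (cmap (T p) w).
  rewrite changeE -(deriveE xi dt) -(derive_lin _ lsubmx_linear dt).
  apply: near_eq_derive; apply: filterS (TM_transitionE pw qw) => z ->.
  by rewrite row_mxKl.
by rewrite E derive_lsub lsub_TM_cmap (deriveE _ d).
Qed.

(** Vertical vectors transform like vectors of the base, because (x, y) |-> t' x y
    is linear in y. *)
Lemma change_TM_vert p q w v : cdom (T p) w -> cdom (T q) w ->
  change (T p) (T q) w (row_mx 0 v) = row_mx 0 (change (A p.1) (A q.1) w.1 v).
Proof.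
move=> pw qw; have dt := differentiable_transition TM_smooth_charts pw qw.
have st := smooth_transition gA (pw : cdom (A p.1) w.1) qw.
have d := smooth_near_diff st.
rewrite -[LHS]hsubmxK; congr row_mx.
  by rewrite lsub_change_TM // row_mxKl /change linear0.
set t := transition A p.1 q.1; pose z0 := cmap (T p) w.
have z0l : lsubmx z0 = cmap (A p.1) w.1 by rewrite lsub_TM_cmap.
have E : rsubmx (change (T p) (T q) w (row_mx 0 v)) =
  'D_(row_mx 0 v) (fun z => 'd t (lsubmx z) (rsubmx z)) z0.
  rewrite changeE -(deriveE (row_mx 0 v) dt) -(derive_lin _ rsubmx_linear dt).
  apply: near_eq_derive; apply: filterS (TM_transitionE pw qw) => z ->.
  by rewrite row_mxKr.
have Ed a : \forall z \near z0, 'D_a t (lsubmx z) = 'd t (lsubmx z) a.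
  apply: (near_TM_cmap (P := fun x => 'D_a t x = 'd t x a)).
  by apply: filterS (smooth_near_near st) => x sx;
    exact: (deriveE a (smooth_near_diff sx)).
have E1 := @derive_app R _ n _ (fun z => 'd t (lsubmx z)) (fun z => rsubmx z) z0
  (row_mx 0 v) (fun z => linearP _) _ (smooth_near_diff (smooth_rsubmx z0)).
rewrite E E1.
  rewrite -(near_eq_derive _ (Ed (rsubmx z0))) (derive_vert_lsub ('D_(rsubmx z0) t)).
  rewrite add0r z0l.
  rewrite (derive_lin _ rsubmx_linear); last by [].
  by rewrite derive_id row_mxKr.
move=> a; apply: near_eq_differentiable (Ed a) _.
apply: smooth_near_diff; apply: (@smooth_near_comp R _ n _ _ ('D_a t)
  _ (smooth_lsubmx _)).
by rewrite z0l; exact: smooth_near_derive.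
Qed.

End TangentCharts.

(** * Sections read in a fixed chart *)

Section Reading.
Variables (R : realType) (n : nat) (M : Type) (A : atlas R n M).
Hypothesis gA : smooth_charts A.
Local Notation T := (TM_atlas A).
Let gT : smooth_charts T := TM_smooth_charts gA.
Implicit Types (p w : TM R n M) (z : 'rV[R]_(n + n)).

(** The coordinates, in the chart of the tangent bundle centred at p, of the
    nonzero tangent vectors. *)
Definition slit_chart p : set 'rV[R]_(n + n) :=
  [set z | (cmap (T p) @` cdom (T p)) z /\ rsubmx z != 0].

Lemma slit_chart_open p : open (slit_chart p).
Proof.
apply: openI; first by case: gT.
have H : open ((fun z : 'rV[R]_(n + n) => rsubmx z : 'rV[R]_n) @^-1` [set y | y != 0]).
  apply: open_comp => [z _|]; last first.
    rewrite (_ : [set y | _] = ~` [set 0]); last by apply/seteqP; split=> y /eqP.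
    apply: closed_openC; apply: accessible_closed_set1.
    exact/hausdorff_accessible/norm_hausdorff.
  exact: (differentiable_continuous (smooth_near_diff (smooth_rsubmx z))).
exact: H.
Qed.

Lemma slit_chart_near p z : slit_chart p z -> \forall y \near z, slit_chart p y.
Proof. by move=> rz; apply: open_nbhs_nbhs; split => //; exact: slit_chart_open. Qed.

Lemma slit_chart_cdom p z : slit_chart p z -> cdom (T p) (cinv (T p) z).
Proof. by case=> iz _; exact: (image_cdom gT iz). Qed.

Lemma slit_chart_cmapK p z : slit_chart p z -> cmap (T p) (cinv (T p) z) = z.
Proof. by case=> iz _; exact: (imageK gT iz). Qed.

Lemma slit_chart_slit p z : slit_chart p z -> slit (cinv (T p) z).
Proof.
case=> iz z0; apply: contra z0 => /eqP z0.
have /(image_cdom gA) pz := (TM_imageP gA p z).1 iz.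
have H := changeK gA (rsubmx z) pz (cdom_center gA _).
by rewrite -H [X in change _ _ _ X]z0 /change linear0.
Qed.

Lemma slit_chart_center p : slit p -> slit_chart p (cmap (T p) p).
Proof.
move=> p0; split; first by exists p => //; exact: (cdom_center gT).
by rewrite TM_cmap row_mxKr (change_id gA _ (cdom_center gA _)).
Qed.

Definition pvf_read (Y : pvf R n M) p := section_read A T fst Y p.
Definition tvf_read (X : tvf R n M) p := vf_loc T X p.
Definition fun_read (f : TM R n M -> R) p : 'rV[R]_(n + n) -> R^o := f \o cinv (T p).

Lemma pvf_read_at Y p z : slit_chart p z -> let w := cinv (T p) z in
  pvf_read Y p z = change (A w.1) (A p.1) w.1 (Y w).
Proof. by []. Qed.

Lemma tvf_read_at X p z : slit_chart p z -> let w := cinv (T p) z in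
  tvf_read X p z = change (T w) (T p) w (X w).
Proof. by []. Qed.

Lemma smooth_pvf_read Y p z : slit_chart p z ->
  smooth_pvf_at A Y (cinv (T p) z) <-> smooth_near (pvf_read Y p) z.
Proof.
move=> rz; have pz := slit_chart_cdom rz; have ww := cdom_center gT (cinv (T p) z).
have H p1 q1 r := @smooth_section_read R n M A gA _ _ T gT fst (@fst_cdom _ _ _ A)
  (@fst_smooth _ _ _ A gA) Y p1 q1 r.
have zE := slit_chart_cmapK rz.
split=> [sY|sY].
- by rewrite -zE; exact: (H _ _ _ ww pz sY).
- by apply: (H _ _ _ pz ww); rewrite zE.
Qed.

Lemma smooth_tvf_read X p z : slit_chart p z ->
  smooth_vf_at T X (cinv (T p) z) <-> smooth_near (tvf_read X p) z.
Proof.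
move=> rz; have pz := slit_chart_cdom rz; have ww := cdom_center gT (cinv (T p) z).
have zE := slit_chart_cmapK rz.
split=> [sX|sX].
- by rewrite -zE; exact: (smooth_vf_loc_change gT ww pz sX).
- by apply: (smooth_vf_loc_change gT pz ww); rewrite zE.
Qed.

Lemma smooth_fun_read f p z : slit_chart p z ->
  smooth_fun_at T f (cinv (T p) z) <-> smooth_near (fun_read f p) z.
Proof.
move=> rz; have pz := slit_chart_cdom rz; have ww := cdom_center gT (cinv (T p) z).
have zE := slit_chart_cmapK rz.
have H p1 q1 r := @smooth_read R _ _ T gT R^o f p1 q1 r.
split=> [sf|sf].
- by rewrite -[z]zE; exact: (H _ _ _ pz ww sf).
- by apply: (H _ _ _ ww pz); rewrite zE.
Qed.

Lemma dir_fun_read f p z xi : slit_chart p z -> smooth_near (fun_read f p) z ->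
  let w := cinv (T p) z in
  dir T f w xi = 'D_(change (T w) (T p) w xi) (fun_read f p) z.
Proof.
move=> rz sf w; have pz := slit_chart_cdom rz; have ww := cdom_center gT w.
have zE := slit_chart_cmapK rz.
have df : differentiable ((f : _ -> R^o) \o cinv (T p)) (cmap (T p) w).
  by rewrite /w zE; exact: smooth_near_diff.
have E := (@diff_read R _ _ T gT R^o f w p w xi ww pz df).2.
apply: (etrans E); rewrite -(deriveE _ df).
by rewrite [in LHS]/w zE.
Qed.

Lemma pvf_read_rho X p z : slit_chart p z -> pvf_read (rho_vf A X) p z =
  lsubmx (tvf_read X p z).
Proof.
move=> rz; rewrite (tvf_read_at _ rz) (pvf_read_at _ rz) /rho_vf (rhoE gA).
by rewrite (lsub_change_TM gA) //; [exact: (cdom_center gT)|exact: slit_chart_cdom].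
Qed.

Lemma tvf_read_gam Y p z : slit_chart p z -> tvf_read (gam_vf A Y) p z =
  row_mx 0 (pvf_read Y p z).
Proof.
move=> rz; rewrite (tvf_read_at _ rz) (pvf_read_at _ rz) /gam_vf (gamE gA).
by rewrite (change_TM_vert gA) //; [exact: (cdom_center gT)|exact: slit_chart_cdom].
Qed.

Lemma pvf_read_eta p z : slit_chart p z -> pvf_read (@Defs.eta R n M) p z = rsubmx z.
Proof.
move=> rz; rewrite -[in RHS](slit_chart_cmapK rz) TM_cmap row_mxKr.
exact: (pvf_read_at _ rz).
Qed.

Lemma tvf_read_bracket X Y p z : slit_chart p z ->
  smooth_near (tvf_read X p) z -> smooth_near (tvf_read Y p) z ->
  tvf_read (lie_bracket T X Y) p z =
  'D_(tvf_read X p z) (tvf_read Y p) z - 'D_(tvf_read Y p z) (tvf_read X p) z.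
Proof.
move=> rz sX sY; rewrite (tvf_read_at _ rz).
have E := lie_bracket_change gT (slit_chart_cdom rz) ((smooth_tvf_read X rz).2 sX)
  ((smooth_tvf_read Y rz).2 sY).
apply: (etrans E); rewrite (slit_chart_cmapK rz).
by rewrite (deriveE _ (smooth_near_diff sX)) (deriveE _ (smooth_near_diff sY)).
Qed.

(** Coordinate fields of the chart centred at p, here and in [vframe]; v lists their
    constant components. *)
Definition pframe p (v : 'rV[R]_n) : pvf R n M :=
  fun w => change (A p.1) (A w.1) w.1 v.

Definition vframe p (v : 'rV[R]_(n + n)) : tvf R n M :=
  fun w => change (T p) (T w) w v.

Lemma pvf_read_frame p v z : slit_chart p z -> pvf_read (pframe p v) p z = v.
Proof.
move=> rz; rewrite (pvf_read_at _ rz) /pframe.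
by apply: (changeK gA); [exact: (slit_chart_cdom rz)|exact: (cdom_center gA)].
Qed.

Lemma tvf_read_frame p v z : slit_chart p z -> tvf_read (vframe p v) p z = v.
Proof.
move=> rz; rewrite (tvf_read_at _ rz) /vframe.
by apply: (changeK gT); [exact: (slit_chart_cdom rz)|exact: (cdom_center gT)].
Qed.

Lemma smooth_pframe p v z : slit_chart p z -> smooth_near (pvf_read (pframe p v) p) z.
Proof.
move=> rz; apply: (@smooth_near_eq _ _ _ (fun=> v)); last exact: smooth_near_cst.
by apply: filterS (slit_chart_near rz) => y ry; rewrite pvf_read_frame.
Qed.

Lemma smooth_vframe p v z : slit_chart p z -> smooth_near (tvf_read (vframe p v) p) z.
Proof.
move=> rz; apply: (@smooth_near_eq _ _ _ (fun=> v)); last exact: smooth_near_cst.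
by apply: filterS (slit_chart_near rz) => y ry; rewrite tvf_read_frame.
Qed.

Lemma smooth_eta p z : slit_chart p z -> smooth_near (pvf_read (@Defs.eta R n M) p) z.
Proof.
move=> rz; apply: (@smooth_near_eq _ _ _ (fun z => rsubmx z));
  last exact: smooth_rsubmx.
by apply: filterS (slit_chart_near rz) => y ry; rewrite pvf_read_eta.
Qed.

Lemma pvf_read_add Y Z p z : pvf_read (fun w => Y w + Z w) p z =
  pvf_read Y p z + pvf_read Z p z.
Proof. exact: (linearD ('d _ _)). Qed.

Lemma pvf_read_opp Y p z : pvf_read (fun w => - Y w) p z = - pvf_read Y p z.
Proof. exact: (linearN ('d _ _)). Qed.

Lemma pvf_read_scale f Y p z : pvf_read (fun w => f w *: Y w) p z =
  fun_read f p z *: pvf_read Y p z.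
Proof. exact: (linearZZ ('d _ _)). Qed.

Lemma smooth_pvf_read_sum m (Y : 'I_m -> pvf R n M) p z :
  (forall i, smooth_near (pvf_read (Y i) p) z) ->
  smooth_near (pvf_read (fun w => \sum_i Y i w) p) z.
Proof.
move=> sY; apply: (@smooth_near_eq _ _ _ (fun z => \sum_i pvf_read (Y i) p z));
  last first.
  exact: smooth_near_sum.
by near=> y; exact: (esym (linear_sum ('d _ _) _ _ _)).
Unshelve. all: by end_near. Qed.

End Reading.

(** * Connection coefficients *)

Section Christoffel.
Variables (R : realType) (n : nat) (M : Type) (A : atlas R n M).
Hypothesis gA : smooth_charts A.
Local Notation T := (TM_atlas A).
Let gT : smooth_charts T := TM_smooth_charts gA.
Variables (D : connection R n M) (cD : is_connection A D).
Implicit Types (p w u : TM R n M) (z : 'rV[R]_(n + n)) (Y Z : pvf R n M).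

Lemma connection_add u xi Y Z : slit u -> smooth_pvf_at A Y u -> smooth_pvf_at A Z u ->
  D u xi (fun w => Y w + Z w) = D u xi Y + D u xi Z.
Proof. by move=> /cD[_ H _ _]; exact: H. Qed.

Lemma connection_scale u xi (f : TM R n M -> R) Y : slit u ->
  smooth_fun_at T f u -> smooth_pvf_at A Y u ->
  D u xi (fun w => f w *: Y w) = dir T f u xi *: Y u + f u *: D u xi Y.
Proof. by move=> /cD[_ _ H _]; exact: H. Qed.

Lemma connection_linear u (a : R) xi zeta Y : slit u -> smooth_pvf_at A Y u ->
  D u (a *: xi + zeta) Y = a *: D u xi Y + D u zeta Y.
Proof. by move=> /cD[H _ _ _]; exact: H. Qed.

Lemma smooth_cov u X Y : slit u -> smooth_vf_at T X u -> smooth_pvf_at A Y u ->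
  smooth_pvf_at A (cov D X Y) u.
Proof. by move=> /cD[_ _ _ H]; exact: H. Qed.

(** Locality at a zero section: the indicator f of the points where Y does not
    vanish is smooth near u, being 0 there, and f Y = Y; by the Leibniz rule D Y
    is then a combination of Y u and f u, which are both 0. *)
Lemma connection_near0 u xi Y : slit u ->
  (\forall z \near cmap (T u) u, Y (cinv (T u) z) = 0) -> D u xi Y = 0.
Proof.
(* The zero set of Y contains a neighbourhood of u, so f is smooth there. *)
move=> su Y0; pose f w : R := if Y w == 0 then 0 else 1.
have fY : (fun w => f w *: Y w) = Y.
  apply/funext => w; rewrite /f; case: eqP => [->|_]; first by rewrite scaler0.
  by rewrite scale1r.
have Yu : Y u = 0.
  by have := nbhs_singleton Y0; rewrite (cinvK gT (cdom_center gT u)).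
have sf : smooth_fun_at T f u.
  apply: (@smooth_near_eq _ _ _ (fun=> 0)); last exact: smooth_near_cst.
  by apply: filterS Y0 => z Yz; rewrite /f /= Yz eqxx.
have sY : smooth_pvf_at A Y u.
  apply: (@smooth_near_eq _ _ _ (fun=> 0)); last exact: smooth_near_cst.
  by apply: filterS Y0 => z Yz; rewrite /= Yz /change linear0.
have := connection_scale xi su sf sY; rewrite fY Yu scaler0 add0r => ->.
by rewrite /f Yu eqxx scale0r.
Qed.

Lemma connection_near u xi Y Z : slit u -> smooth_pvf_at A Y u -> smooth_pvf_at A Z u ->
  (\forall z \near cmap (T u) u, Y (cinv (T u) z) = Z (cinv (T u) z)) ->
  D u xi Y = D u xi Z.
Proof.
move=> su sY sZ YZ; pose W w := Z w - Y w.
have W0 : \forall z \near cmap (T u) u, W (cinv (T u) z) = 0.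
  by apply: filterS YZ => z E; rewrite /W E subrr.
have sW : smooth_pvf_at A W u.
  apply: (@smooth_near_eq _ _ _ (fun=> 0)); last exact: smooth_near_cst.
  by apply: filterS W0 => z Wz; rewrite /= Wz /change linear0.
have := connection_add xi su sY sW; rewrite (connection_near0 xi su W0) addr0 => <-.
by congr (D u xi _); apply/funext => w; rewrite /W addrC subrK.
Qed.

Variable p : TM R n M.
Local Notation reg := (slit_chart A p).
Local Notation pt z := (cinv (T p) z).

Lemma connection_near_chart z xi Y Z : reg z ->
  smooth_near (pvf_read A Y p) z -> smooth_near (pvf_read A Z p) z ->
  (\forall y \near z, Y (pt y) = Z (pt y)) -> D (pt z) xi Y = D (pt z) xi Z.
Proof.
move=> rz sY sZ YZ; set w := pt z.
have ww := cdom_center gT w; have pw := slit_chart_cdom gA rz.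
apply: (connection_near xi (slit_chart_slit gA rz) ((smooth_pvf_read gA _ rz).2 sY)
  ((smooth_pvf_read gA _ rz).2 sZ)).
have zE : transition T w p (cmap (T w) w) = z.
  by rewrite (transition_cmap gT _ ww) (slit_chart_cmapK gA rz).
have c := differentiable_continuous (differentiable_transition gT ww pw).
have YZ' : \forall y \near transition T w p (cmap (T w) w), Y (pt y) =
  Z (pt y) by rewrite zE.
have H : \forall y \near cmap (T w) w, Y (pt (transition T w p y)) =
  Z (pt (transition T w p y)).
  exact: (c _ YZ').
apply: filterS2 H (near_cdom gT ww pw) => y Ey py.
have K : pt (transition T w p y) = cinv (T w) y := cinvK gT py.
by rewrite -K.
Qed.

Lemma connection_sum m z xi (Y : 'I_m -> pvf R n M) : reg z ->
  (forall i, smooth_near (pvf_read A (Y i) p) z) ->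
  D (pt z) xi (fun w => \sum_i Y i w) = \sum_i D (pt z) xi (Y i).
Proof.
move=> rz; elim: m Y => [|m IH] Y sY.
  rewrite big_ord0; apply: connection_near0; first exact: (slit_chart_slit gA rz).
  by near=> y; rewrite big_ord0.
have -> : (fun w => \sum_i Y i w) =
  (fun w => \sum_(i < m) Y (widen_ord (leqnSn m) i) w + Y ord_max w).
  by apply/funext => w; rewrite big_ord_recr.
rewrite connection_add.
- by rewrite big_ord_recr /= IH.
- exact: (slit_chart_slit gA rz).
- by apply/(smooth_pvf_read gA _ rz); exact: smooth_pvf_read_sum.
- exact/(smooth_pvf_read gA _ rz).
Unshelve. all: by end_near. Qed.

Definition frame_coef z xi v := pvf_read A (cov D (vframe A p xi) (pframe A p v)) p z.

(** The coefficients on frames extended bilinearly, so that they are bilinear at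
    every point and not only where the frames are defined. *)
Definition conn_coef z (xi : 'rV[R]_(n + n)) (v : 'rV[R]_n) : 'rV[R]_n :=
  \sum_i v 0 i *: (\sum_j xi 0 j *: frame_coef z (delta_mx 0 j) (delta_mx 0 i)).

Lemma conn_coef_linear z xi : linear (conn_coef z xi).
Proof.
move=> a u v; rewrite /conn_coef scaler_sumr -big_split; apply: eq_bigr => i _ /=.
by rewrite !mxE scalerDl scalerA.
Qed.

Lemma conn_coef_linearl z v : linear (conn_coef z ^~ v).
Proof.
move=> a x y; rewrite /conn_coef scaler_sumr -big_split; apply: eq_bigr => i _ /=.
rewrite [a *: (v 0 i *: _)]scalerA mulrC -scalerA -scalerDr; congr (_ *: _).
rewrite scaler_sumr -big_split; apply: eq_bigr => j _ /=.
by rewrite !mxE scalerDl scalerA.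
Qed.

Lemma smooth_conn_coef z xi v : reg z -> smooth_near (fun y => conn_coef y xi v) z.
Proof.
move=> rz; apply: smooth_near_sum => i.
apply: smooth_near_scale; first exact: smooth_near_cst.
apply: smooth_near_sum => j.
apply: smooth_near_scale; first exact: smooth_near_cst.
apply/(smooth_pvf_read gA _ rz); apply: smooth_cov;
  first exact: (slit_chart_slit gA rz).
- by apply/(smooth_tvf_read gA _ rz); exact: smooth_vframe.
- by apply/(smooth_pvf_read gA _ rz); exact: smooth_pframe.
Qed.

Lemma frame_coef_linear z v : reg z -> linear (frame_coef z ^~ v).
Proof.
move=> rz a x y; rewrite /frame_coef !(pvf_read_at _ rz) /cov /vframe.
have -> : change (T p) (T (pt z)) (pt z) (a *: x + y) =
   a *: change (T p) (T (pt z)) (pt z) x + change (T p) (T (pt z)) (pt z) y.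
  exact: change_linear.
rewrite connection_linear; first exact: change_linear.
  exact: (slit_chart_slit gA rz).
by apply/(smooth_pvf_read gA _ rz); exact: smooth_pframe.
Qed.

(** In a fixed chart a covariant derivative is a directional derivative plus a
    zeroth order term.  Near the point Y is a combination of frame fields, and
    locality allows the Leibniz rule to be applied to that combination. *)
Lemma pvf_read_cov X Y z : reg z -> smooth_near (pvf_read A Y p) z ->
  pvf_read A (cov D X Y) p z =
  'D_(tvf_read A X p z) (pvf_read A Y p) z + conn_coef z (tvf_read A X p z)
    (pvf_read A Y p z).
Proof.
move=> rz sY; set w := pt z; set xi := tvf_read A X p z.
pose f i v : R := pvf_read A Y p (cmap (T p) v) 0 i.
pose e i := pframe A p (delta_mx 0 i).
have fE i : \forall y \near z, pvf_read A Y p y 0 i = fun_read A (f i) p y.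
  by apply: filterS (slit_chart_near gA rz) => y ry;
    rewrite /fun_read /= /f (slit_chart_cmapK gA ry).
have sf i : smooth_near (fun_read A (f i) p) z.
  by apply: smooth_near_eq (fE i) _; exact: smooth_near_coord.
have se i : smooth_near (pvf_read A (e i) p) z by exact: smooth_pframe.
have sfe i : smooth_near (pvf_read A (fun v => f i v *: e i v) p) z.
  apply: (@smooth_near_eq _ _ _ (fun y => fun_read A (f i) p y *: pvf_read A (e i)
    p y)).
    by near=> y; rewrite pvf_read_scale.
  exact: smooth_near_scale.
have E : D w (X w) Y = D w (X w) (fun v => \sum_i f i v *: e i v).
  apply: connection_near_chart => //; first exact: smooth_pvf_read_sum.
  apply: filterS (slit_chart_near gA rz) => y ry.
  have py := slit_chart_cdom gA ry.
  have H := changeK gA (Y (pt y)) (cdom_center gA _) py.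
  rewrite -[LHS]H [X in change _ _ _ X](rV_linear_sum (l := id)) //.
  rewrite -[LHS]/('d _ _ _) linear_sum; apply: eq_bigr => i _.
  rewrite linearZ /= /f (slit_chart_cmapK gA ry); congr (_ *: _).
rewrite (pvf_read_at _ rz) /cov E connection_sum //.
rewrite -[LHS]/('d _ _ _) linear_sum.
have DY i : 'D_xi (pvf_read A Y p) z 0 i = dir T (f i) w (X w).
  rewrite (dir_fun_read gA _ rz (sf i)).
  rewrite -(derive_coord _ _ _ (smooth_near_diff sY)).
  exact: near_eq_derive (fE i).
rewrite [X in X + _](rV_linear_sum (l := id)) // -big_split; apply: eq_bigr => i _ /=.
rewrite connection_scale; [|exact: (slit_chart_slit gA rz)|exact/(smooth_fun_read gA _
  rz)|exact/(smooth_pvf_read gA _ rz)].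
rewrite linearD !linearZ /= DY; congr (_ *: _ + _).
  exact: (pvf_read_frame gA _ rz).
rewrite (_ : f i w = pvf_read A Y p z 0 i); last by rewrite /f (slit_chart_cmapK gA rz).
congr (_ *: _).
rewrite -(rV_linear_sum (frame_coef_linear _ rz)) /frame_coef (pvf_read_at _ rz) /cov.
congr ('d _ _ (D _ _ _)); rewrite /vframe /xi (tvf_read_at _ rz).
exact: (esym (changeK gT _ (cdom_center gT _) (slit_chart_cdom gA rz))).
Unshelve. all: by end_near. Qed.

End Christoffel.

(** * Curvature in coordinates *)

Section LocalCurvature.
Variables (R : realType) (n : nat) (O : set 'rV[R]_(n + n)).
Variable G : 'rV[R]_(n + n) -> 'rV[R]_n -> 'rV[R]_n -> 'rV[R]_n.
Hypothesis oO : open O.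
Hypothesis G_linear : forall z a, linear (G z a).
Hypothesis G_linearl : forall z b, linear (G z ^~ b).
Hypothesis G_smooth : forall z a b, O z -> smooth_near (fun y => G y a b) z.
Local Notation vert b := (row_mx 0 b).

Lemma near_domain z : O z -> \forall y \near z, O y.
Proof. by move=> Oz; exact: open_nbhs_nbhs. Qed.

Lemma G_Dr z a b c : G z a (b + c) = G z a b + G z a c.
Proof. by have := G_linear z a 1 b c; rewrite !scale1r. Qed.
Lemma G_0r z a : G z a 0 = 0.
Proof. by apply: (addrI (G z a 0)); rewrite -G_Dr !addr0. Qed.
Lemma G_Nr z a b : G z a (- b) = - G z a b.
Proof. by apply/eqP; rewrite -subr_eq0 opprK -G_Dr addNr G_0r. Qed.
Lemma derive_G (X Y : 'rV[R]_(n + n) -> 'rV[R]_n) z v : O z ->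
  differentiable X z -> differentiable Y z ->
  'D_v (fun y => G y (X y) (Y y)) z =
  'D_v (fun y => G y (X z) (Y z)) z + G z ('D_v X z) (Y z) + G z (X z) ('D_v Y z).
Proof.
move=> Oz dX dY.
have dG a b : differentiable (fun y => G y a b) z by exact/smooth_near_diff/G_smooth.
have lG b y : linear (fun a => G y a b) by exact: (G_linearl y b).
have dGX b : differentiable (fun y => G y (X y) b) z.
  exact: (differentiable_app (lG b) (fun a => dG a b) dX).
rewrite (derive_app (B := fun y b => G y (X y) b) v (fun y => G_linear y (X y)) dGX dY).
by rewrite (derive_app v (lG (Y z)) (fun a => dG a (Y z)) dX).
Qed.

Lemma smooth_G (X Y : 'rV[R]_(n + n) -> 'rV[R]_n) z : O z ->
  smooth_near X z -> smooth_near Y z -> smooth_near (fun y => G y (X y) (Y y)) z.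
Proof.
move=> Oz sX sY.
have lG b y : linear (fun a => G y a b) by exact: (G_linearl y b).
apply: (smooth_near_app (B := fun y b => G y (X y) b) (fun y => G_linear y (X y))
  _ sY) => b.
by apply: (smooth_near_app (lG b) _ sX) => a; exact: G_smooth.
Qed.

(** Expands a second covariant derivative, so that [curvature_local] only has to
    cancel terms. *)
Lemma derive_cov (X : 'rV[R]_(n + n) -> 'rV[R]_(n + n)) (Y : 'rV[R]_(n + n) ->
  'rV[R]_n) z v :
  O z -> smooth_near X z -> smooth_near Y z ->
  'D_v (fun y => 'D_(X y) Y y + G y (lsubmx (X y)) (Y y)) z =
  'D_v ('D_(X z) Y) z + 'D_('D_v X z) Y z
  + ('D_v (fun y => G y (lsubmx (X z)) (Y z)) z
     + G z (lsubmx ('D_v X z)) (Y z) + G z (lsubmx (X z)) ('D_v Y z)).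
Proof.
move=> Oz sX sY; have dX := smooth_near_diff sX; have dY := smooth_near_diff sY.
have slX : smooth_near (fun y => lsubmx (X y)) z.
  exact: smooth_near_linear (@lsubmx_linear _ _) sX.
have lD : \forall y \near z, linear (fun a => 'D_a Y y).
  apply: filterS (smooth_near_near sY) => y /smooth_near_diff dy a u w.
  exact: derive_linear_direction.
have [dDY EDY] := @derive_app_near R _ _ _ (fun y a => 'D_a Y y) X z v lD
  (fun a => smooth_near_diff (smooth_near_derive a sY)) dX.
rewrite (derive_add _ dDY (smooth_near_diff (smooth_G Oz slX sY))) EDY.
rewrite (derive_G v Oz (smooth_near_diff slX) dY).
by rewrite (derive_lin _ (@lsubmx_linear _ _) dX).
Qed.

Lemma curvature_cancel (a1 a2 b1 b2 b3 c1 c2 d2 e1 e2 f2 : 'rV[R]_n) :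
  - (a1 + a2 + (b1 + b2 + b3) + (c1 + c2))
  + (a1 + d2 + (e1 + e2 + c1) + (b3 + f2)) + (a2 - d2 + (b2 - e2)) =
  - b1 + e1 - c2 + f2.
Proof. by apply/rowP => i; rewrite !mxE; ring. Qed.

(** The curvature is tensorial: all derivatives of U, V and Z cancel, the second
    derivative of Z by symmetry and the others against the bracket term W. *)
Lemma curvature_local (U V : 'rV[R]_(n + n) -> 'rV[R]_(n + n))
    (Z : 'rV[R]_(n + n) -> 'rV[R]_n) z :
  O z -> smooth_near U z -> smooth_near V z -> smooth_near Z z ->
  let nabla X Y y := 'D_(X y) Y y + G y (lsubmx (X y)) (Y y) in
  let W := 'D_(U z) V z - 'D_(V z) U z in
  - nabla U (nabla V Z) z + nabla V (nabla U Z) z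
  + ('D_W Z z + G z (lsubmx W) (Z z)) =
  - 'D_(U z) (fun y => G y (lsubmx (V z)) (Z z)) z
  + 'D_(V z) (fun y => G y (lsubmx (U z)) (Z z)) z
  - G z (lsubmx (U z)) (G z (lsubmx (V z)) (Z z))
  + G z (lsubmx (V z)) (G z (lsubmx (U z)) (Z z)).
Proof.
move=> Oz sU sV sZ nabla W.
rewrite [X in - X](_ : _ = 'D_(U z) (fun y => 'D_(V y) Z y + G y (lsubmx (V y)) (Z y)) z
   + G z (lsubmx (U z)) (nabla V Z z)) //.
rewrite [X in _ + X + _](_ : _ = 'D_(V z) (fun y => 'D_(U y) Z y + G y (lsubmx (U y))
  (Z y)) z
   + G z (lsubmx (V z)) (nabla U Z z)) //.
rewrite (derive_cov (U z) Oz sV sZ) (derive_cov (V z) Oz sU sZ) /nabla !G_Dr.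
rewrite (derive_comm_rV (V z) (U z) sZ).
have dZ := smooth_near_diff sZ.
have -> : 'D_W Z z = 'D_('D_(U z) V z) Z z - 'D_('D_(V z) U z) Z z.
  have H := derive_linear_direction (-1) ('D_(V z) U z) ('D_(U z) V z) dZ.
  rewrite !scaleN1r in H; apply: (etrans _ (etrans H (addrC _ _))).
  by rewrite /W; congr (derive Z z _); exact: addrC.
have -> : G z (lsubmx W) (Z z) =
   G z (lsubmx ('D_(U z) V z)) (Z z) - G z (lsubmx ('D_(V z) U z)) (Z z).
  have H := G_linearl z (Z z) (-1) (lsubmx ('D_(V z) U z)) (lsubmx ('D_(U z) V z)).
  rewrite !scaleN1r in H; apply: (etrans _ (etrans H (addrC _ _))).
  by rewrite /W linearB; congr (G z _ (Z z)); exact: addrC.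
exact: curvature_cancel.
Qed.

End LocalCurvature.

(** * Coordinate identities for a Berwald connection *)

Section LocalBerwald.
Variables (R : realType) (n : nat) (O : set 'rV[R]_(n + n)).
Variable G : 'rV[R]_(n + n) -> 'rV[R]_n -> 'rV[R]_n -> 'rV[R]_n.
Hypothesis oO : open O.
Hypothesis G_linear : forall z a, linear (G z a).
Hypothesis G_linearl : forall z b, linear (G z ^~ b).
Hypothesis G_smooth : forall z a b, O z -> smooth_near (fun y => G y a b) z.
Hypothesis G_sym : forall z a b, O z -> G z a b = G z b a.
Local Notation vert b := (row_mx 0 b).
Hypothesis G_vert : forall z a b, O z ->
  'D_(vert b) (fun y => G y a (rsubmx z)) z = 0.

(** The nonlinear connection; its graph, up to sign, is the horizontal space. *)
Definition nonlinear_conn z a := G z a (rsubmx z).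
Local Notation N := nonlinear_conn.
Definition hlift z a : 'rV[R]_(n + n) := row_mx a (- N z a).

(** The formula of [curvature_local] for the horizontal lifts of a and b. *)
Definition hcurv z a b c :=
  - 'D_(hlift z a) (fun y => G y b c) z + 'D_(hlift z b) (fun y => G y a c) z
  - G z a (G z b c) + G z b (G z a c).

(** The vertical component of the bracket of the horizontal lifts of the constant
    fields a and b. *)
Definition hbracket z a b := - 'D_(hlift z a) (N ^~ b) z + 'D_(hlift z b) (N ^~ a) z.

Lemma smooth_N z a : O z -> smooth_near (N ^~ a) z.
Proof.
move=> Oz.
exact: (smooth_G G_linear G_linearl G_smooth Oz (smooth_near_cst a z)
  (smooth_rsubmx z)).
Qed.

Lemma derive_N z a v : O z ->
  'D_v (N ^~ a) z = 'D_v (fun y => G y a (rsubmx z)) z + G z a (rsubmx v).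
Proof.
move=> Oz.
have dr := smooth_near_diff (smooth_rsubmx z).
have H := derive_app v (fun y => G_linear y a)
  (fun b => smooth_near_diff (G_smooth a b Oz)) dr.
apply: (etrans H); congr (_ + G z a _).
rewrite (derive_lin v (@rsubmx_linear _ _) (f := id)) ?derive_id //.
Qed.

(** The Berwald property: the connection coefficients are the vertical derivatives
    of the nonlinear connection. *)
Lemma derive_N_vert z a b : O z -> 'D_(vert b) (N ^~ a) z = G z a b.
Proof. by move=> Oz; rewrite derive_N // G_vert // add0r row_mxKr. Qed.

Lemma hcurv_eta z a b : O z -> hcurv z a b (rsubmx z) = hbracket z a b.
Proof.
move=> Oz; rewrite /hcurv /hbracket !derive_N // /hlift !row_mxKr.
rewrite !(G_Nr G_linear) -/(hlift z a) -/(hlift z b) /N.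
set x := 'D_ _ _ z; set x' := 'D_ _ _ z; set y := G _ _ _; set y' := G _ _ _.
by rewrite opprD opprK addrACA -!addrA; congr (_ + (_ + _)); rewrite addrC.
Qed.

Lemma derive_hlift_vert z a c : O z ->
  'D_(vert c) (hlift ^~ a) z = vert (- G z a c).
Proof.
move=> Oz; have sN := smooth_N a Oz.
rewrite (derive_row_mx _ (smooth_near_cst a z) (smooth_near_opp sN)).
rewrite (derive_opp _ (smooth_near_diff sN)) derive_N_vert //.
by congr row_mx; exact: derive_cst.
Qed.

Lemma smooth_hlift z a : O z -> smooth_near (hlift ^~ a) z.
Proof.
move=> Oz; apply: smooth_near_row_mx; first exact: smooth_near_cst.
by apply: smooth_near_opp; exact: smooth_N.
Qed.

(** The two derivatives of N commute; the second term comes from the direction of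
    differentiation, which moves by - G z a c. *)
Lemma derive_hlift_N z a b c : O z ->
  differentiable (fun y => 'D_(hlift y a) (N ^~ b) y) z /\
  'D_(vert c) (fun y => 'D_(hlift y a) (N ^~ b) y) z =
  'D_(hlift z a) (fun y => G y b c) z - G z b (G z a c).
Proof.
move=> Oz; have sN := smooth_N b Oz.
have lD : \forall y \near z, linear (fun v => 'D_v (N ^~ b) y).
  apply: filterS (smooth_near_near sN) => y /smooth_near_diff dy r u w.
  exact: derive_linear_direction.
have [d E] := @derive_app_near R _ _ _ (fun y v => 'D_v (N ^~ b) y) (hlift ^~ a)
  z (vert c) lD
  (fun v => smooth_near_diff (smooth_near_derive v sN))
    (smooth_near_diff (smooth_hlift a Oz)).
split=> //; apply: (etrans E); apply: congr2.
  apply: (etrans (derive_comm_rV _ _ sN)).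
  apply: near_eq_derive; apply: filterS (near_domain oO Oz) => y Oy.
  exact: derive_N_vert.
rewrite (derive_hlift_vert a c Oz) derive_N_vert //.
exact: (G_Nr G_linear).
Qed.

Lemma hbracket_cancel (a b p q : 'rV[R]_n) : - (a - p) + (b - q) = - a + b - q + p.
Proof. by apply/rowP => i; rewrite !mxE; ring. Qed.

(** Vertical differentiation turns N into G, and the direction of each horizontal
    lift moves as well, which supplies the quadratic terms of [hcurv]. *)
Lemma derive_hbracket z a b c : O z ->
  differentiable (fun y => hbracket y a b) z /\
  'D_(vert c) (fun y => hbracket y a b) z = hcurv z a b c.
Proof.
move=> Oz; have [d1 E1] := derive_hlift_N a b c Oz; have [d2 E2] :=
  derive_hlift_N b a c Oz.
have d3 : differentiable (fun y => - 'D_(hlift y a) (N ^~ b) y)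
  z by exact: differentiableN.
split; first exact: (differentiableD d3 d2).
rewrite /hbracket (derive_add _ d3 d2) (derive_opp _ d1) E1 E2 /hcurv.
exact: hbracket_cancel.
Qed.

Lemma hcurv_anti z a b c : hcurv z a b c = - hcurv z b a c.
Proof.
rewrite /hcurv !opprD !opprK.
set x := 'D_ _ _ z; set x' := 'D_ _ _ z; set y := G _ _ _; set y' := G _ _ _.
by rewrite [- x + x']addrC -!addrA; congr (_ + (_ + _)); rewrite addrC.
Qed.

Lemma bianchi_cancel (a b c p q r : 'rV[R]_n) :
  (- a + b - p + q) + (- b + c - q + r) + (- c + a - r + p) = 0.
Proof. by apply/rowP => i; rewrite !mxE; ring. Qed.

(** The cyclic identity of a torsion-free connection; here every term cancels
    against another one by the symmetry of the coefficients. *)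
Lemma bianchi z a b c : O z -> hcurv z a b c + hcurv z b c a + hcurv z c a b = 0.
Proof.
move=> Oz.
have S v b' c' : 'D_v (fun y => G y b' c') z = 'D_v (fun y => G y c' b') z.
  apply: near_eq_derive; apply: filterS (near_domain oO Oz) => y Oy; exact: G_sym.
rewrite /hcurv (S _ c b) (S _ a c) (S _ b a).
rewrite (G_sym c b Oz) (G_sym a c Oz) (G_sym b a Oz).
exact: bianchi_cancel.
Qed.

Lemma hbracket_linearl z b : O z -> linear (fun a => hbracket z a b).
Proof.
move=> Oz r u w.
have sNb := smooth_near_diff (smooth_N b Oz).
have Nl y : N y (r *: u + w) = r *: N y u + N y w by exact: G_linearl.
have du : differentiable (N ^~ u) z := smooth_near_diff (smooth_N u Oz).
have dw : differentiable (N ^~ w) z := smooth_near_diff (smooth_N w Oz).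
have dr : differentiable (fun=> r : R^o) z by exact: differentiable_cst.
have NE v : 'D_v (N ^~ (r *: u + w)) z = r *: 'D_v (N ^~ u) z + 'D_v (N ^~ w) z.
  have -> : N ^~ (r *: u + w) = (fun y => r *: N y u + N y w) by apply/funext.
  rewrite (derive_add _ (differentiable_scale dr du) dw) (derive_scale _ dr du).
  by rewrite (derive_cst r) scale0r add0r.
have hE : hlift z (r *: u + w) = r *: hlift z u + hlift z w.
  by rewrite /hlift Nl scale_row_mx add_row_mx scalerN opprD.
rewrite /hbracket hE (derive_linear_direction _ _ _ sNb) NE.
by rewrite opprD addrACA scalerDr scalerN.
Qed.

(** The deviation tensor, contracting the h-curvature with y twice. *)
Definition jacobi_endo z b := hcurv z (rsubmx z) b (rsubmx z).
Local Notation H := jacobi_endo.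

Lemma jacobiE z b : O z -> H z b = hbracket z (rsubmx z) b.
Proof. exact: hcurv_eta. Qed.

Lemma hbracket_anti z a b : hbracket z a b = - hbracket z b a.
Proof. by rewrite /hbracket opprD opprK addrC. Qed.

Lemma derive_jacobi z a b : O z ->
  'D_(vert a) (H ^~ b) z = hbracket z a b + hcurv z (rsubmx z) b a.
Proof.
move=> Oz.
have E : \forall y \near z, H y b = hbracket y (rsubmx y) b.
  by apply: filterS (near_domain oO Oz) => y; exact: jacobiE.
have lB : \forall y \near z, linear (fun a => hbracket y a b).
  by apply: filterS (near_domain oO Oz) => y; exact: hbracket_linearl.
have [_ E1] := @derive_app_near R _ _ _ (fun y a => hbracket y a b)
  (fun y => rsubmx y) z (vert a) lB (fun c => (derive_hbracket c b 0 Oz).1)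
  (smooth_near_diff (smooth_rsubmx z)).
apply: (etrans (near_eq_derive _ E)); apply: (etrans E1).
apply: (etrans (addrC _ _)); apply: congr2; last exact: (derive_hbracket (rsubmx z)
  b a Oz).2.
congr (hbracket z _ b).
by rewrite (derive_lin _ (@rsubmx_linear _ _) (f := id)) ?derive_id ?row_mxKr.
Qed.

Lemma jacobi_cancel (h x : 'rV[R]_n) : h + (h + x) - (- h + x) = 3 *: h.
Proof. by apply/rowP => i; rewrite !mxE; ring. Qed.

(** By [derive_jacobi] the left-hand side is twice the bracket plus an
    antisymmetrized curvature term, which the cyclic identity turns into a third
    copy of the bracket. *)
Lemma jacobi_bracket z a b : O z ->
  'D_(vert a) (H ^~ b) z - 'D_(vert b) (H ^~ a) z = 3 *: hbracket z a b.
Proof.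
move=> Oz; rewrite !derive_jacobi //.
have := bianchi (rsubmx z) b a Oz.
rewrite (hcurv_anti z b a) hcurv_eta // (hcurv_anti z a (rsubmx z) b).
rewrite (hbracket_anti z b a).
set x := hcurv _ _ _ _; set x' := hcurv _ _ _ _; set h := hbracket _ _ _.
move=> E; have -> : x = h + x' by apply/eqP; rewrite -subr_eq0 opprD addrA E.
exact: jacobi_cancel.
Qed.

(** The vertical derivative of [jacobi_bracket].  The deviation tensor is replaced
    by any smooth h that agrees with it on the domain, since an explicit
    expression is what will be differentiated. *)
Lemma hcurv_jacobi (h : 'rV[R]_(n + n) -> 'rV[R]_n -> 'rV[R]_n) z a b c :
  (forall y d, O y -> H y d = h y d) ->
  (forall d, smooth_near (h ^~ d) z) -> O z ->
  3 *: hcurv z a b c =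
  'D_(vert c) ('D_(vert a) (h ^~ b)) z - 'D_(vert c) ('D_(vert b) (h ^~ a)) z.
Proof.
move=> Hh sh Oz.
have E : \forall y \near z, 3 *: hbracket y a b =
   'D_(vert a) (h ^~ b) y - 'D_(vert b) (h ^~ a) y.
  apply: filterS (near_domain oO Oz) => y Oy.
  apply: (etrans (esym (jacobi_bracket a b Oy))).
  by apply: congr2; [|congr (- _)]; apply: near_eq_derive;
    apply: filterS (near_domain oO Oy) => x; exact: Hh.
have [d E1] := derive_hbracket a b c Oz.
have d3 : differentiable (fun=> 3 : R^o) z by exact: differentiable_cst.
have := near_eq_derive (vert c) E.
rewrite (derive_scale _ d3 d) E1 (derive_cst (3 : R^o)) scale0r add0r => ->.
by rewrite derive_sub //; apply: smooth_near_diff; exact: smooth_near_derive.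
Qed.

End LocalBerwald.

(** * Coefficients of a torsion-free connection *)

Section TorsionFree.
Variables (R : realType) (n : nat) (M : Type) (A : atlas R n M).
Hypothesis gA : smooth_charts A.
Local Notation T := (TM_atlas A).
Let gT : smooth_charts T := TM_smooth_charts gA.
Variables (D : connection R n M) (cD : is_connection A D).
Hypothesis torsion0 : forall u X Y, slit u ->
  smooth_vf_at T X u -> smooth_vf_at T Y u -> torsion A D X Y u = 0.
Variable p : TM R n M.
Local Notation reg := (slit_chart A p).
Local Notation pt z := (cinv (T p) z).
Implicit Types (z : 'rV[R]_(n + n)) (X Y Z : pvf R n M).

Lemma pvf_read_eq0 Y z : Y (pt z) = 0 -> pvf_read A Y p z = 0.
Proof.
by move=> Y0; rewrite /pvf_read /section_read /=; move: Y0 => /= ->;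
  rewrite /change linear0.
Qed.

(** Torsion of two coordinate fields: their bracket vanishes and their projections
    have constant components. *)
Lemma conn_coef_torsion z xi zeta : reg z ->
  conn_coef A D p z xi (lsubmx zeta) = conn_coef A D p z zeta (lsubmx xi).
Proof.
move=> rz.
have sv x := smooth_vframe gA x rz.
have sr x : \forall y \near z, pvf_read A (rho_vf A (vframe A p x)) p y = lsubmx x.
  by apply: filterS (slit_chart_near gA rz) => y ry; rewrite (pvf_read_rho gA)
    // tvf_read_frame.
have srn x : smooth_near (pvf_read A (rho_vf A (vframe A p x)) p) z.
  apply: (@smooth_near_eq _ _ _ (fun=> lsubmx x)); last exact: smooth_near_cst.
  by apply: filterS (sr x) => y ->.
have cE x x' : pvf_read A (cov D (vframe A p x) (rho_vf A (vframe A p x'))) p z =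
   conn_coef A D p z x (lsubmx x').
  rewrite (pvf_read_cov gA cD _ rz (srn x')) tvf_read_frame // (nbhs_singleton (sr x')).
  by rewrite (near_eq_derive _ (sr x')) derive_cst add0r.
have bE : pvf_read A (rho_vf A (lie_bracket T (vframe A p xi) (vframe A p zeta)))
  p z = 0.
  rewrite (pvf_read_rho gA) // tvf_read_bracket //.
  have dE x x' : 'D_x (tvf_read A (vframe A p x') p) z = 0.
    have E : \forall y \near z, tvf_read A (vframe A p x') p y = x'.
      by apply: filterS (slit_chart_near gA rz) => y ry; rewrite tvf_read_frame.
    by rewrite (near_eq_derive _ E) derive_cst.
  by rewrite !dE subrr linear0.
have := pvf_read_eq0 (torsion0 (slit_chart_slit gA rz)
  ((smooth_tvf_read gA _ rz).2 (sv xi)) ((smooth_tvf_read gA _ rz).2 (sv zeta))).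
have -> : pvf_read A (torsion A D (vframe A p xi) (vframe A p zeta)) p z =
  pvf_read A (cov D (vframe A p xi) (rho_vf A (vframe A p zeta))) p z
  - pvf_read A (cov D (vframe A p zeta) (rho_vf A (vframe A p xi))) p z
  - pvf_read A (rho_vf A (lie_bracket T (vframe A p xi) (vframe A p zeta))) p z.
  by rewrite -!pvf_read_opp -!pvf_read_add.
by rewrite bE subr0 !cE => /eqP; rewrite subr_eq0 => /eqP.
Qed.

(** The coefficients along horizontal coordinate directions, which by [conn_coefE]
    are all there is. *)
Definition berwald_coef z a b := conn_coef A D p z (row_mx a 0) b.

Lemma conn_coef_vert z b v : reg z -> conn_coef A D p z (row_mx 0 b) v = 0.
Proof.
move=> rz; have := conn_coef_torsion (row_mx 0 b) (row_mx v 0) rz.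
rewrite !row_mxKl => ->.
exact: (@G_0r R n (fun z a b => conn_coef A D p z (row_mx a 0) b)
  (fun z a => conn_coef_linear A D p z (row_mx a 0)) z v).
Qed.

Lemma conn_coefE z xi v : reg z -> conn_coef A D p z xi v = berwald_coef z (lsubmx xi)
  v.
Proof.
move=> rz; rewrite /berwald_coef.
have := conn_coef_linearl A D p z v 1 (row_mx (lsubmx xi) 0) (row_mx 0 (rsubmx xi)).
rewrite scale1r add_row_mx addr0 add0r hsubmxK => ->.
by rewrite conn_coef_vert // addr0 scale1r.
Qed.

Lemma berwald_coef_sym z a b : reg z -> berwald_coef z a b = berwald_coef z b a.
Proof.
by move=> rz; have := conn_coef_torsion (row_mx a 0) (row_mx b 0) rz; rewrite !row_mxKl.
Qed.

Lemma berwald_coef_linear z a : linear (berwald_coef z a).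
Proof. exact: conn_coef_linear. Qed.

Lemma berwald_coef_linearl z b : linear (berwald_coef z ^~ b).
Proof.
move=> r u w; rewrite /berwald_coef -(conn_coef_linearl A D p z b r (row_mx u 0)
  (row_mx w 0)).
by rewrite scale_row_mx add_row_mx scaler0 addr0.
Qed.

Lemma berwald_coef_smooth z a b : reg z -> smooth_near (fun y => berwald_coef y a b) z.
Proof. exact: (smooth_conn_coef gA cD). Qed.

Lemma pvf_read_cov_berwald (U : tvf R n M) Y z : reg z -> smooth_near (pvf_read A Y p)
  z ->
  pvf_read A (cov D U Y) p z =
  'D_(tvf_read A U p z) (pvf_read A Y p) z + berwald_coef z (lsubmx (tvf_read A U p
    z)) (pvf_read A Y p z).
Proof. by move=> rz sY; rewrite (pvf_read_cov gA cD) // conn_coefE. Qed.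

(** The condition D_xi eta = 0 reads: vertical part of xi = - G (horizontal part)
    y.  Hence exactly one vector satisfies the conditions defining [bet]. *)
Lemma tvf_read_bet Y z : reg z ->
  tvf_read A (bet_vf A D Y) p z = hlift berwald_coef z (pvf_read A Y p z).
Proof.
move=> rz; set w := pt z; have ww := cdom_center gT w; have pw := slit_chart_cdom gA rz.
pose S := [set xi | horizontal D w xi /\ rho A w xi = Y w].
have SP xi : S xi <-> change (T w) (T p) w xi = hlift berwald_coef z (pvf_read A Y p z).
  set xi' := change (T w) (T p) w xi.
  have E1 : lsubmx xi' = change (A w.1) (A p.1) w.1 (rho A w xi).
    by rewrite (rhoE gA); exact: lsub_change_TM.
  have E2 : change (A w.1) (A p.1) w.1 (D w xi (@Defs.eta R n M)) =
     rsubmx xi' + berwald_coef z (lsubmx xi') (rsubmx z).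
    have := pvf_read_cov_berwald (fun=> xi) rz (smooth_eta gA rz).
    rewrite (pvf_read_eta gA rz) (_ : tvf_read A _ p z = xi') //.
    have E3 : \forall y \near z, pvf_read A (@Defs.eta R n M) p y = rsubmx y.
      by apply: filterS (slit_chart_near gA rz) => y; exact: pvf_read_eta.
    rewrite (near_eq_derive _ E3) (derive_lin _ (@rsubmx_linear _ _) (f :=
      id)) // derive_id.
    by move=> <-.
  have inj u v : change (A w.1) (A p.1) w.1 u = change (A w.1) (A p.1) w.1 v -> u = v.
    move=> E; rewrite -[u](changeK gA _ (cdom_center gA _) pw) E.
    exact: (changeK gA _ (cdom_center gA _) pw).
  split=> [[Hxi Rxi]|Exi].
    rewrite -[LHS]hsubmxK /hlift.
    have lE : lsubmx xi' = pvf_read A Y p z by rewrite E1 Rxi.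
    congr row_mx => //; rewrite /nonlinear_conn -lE; apply/eqP.
    rewrite -addr_eq0 -E2 Hxi; apply/eqP.
    exact: (linear0 ('d _ _)).
  split.
    apply: inj; rewrite E2 Exi /hlift row_mxKl row_mxKr /nonlinear_conn addNr.
    exact: (esym (linear0 ('d _ _))).
  by apply: inj; rewrite -E1 Exi /hlift row_mxKl.
have S0 : S !=set0.
  exists (change (T p) (T w) w (hlift berwald_coef z (pvf_read A Y p z))); apply/SP.
  exact: (changeK gT _ pw ww).
have [xi0 Sxi0] := S0.
have := xgetPex 0 S0; rewrite -/(bet A D w (Y w)) => /SP.
exact.
Qed.

End TorsionFree.

(** * Curvature read in a fixed chart *)

Section CurvatureReading.
Variables (R : realType) (n : nat) (M : Type) (A : atlas R n M).
Hypothesis gA : smooth_charts A.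
Local Notation T := (TM_atlas A).
Let gT : smooth_charts T := TM_smooth_charts gA.
Variables (D : connection R n M) (cD : is_connection A D).
Hypothesis torsion0 : forall u X Y, slit u ->
  smooth_vf_at T X u -> smooth_vf_at T Y u -> torsion A D X Y u = 0.
Variable p : TM R n M.
Local Notation reg := (slit_chart A p).
Local Notation pt z := (cinv (T p) z).
Local Notation G := (berwald_coef A D p).
Implicit Types (z : 'rV[R]_(n + n)) (X Y Z : pvf R n M).

Let Gl := berwald_coef_linear A D p.
Let Gll := berwald_coef_linearl A D p.
Let Gs := berwald_coef_smooth gA cD (p := p).

Lemma pvf_read_curvature (U V : tvf R n M) Z z : reg z ->
  smooth_near (tvf_read A U p) z -> smooth_near (tvf_read A V p) z ->
  smooth_near (pvf_read A Z p) z ->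
  let u := tvf_read A U p in let v := tvf_read A V p in let c := pvf_read A Z p z in
  pvf_read A (curvature A D U V Z) p z =
  - 'D_(u z) (fun y => G y (lsubmx (v z)) c) z
  + 'D_(v z) (fun y => G y (lsubmx (u z)) c) z
  - G z (lsubmx (u z)) (G z (lsubmx (v z)) c)
  + G z (lsubmx (v z)) (G z (lsubmx (u z)) c).
Proof.
move=> rz sU sV sZ u v c.
have cE W : \forall y \near z, pvf_read A (cov D W Z) p y =
    'D_(tvf_read A W p y) (pvf_read A Z p) y + G y (lsubmx (tvf_read A W p y))
      (pvf_read A Z p y).
  apply: filterS2 (slit_chart_near gA rz) (smooth_near_near sZ) => y ry sy.
  exact: pvf_read_cov_berwald.
have scov W : smooth_near (tvf_read A W p) z -> smooth_near (pvf_read A (cov D W Z) p)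
  z.
  move=> sW; exact: ((smooth_pvf_read gA _ rz).1 (smooth_cov cD (slit_chart_slit gA rz)
    ((smooth_tvf_read gA W rz).2 sW) ((smooth_pvf_read gA Z rz).2 sZ))).
have ccE W W' : smooth_near (tvf_read A W' p) z ->
    pvf_read A (cov D W (cov D W' Z)) p z =
    'D_(tvf_read A W p z) (fun y => 'D_(tvf_read A W' p y) (pvf_read A Z p) y
         + G y (lsubmx (tvf_read A W' p y)) (pvf_read A Z p y)) z
    + G z (lsubmx (tvf_read A W p z)) ('D_(tvf_read A W' p z) (pvf_read A Z p) z
         + G z (lsubmx (tvf_read A W' p z)) (pvf_read A Z p z)).
  move=> sW'; rewrite (pvf_read_cov_berwald gA cD torsion0 W rz (scov _ sW')).
  by rewrite (near_eq_derive _ (cE W')) (nbhs_singleton (cE W')).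
rewrite -(curvature_local Gl Gll Gs rz sU sV sZ).
have -> : pvf_read A (curvature A D U V Z) p z =
   - pvf_read A (cov D U (cov D V Z)) p z + pvf_read A (cov D V (cov D U Z)) p z
   + pvf_read A (cov D (lie_bracket T U V) Z) p z.
  by rewrite -pvf_read_opp -!pvf_read_add.
apply: congr2; first by apply: congr2; [congr (- _)|]; exact: ccE.
rewrite (pvf_read_cov_berwald gA cD torsion0 _ rz sZ) -(tvf_read_bracket gA rz sU sV)
  //.
Qed.

Lemma smooth_bet Y z : reg z -> smooth_near (pvf_read A Y p) z ->
  smooth_near (tvf_read A (bet_vf A D Y) p) z.
Proof.
move=> rz sY.
apply: (@smooth_near_eq _ _ _ (fun y => hlift G y (pvf_read A Y p y))).
  by apply: filterS (slit_chart_near gA rz) => y ry; rewrite tvf_read_bet.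
apply: smooth_near_row_mx => //; apply: smooth_near_opp.
exact: (smooth_G Gl Gll Gs rz sY (smooth_rsubmx z)).
Qed.

Lemma smooth_gam Y z : reg z -> smooth_near (pvf_read A Y p) z ->
  smooth_near (tvf_read A (gam_vf A Y) p) z.
Proof.
move=> rz sY.
apply: (@smooth_near_eq _ _ _ (fun y => row_mx 0 (pvf_read A Y p y))).
  by apply: filterS (slit_chart_near gA rz) => y ry; rewrite tvf_read_gam.
by apply: smooth_near_row_mx => //; exact: smooth_near_cst.
Qed.

Lemma pvf_read_hcurvature X Y Z z : reg z -> smooth_near (pvf_read A X p) z ->
  smooth_near (pvf_read A Y p) z -> smooth_near (pvf_read A Z p) z ->
  pvf_read A (h_curvature A D X Y Z) p z =
  hcurv G z (pvf_read A X p z) (pvf_read A Y p z) (pvf_read A Z p z).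
Proof.
move=> rz sX sY sZ.
rewrite (pvf_read_curvature rz (smooth_bet rz sX) (smooth_bet rz sY) sZ).
by rewrite !tvf_read_bet // /hcurv /hlift !row_mxKl.
Qed.

Hypothesis vhv0 : forall u X Y, slit u -> smooth_pvf_at A X u ->
  smooth_pvf_at A Y u -> vhv_torsion A D X Y u = 0.

(** The (v)hv-torsion of constant fields.  In the curvature formula the vertical
    direction has no horizontal part, so only this derivative remains. *)
Lemma berwald_coef_vert z a b : reg z ->
  'D_(row_mx 0 b) (fun y => G y a (rsubmx z)) z = 0.
Proof.
move=> rz.
have sa := smooth_pframe gA a rz; have sb := smooth_pframe gA b rz.
have := pvf_read_eq0 (vhv0 (slit_chart_slit gA rz) ((smooth_pvf_read gA _ rz).2 sa)
  ((smooth_pvf_read gA _ rz).2 sb)).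
rewrite (pvf_read_curvature rz (smooth_bet rz sa) (smooth_gam rz sb)
  (smooth_eta gA rz)).
rewrite tvf_read_bet // tvf_read_gam // !pvf_read_frame // pvf_read_eta // /hlift
  !row_mxKl.
have G_0l y c : G y 0 c = 0.
  exact: (@G_0r R n (fun z a b => G z b a) (fun z a => Gll z a) y c).
have -> : (fun y => G y 0 (rsubmx z)) = (fun=> 0) by apply/funext => y.
by rewrite derive_cst !G_0l (G_0r Gl) !oppr0 add0r !addr0.
Qed.

End CurvatureReading.

(** * Second derivatives of products *)

Section ScalarCalculus.
Variables (R : realType) (V : normedModType R).
Implicit Types f g : V -> R^o.

Lemma derive2_mul f g (z a c : V) : smooth_near f z -> smooth_near g z ->
  'D_c ('D_a (fun y => f y * g y : R^o)) z =
  'D_c ('D_a f) z * g z + 'D_a f z * 'D_c g z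
  + ('D_c f z * 'D_a g z + f z * 'D_c ('D_a g) z).
Proof.
move=> sf sg.
have E : \forall y \near z, 'D_a (fun y => f y * g y : R^o) y =
  'D_a f y * g y + f y * 'D_a g y.
  apply: filterS2 (smooth_near_near sf) (smooth_near_near sg) => y fy gy.
  exact: (derive_mul a (smooth_near_diff fy) (smooth_near_diff gy)).
have [df dg] := (smooth_near_diff sf, smooth_near_diff sg).
have sDf := smooth_near_derive a sf; have sDg := smooth_near_derive a sg.
have [dDf dDg] := (smooth_near_diff sDf, smooth_near_diff sDg).
have d1 := smooth_near_diff (smooth_near_mul sDf sg).
have d2 := smooth_near_diff (smooth_near_mul sf sDg).
apply: (etrans (near_eq_derive c E)); apply: (etrans (derive_add c d1 d2)).
by apply: congr2; [exact: (derive_mul c dDf dg)|exact: (derive_mul c df dDg)].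
Qed.

Lemma derive2_const_mul f (r : R) (z a c : V) : smooth_near f z ->
  'D_c ('D_a (fun y => f y * r : R^o)) z = 'D_c ('D_a f) z * r.
Proof.
move=> sf; have sr : smooth_near (fun _ : V => r : R^o) z by exact: smooth_near_cst.
rewrite (derive2_mul a c sf sr) !derive_cst.
rewrite (_ : 'D_a (fun=> r : R^o) = fun=> 0); last by apply/funext => y;
  exact: derive_cst.
by rewrite derive_cst !mulr0 !addr0.
Qed.

Lemma derive2_sub f g (z a c : V) : smooth_near f z -> smooth_near g z ->
  'D_c ('D_a (fun y => f y - g y : R^o)) z = 'D_c ('D_a f) z - 'D_c ('D_a g) z.
Proof.
move=> sf sg.
have E : \forall y \near z, 'D_a (fun y => f y - g y : R^o) y = 'D_a f y - 'D_a g y.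
  apply: filterS2 (smooth_near_near sf) (smooth_near_near sg) => y fy gy.
  exact: (derive_sub a (smooth_near_diff fy) (smooth_near_diff gy)).
apply: (etrans (near_eq_derive c E)); apply: derive_sub;
  exact/smooth_near_diff/smooth_near_derive.
Qed.

(** The second derivative of one component of the deviation tensor, at a point
    where the first derivatives of e = L^2 and the component m of y vanish. *)
Lemma derive2_jacobi (k e eb m : V -> R^o) (z a c : V) (lb la lc : R) :
  smooth_near k z -> smooth_near e z -> smooth_near eb z -> smooth_near m z ->
  (forall y, 'D_a m y = la) -> 'D_c m z = lc ->
  'D_a e z = 0 -> 'D_c e z = 0 -> eb z = 0 -> m z = 0 ->
  'D_c ('D_a (fun y => k y * (e y * lb - eb y * m y * 2^-1) : R^o)) z =
  'D_c ('D_a k) z * (e z * lb)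
  + k z * ('D_c ('D_a e) z * lb - ('D_a eb z * lc + 'D_c eb z * la) * 2^-1).
Proof.
move=> sk se sb sm ma mc ea ec b0 m0.
have s0 : smooth_near (fun _ : V => lb : R^o) z by exact: smooth_near_cst.
have s1 := smooth_near_mul se s0.
have s2 := smooth_near_mul sb sm.
have s3 : smooth_near (fun _ : V => 2^-1 : R^o) z by exact: smooth_near_cst.
have s4 := smooth_near_mul s2 s3.
pose Q : V -> R^o := fun y => e y * lb - eb y * m y * 2^-1.
have s5 : smooth_near Q z := smooth_near_sub s1 s4.
have D1 v : 'D_v Q z =
   'D_v e z * lb - ('D_v eb z * m z + eb z * 'D_v m z) * 2^-1.
  apply: (etrans (derive_sub v (smooth_near_diff s1) (smooth_near_diff s4))).
  apply: congr2.
    apply: (etrans (derive_mul v (smooth_near_diff se) (smooth_near_diff s0))).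
    by rewrite derive_cst mulr0 addr0.
  congr (- _); apply: (etrans (derive_mul v (smooth_near_diff s2)
    (smooth_near_diff s3))).
  rewrite derive_cst mulr0 addr0; congr (_ * _).
  exact: (derive_mul v (smooth_near_diff sb) (smooth_near_diff sm)).
have D2 : 'D_c ('D_a Q) z =
   'D_c ('D_a e) z * lb - ('D_a eb z * lc + 'D_c eb z * la) * 2^-1.
  apply: (etrans (derive2_sub a c s1 s4)).
  apply: congr2; first exact: derive2_const_mul.
  congr (- _); apply: (etrans (derive2_const_mul _ a c s2)); congr (_ * _).
  apply: (etrans (derive2_mul a c sb sm)).
  by rewrite m0 b0 mc ma mulr0 mul0r add0r addr0.
have Qz : Q z = e z * lb by rewrite /Q b0 !mul0r subr0.
have DQ v : 'D_v e z = 0 -> 'D_v Q z = 0.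
  by move=> ev; rewrite D1 ev b0 m0 mulr0 !mul0r addr0 mul0r subr0.
rewrite [LHS](derive2_mul a c sk s5) D2 (DQ a ea) (DQ c ec) Qz.
by rewrite !mulr0 addr0 add0r.
Qed.

End ScalarCalculus.

(** * The Finsler metric read in a fixed chart *)

Section FinslerReading.
Variables (R : realType) (n : nat) (M : Type) (A : atlas R n M).
Hypothesis gA : smooth_charts A.
Local Notation T := (TM_atlas A).
Let gT : smooth_charts T := TM_smooth_charts gA.
Variables (L : TM R n M -> R) (L_finsler : is_finsler A L).
Variable p : TM R n M.
Local Notation reg := (slit_chart A p).
Local Notation pt z := (cinv (T p) z).
Local Notation vert b := (row_mx 0 b).
Local Notation J z := (change (A (pt z).1) (A p.1) (pt z).1).
Implicit Types (z : 'rV[R]_(n + n)) (X Y Z : pvf R n M).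

Local Notation Lz := (fun_read A L p).
Definition sqL z : R^o := Lz z ^+ 2.
Local Notation E := sqL.
(** The Finsler metric at the point of coordinates z, as the vertical Hessian of
    half of L^2; see [fmetricE]. *)
Definition metric_read z a b : R := 2^-1 * 'D_(vert a) ('D_(vert b) E) z.
Local Notation g := metric_read.

Lemma smooth_L z : reg z -> smooth_near Lz z.
Proof.
move=> rz; apply/(smooth_fun_read gA _ rz); case: L_finsler => H _ _ _.
exact: H (slit_chart_slit gA rz).
Qed.

Lemma smooth_sqL z : reg z -> smooth_near E z.
Proof. by move=> rz; exact: (smooth_near_mul (smooth_L rz) (smooth_L rz)). Qed.

Lemma L_gt0 z : reg z -> 0 < Lz z.
Proof. by move=> /(slit_chart_slit gA); case: L_finsler => _ H _ _; exact: H. Qed.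

Lemma sqL_gt0 z : reg z -> 0 < E z.
Proof. by move=> rz; rewrite exprn_gt0 // L_gt0. Qed.

Lemma coord_eta z : reg z -> J z (pt z).2 = rsubmx z.
Proof. exact: pvf_read_eta. Qed.

Lemma pt_row_mx z y : reg z -> pt (row_mx (lsubmx z) (J z y)) = ((pt z).1, y).
Proof.
move=> rz; rewrite [LHS]/= row_mxKl row_mxKr; congr pair.
exact: (changeK gA _ (cdom_center gA _) (slit_chart_cdom gA rz)).
Qed.

Lemma row_mx_affine z v y (h : R) : reg z ->
  row_mx (lsubmx z) (J z (h *: v + y)) =
  h *: vert (J z v) + row_mx (lsubmx z) (J z y).
Proof.
move=> rz; rewrite scale_row_mx add_row_mx scaler0 add0r; congr row_mx.
exact: change_linear.
Qed.

(** The fibre derivatives defining the metric are taken in the chart centred at the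
    point itself; the identification with the fibre of the fixed chart is linear,
    so it only changes the directions. *)
Lemma fmetricE z v w : reg z -> fmetric L (pt z) v w = g z (J z v) (J z w).
Proof.
move=> rz; pose l y := row_mx (lsubmx z) (J z y).
have E1 : (fun y' : 'rV[R]_n => (L ((pt z).1, y') ^+ 2 : R^o)) = (fun y => E (l y)).
  by apply/funext => y; rewrite /sqL /fun_read /l -(pt_row_mx y rz).
have lh u y h : l (h *: u + y) = h *: vert (J z u) + l y by exact: row_mx_affine.
have E2 : (fun y => 'D_w (fun y => E (l y)) y) = (fun y => 'D_(vert (J z w)) E (l y)).
  by apply/funext => y; exact: (derive_comp_affine E (lh w y)).
have E3 := derive_comp_affine ('D_(vert (J z w)) E) (lh v (pt z).2).
have lz : l (pt z).2 = z.
  exact: (etrans (congr1 (row_mx (lsubmx z)) (coord_eta rz)) (hsubmxK z)).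
rewrite lz in E3; rewrite /fmetric E1 E2.
exact: (congr1 (fun x => 2^-1 * x) E3).
Qed.

Lemma metric_sym z a b : reg z -> g z a b = g z b a.
Proof.
by move=> rz; rewrite /g (derive_comm (vert a) (vert b) (smooth_sqL rz)).
Qed.

Lemma sqL_scale z (t : R) : 0 <= t -> E (row_mx (lsubmx z) (t *: rsubmx z)) =
  t ^+ 2 * E z.
Proof.
move=> t0; rewrite /sqL -exprMn; congr (_ ^+ 2).
case: L_finsler => _ _ H _.
rewrite /fun_read [LHS]/= row_mxKl row_mxKr.
have -> : change (A p.1) (A (cinv (A p.1) (lsubmx z))) (cinv (A p.1) (lsubmx z))
  (t *: rsubmx z) =
  t *: (pt z).2 by exact: (linearZZ ('d _ _)).
by rewrite H.
Qed.

(** Along the ray through y, the function L^2 is (1 + s)^2 L^2. *)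
Lemma euler_sqL z : reg z -> 'D_(vert (rsubmx z)) E z = 2 * E z.
Proof.
move=> rz; set v := vert _.
have dE : derivable E (0 *: v + z) v.
  by rewrite scale0r add0r; exact/diff_derivable/smooth_near_diff/smooth_sqL.
have H := @derive_val _ _ _ _ _ _ _ (is_derive_line dE).
rewrite scale0r add0r in H; rewrite -H.
(* Homogeneity is known for nonnegative factors only, hence the restriction to s near
  0. *)
have sE : \forall s \near (0 : R^o), E (s *: v + z) = (1 + s) * (1 + s) * E z.
  have n1 : \forall s \near (0 : R^o), `|0 - s| < 1.
    apply/nbhs_ballP; exists 1 => //= s; exact.
  apply: filterS n1 => s; rewrite sub0r normrN ltr_norml => /andP[s1 _].
  have {}s1 : 0 <= 1 + s by move: s1; lra.
  rewrite -expr2 -(sqL_scale _ s1); congr E.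
  rewrite -[in LHS](hsubmxK z) /v scale_row_mx add_row_mx scaler0 add0r.
  by rewrite scalerDl scale1r [rsubmx z + _]addrC.
rewrite (near_eq_derive (1 : R^o) sE).
have d1 : differentiable (fun s : R^o => 1 + s) (0 : R^o).
  exact: (smooth_near_diff (smooth_near_add (smooth_near_cst (1 : R^o) (0 : R^o))
    (smooth_near_id (0 : R^o)))).
have d2 : differentiable (fun s : R^o => (1 + s) * (1 + s) : R^o) (0 : R^o).
  exact: (differentiableM d1 d1).
have d3 : differentiable (fun _ : R^o => E z) (0 : R^o) by exact: differentiable_cst.
rewrite (derive_mul (1 : R^o) d2 d3) (derive_mul (1 : R^o) d1 d1) derive_cst mulr0
  addr0.
have -> : 'D_1 (fun s : R^o => 1 + s) (0 : R^o) = 1.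
  rewrite (derive_add (1 : R^o) (smooth_near_diff (smooth_near_cst (1 : R^o) (0 : R^o)))
    (smooth_near_diff (smooth_near_id (0 : R^o)))).
  by rewrite derive_cst derive_id add0r.
by rewrite addr0 mul1r.
Qed.

(** The vertical derivative of Euler's identity [euler_sqL]. *)
Lemma metric_eta z b : reg z -> g z (rsubmx z) b = 2^-1 * 'D_(vert b) E z.
Proof.
move=> rz; rewrite metric_sym // /g; congr (_ * _).
have sE := smooth_sqL rz.
have E1 : \forall y \near z, 'D_(vert (rsubmx y)) E y = E y * 2.
  by apply: filterS (slit_chart_near gA rz) => y ry; rewrite euler_sqL // mulrC.
have lB : \forall y \near z, linear (fun a => 'D_(vert a) E y).
  apply: filterS (smooth_near_near sE) => y /smooth_near_diff dy r u w.
  rewrite -(derive_linear_direction _ _ _ dy) scale_row_mx add_row_mx scaler0 addr0 //.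
have [_ E2] := @derive_app_near R _ _ _ (fun y a => 'D_(vert a) E y)
  (fun y => rsubmx y) z (vert b) lB (fun a => smooth_near_diff (smooth_near_derive
    (vert a) sE))
  (smooth_near_diff (smooth_rsubmx z)).
have dr : 'D_(vert b) (fun y : 'rV[R]_(n + n) => rsubmx y : 'rV[R]_n) z = b.
  by rewrite (derive_lin _ (@rsubmx_linear _ _) (f := id)) ?derive_id ?row_mxKr.
rewrite dr in E2.
have E3 := near_eq_derive (vert b) E1; rewrite E2 in E3.
have d2 : differentiable (fun _ : 'rV[R]_(n + n) => 2 :
  R^o) z by exact: differentiable_cst.
have E4 := derive_mul (vert b) (smooth_near_diff sE) d2.
rewrite derive_cst mulr0 addr0 in E4.
have := etrans E3 E4; rewrite mulr_natr mulr2n => /addIr; exact.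
Qed.

Lemma metric_eta_eta z : reg z -> g z (rsubmx z) (rsubmx z) = E z.
Proof. by move=> rz; rewrite metric_eta // euler_sqL // mulKf. Qed.

Lemma metric_linear z a : reg z -> linear_for *%R (g z a).
Proof.
move=> rz r u w; have sE := smooth_sqL rz.
have E1 : \forall y \near z, 'D_(vert (r *: u + w)) E y =
  r * 'D_(vert u) E y + 'D_(vert w) E y.
  apply: filterS (smooth_near_near sE) => y /smooth_near_diff dy.
  by rewrite -(derive_linear_direction _ _ _ dy) scale_row_mx add_row_mx scaler0 addr0.
have su := smooth_near_derive (vert u) sE; have sw := smooth_near_derive (vert w) sE.
have sr : smooth_near (fun _ : 'rV[R]_(n + n) => r : R^o) z by exact: smooth_near_cst.
rewrite /g (near_eq_derive _ E1).
rewrite (derive_add _ (smooth_near_diff (smooth_near_mul sr su)) (smooth_near_diff sw)).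
rewrite (derive_mul _ (smooth_near_diff sr) (smooth_near_diff su)) derive_cst mul0r
  add0r.
by rewrite mulrDr mulrCA.
Qed.

Lemma metric_gt0 z d : reg z -> d != 0 -> 0 < g z d d.
Proof.
move=> rz d0; have pz := slit_chart_cdom gA rz.
pose v := change (A p.1) (A (pt z).1) (pt z).1 d.
have Jv : J z v = d by exact: (changeK gA _ pz (cdom_center gA _)).
rewrite -Jv -fmetricE //; case: L_finsler => _ _ _; apply;
  first exact: (slit_chart_slit gA rz).
by apply: contra d0 => /eqP v0; rewrite -Jv v0; apply/eqP; exact: (linear0 ('d _ _)).
Qed.

Lemma ellE z v : reg z -> ell L (pt z) v = (Lz z)^-1 * g z (rsubmx z) (J z v).
Proof.
move=> rz; apply: (congr1 (fun x => (Lz z)^-1 * x)).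
exact: (etrans (fmetricE (pt z).2 v rz) (congr1 (fun a => g z a (J z v))
  (coord_eta rz))).
Qed.

Lemma hbarE z v w : reg z -> hbar L (pt z) v w =
  g z (J z v) (J z w) - (E z)^-1 * g z (rsubmx z) (J z v) * g z (rsubmx z) (J z w).
Proof.
move=> rz; rewrite /hbar (fmetricE v w rz) (ellE v rz) (ellE w rz) /sqL expr2 invfM.
by rewrite mulrACA mulrA.
Qed.

(** The projection phi read in coordinates: the component orthogonal to y. *)
Definition angular z a := a - ((E z)^-1 * g z (rsubmx z) a) *: rsubmx z.

Lemma pvf_read_phi X z : reg z -> pvf_read A (phi L X) p z =
  angular z (pvf_read A X p z).
Proof.
move=> rz; rewrite (pvf_read_at _ rz) /phi (ellE _ rz) mulrA -invfM -expr2.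
apply: (etrans (linearB ('d _ _) _ _)); congr (_ - _).
apply: (etrans (linearZZ ('d _ _) _ _)); congr (_ *: _).
exact: coord_eta.
Qed.

Lemma metric_eta_angular z a : reg z -> g z (rsubmx z) (angular z a) = 0.
Proof.
move=> rz; rewrite /angular addrC -scaleNr metric_linear // metric_eta_eta //.
by rewrite mulNr mulrAC mulVf ?mul1r ?addNr // gt_eqF // sqL_gt0.
Qed.

Lemma metric_angular z a b : reg z -> g z (angular z a) (angular z b) =
  g z a b - (E z)^-1 * g z (rsubmx z) a * g z (rsubmx z) b.
Proof.
move=> rz; rewrite {2}/angular addrC -scaleNr metric_linear //.
rewrite (metric_sym (angular z a)) // metric_eta_angular // mulr0 add0r.
rewrite metric_sym // /angular addrC -scaleNr metric_linear // (metric_sym b (rsubmx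
  z)) //.
by rewrite (metric_sym b a) // addrC mulNr.
Qed.

Lemma smooth_phi X z : reg z -> smooth_near (pvf_read A X p) z ->
  smooth_near (pvf_read A (phi L X) p) z.
Proof.
move=> rz sX.
apply: (@smooth_near_eq _ _ _ (fun y => pvf_read A X p y -
   ((E y)^-1 * (2^-1 * 'D_(vert (pvf_read A X p y)) E y)) *: rsubmx y)).
  apply: filterS (slit_chart_near gA rz) => y ry.
  by rewrite (pvf_read_phi X ry) /angular (metric_eta _ ry).
have sE := smooth_sqL rz.
apply: smooth_near_sub => //; apply: smooth_near_scale; last exact: smooth_rsubmx.
have sV : smooth_near (fun y => (E y)^-1 : R^o) z.
  by apply: smooth_near_inv => //; rewrite gt_eqF // sqL_gt0.
apply: (smooth_near_mul sV).
have s2 : smooth_near (fun _ : 'rV[R]_(n + n) => 2^-1 :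
  R^o) z by exact: smooth_near_cst.
apply: (smooth_near_mul s2).
apply: (@smooth_near_eq _ _ _ (fun y => \sum_i (pvf_read A X p y 0 i :
  R^o) *: 'D_(vert (delta_mx 0 i)) E y)).
  apply: filterS (smooth_near_near sE) => y /smooth_near_diff dy.
  rewrite (rV_linear_sum (l := fun a => 'D_(vert a) E y)) // => r u w.
  by rewrite -(derive_linear_direction _ _ _ dy) scale_row_mx add_row_mx scaler0 addr0.
apply: smooth_near_sum => i; apply: smooth_near_scale; first exact: smooth_near_coord.
exact: smooth_near_derive.
Qed.

End FinslerReading.

Lemma linear_formE (R : realType) (n : nat) (l : 'rV[R]_n -> R^o) : linear l ->
  (forall u w, l (u - w) = l u - l w) /\ (forall r u, l (r *: u) = r * l u).
Proof.
move=> ll; pose lM := GRing.isLinear.Build _ _ _ _ _ ll.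
pose l' : {linear 'rV[R]_n -> R^o} := HB.pack l lM.
by split=> [u w|r u]; [exact: (linearB l')|exact: (linearZZ l')].
Qed.

(** * The h-curvature under scalar curvature *)

Section ScalarCurvature.
Variables (R : realType) (n : nat) (M : Type) (A : atlas R n M).
Hypothesis gA : smooth_charts A.
Local Notation T := (TM_atlas A).
Let gT : smooth_charts T := TM_smooth_charts gA.
Variables (L : TM R n M -> R) (L_finsler : is_finsler A L).
Variables (D : connection R n M) (D_berwald : is_berwald A L D).
Variables (k : TM R n M -> R) (k_scalar : scalar_curvature A L D k).
Variable p : TM R n M.
Local Notation reg := (slit_chart A p).
Local Notation pt z := (cinv (T p) z).
Local Notation vert b := (row_mx 0 b).
Local Notation J z := (change (A (pt z).1) (A p.1) (pt z).1).
Local Notation G := (berwald_coef A D p).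
Local Notation E := (sqL A L p).
Local Notation g := (metric_read A L p).
Local Notation kz := (fun_read A k p).
Implicit Types (z : 'rV[R]_(n + n)) (X Y Z : pvf R n M).

Let cD : is_connection A D. Proof. by case: D_berwald. Qed.
Let tD : forall u (X Y : tvf R n M), slit u -> smooth_vf_at T X u ->
  smooth_vf_at T Y u ->
  torsion A D X Y u = 0.
Proof. by case: D_berwald. Qed.
Let vD : forall u X Y, slit u -> smooth_pvf_at A X u -> smooth_pvf_at A Y u ->
  vhv_torsion A D X Y u = 0.
Proof. by case: D_berwald. Qed.

Lemma smooth_k z : reg z -> smooth_near kz z.
Proof.
move=> rz; apply/(smooth_fun_read gA _ rz); case: k_scalar => _ H _ _.
exact: H (slit_chart_slit gA rz).
Qed.

(** The deviation tensor k L^2 phi written without division by L, with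
    g(y, b) = 'D_b (L^2) / 2. *)
Definition scalar_jacobi z b : 'rV[R]_n :=
  kz z *: (E z *: b - ('D_(vert b) E z * 2^-1) *: rsubmx z).

Lemma scale_phi (r e d : R) (b y : 'rV[R]_n) : e != 0 ->
  (r * e) *: (b - (e^-1 * (2^-1 * d)) *: y) = r *: (e *: b - (d * 2^-1) *: y).
Proof.
move=> e0; rewrite !scalerBr !scalerA; congr (_ - _ *: y).
by field; rewrite e0.
Qed.

(** The hypothesis on the deviation tensor, evaluated at constant fields. *)
Lemma jacobi_scalar z b : reg z -> jacobi_endo G z b = scalar_jacobi z b.
Proof.
move=> rz; have sb := smooth_pframe gA b rz.
have se := smooth_eta gA rz.
have H := pvf_read_hcurvature gA cD tD rz se sb se.
rewrite (pvf_read_eta gA rz) (pvf_read_frame gA _ rz) in H.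
rewrite /jacobi_endo; apply: (etrans (esym H)).
have [_ _ _ dv] := k_scalar.
have := dv _ _ (slit_chart_slit gA rz) ((smooth_pvf_read gA _ rz).2 sb) => Hd.
have E1 : pvf_read A (deviation A D (pframe A p b)) p z =
   (kz z * E z) *: angular A L p z b.
  rewrite (pvf_read_at _ rz) Hd; apply: (etrans (linearZZ ('d _ _) _ _)).
  congr (_ *: _).
  have := pvf_read_phi gA L (pframe A p b) rz.
  by rewrite (pvf_read_frame gA _ rz).
apply: (etrans E1); rewrite /angular (metric_eta gA L_finsler b rz) /scalar_jacobi.
have E0 : E z != 0 by rewrite gt_eqF // (sqL_gt0 gA L_finsler rz).
exact: scale_phi.
Qed.

Lemma smooth_scalar_jacobi z b : reg z -> smooth_near (scalar_jacobi ^~ b) z.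
Proof.
move=> rz; have sE := smooth_sqL gA L_finsler rz.
apply: smooth_near_scale; first exact: smooth_k.
apply: smooth_near_sub.
  by apply: smooth_near_scale => //; exact: smooth_near_cst.
apply: smooth_near_scale; last exact: smooth_rsubmx.
apply: (smooth_near_mul (smooth_near_derive _ sE)).
exact: smooth_near_cst.
Qed.

Lemma hcurv_scalar z a b c : reg z ->
  3 *: hcurv G z a b c =
  'D_(vert c) ('D_(vert a) (scalar_jacobi ^~ b)) z
  - 'D_(vert c) ('D_(vert b) (scalar_jacobi ^~ a)) z.
Proof.
move=> rz.
have H := hcurv_jacobi (O := reg) (@slit_chart_open R n M A gA p) (berwald_coef_linear
  A D p) (berwald_coef_linearl A D p)
  (berwald_coef_smooth gA cD (p := p)) (berwald_coef_sym gA cD tD (p := p))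
  (berwald_coef_vert gA cD tD vD (p := p)) a b c (h := scalar_jacobi) (fun y d =>
    @jacobi_scalar y d)
  (fun d => smooth_scalar_jacobi d rz) rz.
exact: H.
Qed.

Lemma metric_linear_left z d : reg z -> linear (fun v => g z v d : R^o).
Proof.
move=> rz r u w; rewrite !(metric_sym gA L_finsler _ d rz).
exact: (metric_linear gA L_finsler d rz).
Qed.

Lemma double_half (x : R) : x = 2 * (2^-1 * x).
Proof. by rewrite mulVKf // pnatr_eq0. Qed.

Lemma second_derivative_scalar (x e r ca bd ab cd cb ad : R) :
  x * (e * bd) + r * (2 * ca * bd - (2 * ab * cd + 2 * cb * ad) * 2^-1) =
  e * x * bd + r * (2 * ca * bd - ab * cd - cb * ad).
Proof. by field. Qed.

(** Pairing with a vector d orthogonal to y turns the vector-valued derivative into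
    the scalar one of [derive2_jacobi]; the derivative of y is then the constant
    g(-, d), taken at the fixed point z. *)
Lemma derive2_scalar_jacobi z a b c d : reg z ->
  g z (rsubmx z) a = 0 -> g z (rsubmx z) b = 0 -> g z (rsubmx z) c = 0 ->
  g z (rsubmx z) d = 0 ->
  g z ('D_(vert c) ('D_(vert a) (scalar_jacobi ^~ b)) z) d =
  E z * 'D_(vert c) ('D_(vert a) kz) z * g z b d
  + kz z * (2 * g z c a * g z b d - g z a b * g z c d - g z c b * g z a d).
Proof.
move=> rz ya yb yc yd; have sE := smooth_sqL gA L_finsler rz.
have ll := metric_linear_left d rz.
(* The metric is frozen at z, so that l is linear and can be differentiated through. *)
pose l v : R^o := g z v d.
have sh := smooth_scalar_jacobi b rz.
have dl (f : 'rV[R]_(n + n) -> 'rV[R]_n) (x v : 'rV[R]_(n + n)) : smooth_near f x ->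
  'D_v (fun y => l (f y)) x = l ('D_v f x).
  by move=> sf; exact: (derive_lin v ll (smooth_near_diff sf)).
have E1 : \forall y \near z, 'D_(vert a) (fun y => l (scalar_jacobi y b)) y =
    l ('D_(vert a) (scalar_jacobi ^~ b) y).
  by apply: filterS (smooth_near_near sh) => y sy; exact: dl.
have E2 : l ('D_(vert c) ('D_(vert a) (scalar_jacobi ^~ b)) z) =
   'D_(vert c) ('D_(vert a) (fun y => l (scalar_jacobi y b))) z.
  apply: (etrans (esym (dl _ _ (vert c) (smooth_near_derive (vert a) sh)))).
  exact: (esym (near_eq_derive _ E1)).
pose m (y : 'rV[R]_(n + n)) : R^o := l (rsubmx y).
have sm : smooth_near m z := smooth_near_linear ll (smooth_rsubmx z).
have mD v y : 'D_(vert v) m y = l v.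
  rewrite (dl _ _ _ (smooth_rsubmx y)); congr l.
  by rewrite (derive_lin _ (@rsubmx_linear _ _) (f := id)) ?derive_id ?row_mxKr.
have E3 : (fun y => l (scalar_jacobi y b)) =
  (fun y => kz y * (E y * l b - 'D_(vert b) E y * m y * 2^-1) : R^o).
  apply/funext => y.
  have [lB lZ] := linear_formE (ll : linear l).
  rewrite /scalar_jacobi lZ lB !lZ.
  exact: (congr1 (fun x => kz y * (E y * l b - x)) (mulrAC _ _ _)).
have D0 v : g z (rsubmx z) v = 0 -> 'D_(vert v) E z = 0.
  rewrite (metric_eta gA L_finsler v rz) => /eqP; rewrite mulf_eq0 invr_eq0 pnatr_eq0
    /=.
  by move/eqP.
have sDE := smooth_near_derive (vert b) sE.
apply: (etrans E2); rewrite E3.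
have H := derive2_jacobi (l b) (smooth_k rz) sE sDE sm (mD a) (mD c z)
   (D0 a ya) (D0 c yc) (D0 b yb) yd.
apply: (etrans H).
have gD u v : 'D_(vert u) ('D_(vert v) E) z = 2 * g z u v.
  exact: double_half.
have H1 := congr2 (fun x y => x * l c + y * l a) (gD a b) (gD c b).
have H2 := congr2 (fun x y => x * l b - y * 2^-1) (gD c a) H1.
apply: (etrans (congr1 (fun x => _ + kz z * x) H2)).
exact: second_derivative_scalar.
Qed.

Lemma antisym_scalar (x x' e r ac bc ab ad bd cd : R) :
  e * x * bd + r * (2 * ac * bd - ab * cd - bc * ad)
  - (e * x' * ad + r * (2 * bc * ad - ab * cd - ac * bd)) =
  e * (x * bd - x' * ad) + 3 * r * (ac * bd - bc * ad).
Proof. by ring. Qed.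

(** The antisymmetrization of [derive2_scalar_jacobi], as [hcurv_scalar] says. *)
Lemma metric_hcurv z a b c d : reg z ->
  g z (rsubmx z) a = 0 -> g z (rsubmx z) b = 0 -> g z (rsubmx z) c = 0 ->
  g z (rsubmx z) d = 0 ->
  3 * g z (hcurv G z a b c) d =
  E z * ('D_(vert c) ('D_(vert a) kz) z * g z b d - 'D_(vert c) ('D_(vert b) kz)
    z * g z a d)
  + 3 * kz z * (g z a c * g z b d - g z b c * g z a d).
Proof.
move=> rz ya yb yc yd; have ll := metric_linear_left d rz.
have [lB lZ] := linear_formE ll.
have E1 : 3 * g z (hcurv G z a b c) d = g z (3 *: hcurv G z a b c) d.
  exact: (esym (lZ 3 _)).
apply: (etrans E1).
apply: (etrans (congr1 (fun v => g z v d) (hcurv_scalar a b c rz))).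
apply: (etrans (lB _ _)).
have H1 := derive2_scalar_jacobi rz ya yb yc yd.
have H2 := derive2_scalar_jacobi rz yb ya yc yd.
apply: (etrans (congr2 (fun x y => x - y) H1 H2)).
rewrite (metric_sym gA L_finsler b a rz) (metric_sym gA L_finsler c a rz)
  (metric_sym gA L_finsler c b rz).
exact: antisym_scalar.
Qed.

Lemma square_scalar (l x y : R) : l * (l * (x + y) - l * y) = l ^+ 2 * x.
Proof. by ring. Qed.

(** The covariant derivative removes the term coming from the variation of Y, and
    the derivative of the factor L vanishes because X is orthogonal to y. *)
Lemma vcov_Ctensor X Y z : reg z ->
  smooth_near (pvf_read A X p) z -> smooth_near (pvf_read A Y p) z ->
  g z (rsubmx z) (pvf_read A X p z) = 0 ->
  L (pt z) * vcov1 A D (Ctensor A L k) X Y (pt z) =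
  E z * 'D_(vert (pvf_read A X p z)) ('D_(vert (pvf_read A Y p z)) kz) z.
Proof.
move=> rz sX sY aE; pose a := pvf_read A X p z; pose b := pvf_read A Y p z.
have CE W y : reg y -> Ctensor A L k W (pt y) =
    fun_read A L p y * 'D_(vert (pvf_read A W p y)) kz y.
  move=> ry; apply: (congr1 (fun x => fun_read A L p y * x)); rewrite /vcov0.
  apply: (etrans (dir_fun_read gA _ ry (smooth_k ry))).
  by rewrite -(tvf_read_gam gA W ry).
have E1 : \forall y \near z, fun_read A (Ctensor A L k Y) p y =
    fun_read A L p y * 'D_(vert (pvf_read A Y p y)) kz y.
  by apply: filterS (slit_chart_near gA rz) => y ry; exact: CE.
have sk := smooth_k rz; have sL := smooth_L gA L_finsler rz.
have lB : \forall y \near z, linear (fun a => 'D_(vert a) kz y).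
  apply: filterS (smooth_near_near sk) => y /smooth_near_diff dy r u w.
  by rewrite -(derive_linear_direction _ _ _ dy) scale_row_mx add_row_mx scaler0 addr0.
have [dD ED] := @derive_app_near R _ _ _ (fun y a => 'D_(vert a) kz y)
  (pvf_read A Y p) z (vert a) lB (fun a => smooth_near_diff (smooth_near_derive
    (vert a) sk))
  (smooth_near_diff sY).
have sDk : smooth_near (fun y => 'D_(vert (pvf_read A Y p y)) kz y) z.
  apply: (@smooth_near_eq _ _ _ (fun y => \sum_i (pvf_read A Y p y 0 i :
    R^o) *: 'D_(vert (delta_mx 0 i)) kz y)).
    by apply: filterS lB => y ly; rewrite (rV_linear_sum ly).
  apply: smooth_near_sum => i; apply: smooth_near_scale; first exact: smooth_near_coord.
  exact: smooth_near_derive.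
have sC : smooth_near (fun_read A (Ctensor A L k Y) p) z.
  apply: (@smooth_near_eq _ _ _ (fun y => fun_read A L p y * 'D_(vert (pvf_read A Y p
    y)) kz y)).
    by apply: filterS E1 => y ->.
  exact: (smooth_near_mul sL sDk).
have F1 : dir T (Ctensor A L k Y) (pt z) (gam_vf A X (pt z)) =
   'D_(vert a) (fun_read A L p) z * 'D_(vert b) kz z
   + fun_read A L p z * ('D_(vert a) ('D_(vert b) kz) z
      + 'D_(vert ('D_(vert a) (pvf_read A Y p) z)) kz z).
  apply: (etrans (dir_fun_read gA _ rz sC)).
  rewrite -[X in 'D_X _ _](_ : tvf_read A (gam_vf A X) p z =
    _) // (tvf_read_gam gA _ rz).
  rewrite (near_eq_derive _ E1).
  apply: (etrans (derive_mul _ (smooth_near_diff sL) dD)).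
  exact: (congr1 (fun x => _ + fun_read A L p z * x) ED).
have F2 : pvf_read A (cov D (gam_vf A X) Y) p z = 'D_(vert a) (pvf_read A Y p) z.
  rewrite (pvf_read_cov_berwald gA cD tD _ rz sY) (tvf_read_gam gA _ rz) row_mxKl.
  have -> : G z 0 (pvf_read A Y p z) = 0.
    exact: (@G_0r R n (fun z a b => G z b a) (fun z a =>
      berwald_coef_linearl A D p z a) z _).
  by rewrite addr0.
have La : 'D_(vert a) (fun_read A L p) z = 0.
  have dL := smooth_near_diff sL.
  have := derive_mul (vert a) dL dL.
  have L0 := L_gt0 gA L_finsler rz.
  have Ea : 'D_(vert a) E z = 0.
    move: aE; rewrite (metric_eta gA L_finsler _ rz) => /eqP.
    by rewrite mulf_eq0 invr_eq0 pnatr_eq0 /= => /eqP.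
  rewrite (_ : 'D_(vert a) _ z = 0); last exact: Ea.
  rewrite mulrC -mulr2n => /esym/eqP; rewrite mulrn_eq0 /= mulf_eq0 gt_eqF //=.
  by move/eqP.
have F3 := etrans (CE (cov D (gam_vf A X) Y) z rz)
  (congr1 (fun v => fun_read A L p z * 'D_(vert v) kz z) F2).
rewrite La mul0r add0r in F1.
apply: (etrans (congr2 (fun x y => L (pt z) * (x - y)) F1 F3)).
exact: square_scalar.
Qed.

Lemma BtensorE X Y z : reg z ->
  smooth_near (pvf_read A X p) z -> smooth_near (pvf_read A Y p) z ->
  Btensor A L D k X Y (pt z) =
  E z * 'D_(vert (angular A L p z (pvf_read A X p z)))
           ('D_(vert (angular A L p z (pvf_read A Y p z))) kz) z.
Proof.
move=> rz sX sY.
have pX := pvf_read_phi gA L X rz; have pY := pvf_read_phi gA L Y rz.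
have aE : g z (rsubmx z) (pvf_read A (phi L X) p z) = 0.
  exact: (etrans (congr1 (g z (rsubmx z)) pX) (metric_eta_angular gA L_finsler
    (pvf_read A X p z) rz)).
have H := vcov_Ctensor rz (smooth_phi gA L_finsler rz sX) (smooth_phi gA L_finsler rz
  sY) aE.
apply: (etrans H).
exact: (congr2 (fun a b => E z * 'D_(vert a) ('D_(vert b) kz) z) pX pY).
Qed.

End ScalarCurvature.

(** The values of l1 and l2 on the basis form a matrix with two columns, which has
    a nonzero left kernel as soon as it has more than two rows. *)
Lemma common_kernel (R : realType) (n : nat) (l1 l2 : 'rV[R]_n -> R^o) :
  (2 < n)%N -> linear l1 -> linear l2 ->
  exists2 d, d != 0 & l1 d = 0 /\ l2 d = 0.
Proof.
move=> n2 ll1 ll2.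
pose K : 'M[R]_(n, 2) := \matrix_(i, j) if j == 0 then l1 (delta_mx 0 i)
  else l2 (delta_mx 0 i).
have : kermx K != 0.
  rewrite -mxrank_eq0 mxrank_ker -lt0n subn_gt0.
  exact: leq_ltn_trans (rank_leq_col K) n2.
case/rowV0Pn => d /sub_kermxP dK d0; exists d => //.
have E (l : 'rV[R]_n -> R^o) j : linear l -> (forall i, K i j = l (delta_mx 0 i)) ->
  l d = 0.
  move=> ll Kl; rewrite (rV_linear_sum ll).
  have := congr1 (fun A : 'rV[R]_2 => A 0 j) dK; rewrite !mxE => S0; rewrite -[RHS]S0.
  by apply: eq_bigr => i _; rewrite -Kl.
by split; [apply: (E l1 0)|apply: (E l2 1)] => // i; rewrite mxE.
Qed.

(** * The projected h-curvature and the equivalence *)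

Section Equivalence.
Variables (R : realType) (n : nat) (M : Type) (A : atlas R n M).
Hypothesis gA : smooth_charts A.
Local Notation T := (TM_atlas A).
Variables (L : TM R n M -> R) (L_finsler : is_finsler A L).
Variables (D : connection R n M) (D_berwald : is_berwald A L D).
Variables (k : TM R n M -> R) (k_scalar : scalar_curvature A L D k).
Variable p : TM R n M.
Local Notation reg := (slit_chart A p).
Local Notation pt z := (cinv (T p) z).
Local Notation vert b := (row_mx 0 b).
Local Notation G := (berwald_coef A D p).
Local Notation E := (sqL A L p).
Local Notation g := (metric_read A L p).
Local Notation kz := (fun_read A k p).
Local Notation proj := (angular A L p).
Implicit Types (z : 'rV[R]_(n + n)) (X Y Z W : pvf R n M).

Lemma proj4E X Y Z W z : reg z ->
  smooth_near (pvf_read A X p) z -> smooth_near (pvf_read A Y p) z ->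
  smooth_near (pvf_read A Z p) z ->
  proj4 L (h_curvature4 A L D) X Y Z W (pt z) =
  g z (hcurv G z (proj z (pvf_read A X p z)) (proj z (pvf_read A Y p z))
    (proj z (pvf_read A Z p z)))
    (proj z (pvf_read A W p z)).
Proof.
move=> rz sX sY sZ; have [cD _ tD _ _] := D_berwald.
have f := smooth_phi gA L_finsler rz.
have H := pvf_read_hcurvature gA cD tD rz (f _ sX) (f _ sY) (f _ sZ).
have H' := etrans H (f_equal3 (hcurv G z) (pvf_read_phi gA L X rz) (pvf_read_phi gA L
  Y rz)
  (pvf_read_phi gA L Z rz)).
apply: (etrans (fmetricE gA L _ _ rz)).
exact: (congr2 (g z) H' (pvf_read_phi gA L W rz)).
Qed.

Lemma hbar_proj X Y z : reg z ->
  hbar L (pt z) (X (pt z)) (Y (pt z)) = g z (proj z (pvf_read A X p z))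
    (proj z (pvf_read A Y p z)).
Proof.
by move=> rz; rewrite (hbarE gA L _ _ rz) (metric_angular gA L_finsler _ _ rz).
Qed.

Lemma assemble_scalar (r : R) (e x x' b b' yw xw xz yz yw' xw' xz' yz' : R) :
  b = e * x -> b' = e * x' -> yw = yw' -> xw = xw' -> xz = xz' -> yz = yz' ->
  e * (x * yw' - x' * xw') + 3 * r * (xz' * yw' - yz' * xw') =
  b * yw - b' * xw + 3 * r * (xz * yw - yz * xw).
Proof. by move=> -> -> -> -> -> ->; ring. Qed.

(** Projected fields are orthogonal to eta, so [metric_hcurv] applies, and by
    [BtensorE] the second derivatives of k it contains are values of B^k. *)
Lemma proj4_B X Y Z W z : reg z ->
  smooth_near (pvf_read A X p) z -> smooth_near (pvf_read A Y p) z ->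
  smooth_near (pvf_read A Z p) z ->
  let h X Y := hbar L (pt z) (X (pt z)) (Y (pt z)) in
  let B X Y := Btensor A L D k X Y (pt z) in
  3 * proj4 L (h_curvature4 A L D) X Y Z W (pt z) =
  B Z X * h Y W - B Z Y * h X W + 3 * k (pt z) * (h X Z * h Y W - h Y Z * h X W).
Proof.
move=> rz sX sY sZ h B.
have f v := metric_eta_angular gA L_finsler v rz.
have H := metric_hcurv gA L_finsler D_berwald k_scalar rz (f (pvf_read A X p z))
  (f (pvf_read A Y p z))
  (f (pvf_read A Z p z)) (f (pvf_read A W p z)).
apply: (etrans (congr1 (fun x => 3 * x) (proj4E W rz sX sY sZ))).
apply: (etrans H).
have hE V V' : h V V' = _ := hbar_proj V V' rz.
have BX : B Z X = _ := BtensorE gA L_finsler D_berwald k_scalar rz sZ sX.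
have BY : B Z Y = _ := BtensorE gA L_finsler D_berwald k_scalar rz sZ sY.
exact: (assemble_scalar (k (pt z)) BX BY (hE Y W) (hE X W) (hE X Z) (hE Y Z)).
Qed.

End Equivalence.

(** In [proj4_B] with W in the place of Y, orthogonality of W to the field in the
    first slot leaves only multiples of w = h(W,W). *)
Lemma solve_B (R : realType) (r e P b b' w yx wx yw xy : R) :
  0 < w -> yw = 0 -> yx = xy -> P = e * (yx * w - wx * yw) ->
  3 * P = b * w - b' * yw + 3 * r * (yx * w - wx * yw) ->
  b = 3 * (e - r) * xy.
Proof.
move=> w0 -> -> ->; rewrite !mulr0 !subr0 => H.
apply: (mulIf (lt0r_neq0 w0)); apply: (addIr (3 * r * (xy * w))).
by rewrite -H; ring.
Qed.

Lemma solve_proj4 (R : realType) (r e P b b' xz yz zx zy xw yw : R) :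
  zx = xz -> zy = yz -> b = 3 * (e - r) * zx -> b' = 3 * (e - r) * zy ->
  3 * P = b * yw - b' * xw + 3 * r * (xz * yw - yz * xw) ->
  P = e * (xz * yw - yz * xw).
Proof.
have n3 : (3 : R) != 0 by rewrite pnatr_eq0.
by move=> -> -> -> -> H; apply: (mulfI n3); rewrite H; ring.
Qed.

Theorem theorem3p1 (R : realType) (n : nat) (M : topologicalType)
    (A : atlas R n M) (L : TM R n M -> R) (D : connection R n M)
    (k eps : TM R n M -> R)
    (n_ge4 : (4 <= n)%N)
    (M_mfd : is_smooth_manifold A)
    (L_finsler : is_finsler A L)
    (D_berwald : is_berwald A L D)
    (k_scalar : scalar_curvature A L D k)
    (eps_smooth : smooth_on_slit A eps)
    (eps_hom : pos_homogeneous0 eps) :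
  Hp_scalar_curvature A L D eps <->
  (forall u X Y, slit u -> smooth_pvf_at A X u -> smooth_pvf_at A Y u ->
     Btensor A L D k X Y u = 3 * (eps u - k u) * hbar L u (X u) (Y u)).
Proof.
have gA := manifold_smooth_charts M_mfd.
have at_center u : slit u -> exists2 z, slit_chart A u z & cinv (TM_atlas A u) z = u.
  move=> su; exists (cmap (TM_atlas A u) u); first exact: slit_chart_center.
  exact: (cinvK (TM_smooth_charts gA) (cdom_center (TM_smooth_charts gA) u)).
have Bcurv u X Y Z W : slit u ->
    smooth_pvf_at A X u -> smooth_pvf_at A Y u -> smooth_pvf_at A Z u ->
    let h X Y := hbar L u (X u) (Y u) in
    let B X Y := Btensor A L D k X Y u in
    3 * proj4 L (h_curvature4 A L D) X Y Z W u =
    B Z X * h Y W - B Z Y * h X W + 3 * k u * (h X Z * h Y W - h Y Z * h X W).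
  move=> su; have [z rz zu] := at_center u su; rewrite -{1 2 3}zu => sX sY sZ.
  have H := proj4_B gA L_finsler D_berwald k_scalar W rz
    ((smooth_pvf_read gA X rz).1 sX) ((smooth_pvf_read gA Y rz).1 sY)
      ((smooth_pvf_read gA Z rz).1 sZ).
  by rewrite zu in H.
split=> [[_ _ _ Hp] u X Y su sX sY|HB].
- have [z rz zu] := at_center u su.
  (* d is chosen orthogonal to y and to the projection of Y, and W extends it. *)
  pose a := angular A L u z (pvf_read A Y u z).
  have [d d0 [yd ad]] := common_kernel (ltnW n_ge4)
    (metric_linear gA L_finsler (rsubmx z) rz) (metric_linear gA L_finsler a rz).
  pose W := pframe A u d.
  have sW : smooth_pvf_at A W u.
    by have := (smooth_pvf_read gA W rz).2 (smooth_pframe gA d rz); rewrite zu.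
  have prW : angular A L u z (pvf_read A W u z) = d.
    by rewrite (pvf_read_frame gA d rz) /angular yd mulr0 scale0r subr0.
  have hE V V' : hbar L u (V u) (V' u) =
     metric_read A L u z (angular A L u z (pvf_read A V u z))
       (angular A L u z (pvf_read A V' u z)).
    by have := hbar_proj gA L_finsler V V' rz; rewrite zu.
  have hYW : hbar L u (Y u) (W u) = 0 by rewrite hE prW.
  have hWW : 0 < hbar L u (W u) (W u) by rewrite hE prW;
    exact: (metric_gt0 gA L_finsler rz).
  have hs : hbar L u (Y u) (X u) = hbar L u (X u) (Y u).
    exact: (etrans (hE Y X) (etrans (metric_sym gA L_finsler _ _ rz) (esym (hE X Y)))).
  exact: (solve_B hWW hYW hs (Hp u Y W X W su sY sW sX sW) (Bcurv u Y W X W su sY sW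
    sX)).
- split=> // u X Y Z W su sX sY sZ sW.
  have [z rz zu] := at_center u su.
  have hs V V' : hbar L u (V u) (V' u) = hbar L u (V' u) (V u).
    have H1 := hbar_proj gA L_finsler V V' rz; have H2 :=
      hbar_proj gA L_finsler V' V rz.
    rewrite zu in H1; rewrite zu in H2.
    exact: (etrans H1 (etrans (metric_sym gA L_finsler _ _ rz) (esym H2))).
  exact: (solve_proj4 (hs Z X) (hs Z Y) (HB u Z X su sZ sX) (HB u Z Y su sZ sY)
    (Bcurv u X Y Z W su sX sY sZ)).
Qed.
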